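(* In the interactive effects panel model described in the context, let $q=1$, so that $\boldsymbol{\Lambda}_0'=(1,\boldsymbol{\lambda}_0')$. Assume: (A1) the vectors $\boldsymbol{v}_i := (\boldsymbol{z}_i',\boldsymbol{a}_i',\boldsymbol{\epsilon}_i')'$ $(i=1,\ldots,n)$ are independently and identically distributed; (A2$^*$) the entries in $\boldsymbol{v}_i$ have finite fourth moments; (A3) $E(\boldsymbol{z}_1\boldsymbol{\epsilon}_1')=\boldsymbol{0}$; (A4) $\mathrm{Var}(\boldsymbol{z}_1)$ is positive definite; (A5) for each $\boldsymbol{\psi}\in\boldsymbol{\Psi}$ with $\boldsymbol{\psi}\neq\boldsymbol{\psi}_0$ there is at least one $t\in\{1,\ldots,T\}$ such that $\boldsymbol{\pi}_t(\boldsymbol{\psi})\neq\boldsymbol{\pi}_t(\boldsymbol{\psi}_0)$. Suppose that (A) $\boldsymbol{\Lambda}_0=\boldsymbol{\iota}_T$ is true, or (B) $\boldsymbol{\Phi}_{0t}^{x}=\boldsymbol{\Phi}_0^{x}$ for all $t$ (i.e. $\boldsymbol{\Phi}_{0t}^{x}$ does not depend on $t$) is true, or both (A) and (B) are true. Then $$\sqrt n\begin{pmatrix}\widehat{\boldsymbol{\psi}}-\boldsymbol{\psi}_0\\ \widehat{\boldsymbol{\beta}}_{FE}-\boldsymbol{\beta}_0\end{pmatrix}\rightarrow_d N\left(\boldsymbol{0},(\boldsymbol{H}_0^{+})^{-1}\boldsymbol{A}_0^{+}(\boldsymbol{H}_0^{+})^{-1}\right)\qquad(n\to\infty,\ T\text{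 fixed}),$$ where $\boldsymbol{H}_0^{+}=E(\boldsymbol{R}_1^{+\prime}\boldsymbol{R}_1^{+})$, $\boldsymbol{R}_i^{+}:=\mathrm{diag}(\boldsymbol{R}_i^{*},\boldsymbol{Q}\boldsymbol{X}_i^{*})$ (block diagonal), $\boldsymbol{A}_0^{+}:=E(\boldsymbol{R}_1^{+\prime}\boldsymbol{u}_1^{+}\boldsymbol{u}_1^{+\prime}\boldsymbol{R}_1^{+})$, and $\boldsymbol{u}_i^{+\prime}:=(\boldsymbol{u}_i',(\boldsymbol{y}_i^{*}-\boldsymbol{X}_i^{*}\boldsymbol{\beta}_0)')$.
   Context: Model (case $q=1$). For individuals $i=1,\ldots,n$ and periods $t=1,\ldots,T$ ($T\geq 2$), $$\boldsymbol{y}_i=\boldsymbol{X}_i\boldsymbol{\beta}_0+\boldsymbol{\delta}_0+\boldsymbol{\Phi}_0\widetilde{\eta}_i+\boldsymbol{\epsilon}_i,$$ where $\boldsymbol{y}_i=(y_{i1},\ldots,y_{iT})'$, $\boldsymbol{X}_i$ is the $T\times K$ random matrix with $t$th row $\boldsymbol{x}_{it}'$, $\boldsymbol{\beta}_0\in\mathbb{R}^K$ and $\boldsymbol{\delta}_0\in\mathbb{R}^T$ are fixed parameters, $\boldsymbol{\Phi}_0=(\phi_{01},\ldots,\phi_{0T})'$ is a fixed $T\times 1$ vector with $\phi_{01}\ne0$, $\widetilde{\eta}_i$ is an unobserved scalar random variable with $E(\widetilde{\eta}_i)=0$ and nonzero variance, and $\boldsymbol{\epsilon}_i=(\epsilon_{i1},\ldots,\epsilon_{iT})'$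 is an unobserved error vector. Standing assumption: $E(\epsilon_{it}\mid\boldsymbol{x}_{it},\delta_{0t},\phi_{0t}\widetilde{\eta}_i)=0$ (so $E(\boldsymbol{\epsilon}_i)=\boldsymbol{0}$). Put $\eta_i:=\phi_{01}\widetilde{\eta}_i$, $\boldsymbol{\lambda}_0:=(\phi_{02},\ldots,\phi_{0T})'/\phi_{01}$, $\boldsymbol{\Lambda}_0':=(1,\boldsymbol{\lambda}_0')$, so $\boldsymbol{\Lambda}_0\eta_i=\boldsymbol{\Phi}_0\widetilde{\eta}_i$. $\boldsymbol{\iota}_T$ is the $T\times1$ vector of ones. Factor loadings of the regressors. $\boldsymbol{\Phi}_{0t}^{x}:=\mathrm{Var}(\widetilde{\eta}_i)^{-1}\mathrm{Cov}(\widetilde{\eta}_i,\boldsymbol{x}_{it})$ (a $1\times K$ row), so that $\boldsymbol{x}_{it}=\boldsymbol{\delta}_{0t}^{x}+\boldsymbol{\Phi}_{0t}^{x\prime}\widetilde{\eta}_i+\boldsymbol{\epsilon}_{it}^{x}$ with $\boldsymbol{\delta}_{0t}^x = E(\boldsymbol{x}_{it})$ and $E(\widetilde{\eta}_i\boldsymbol{\epsilon}_{it}^{x\prime})=\boldsymbol{0}$. Projection. $\boldsymbol{z}_i$ is the $m\times1$ vector of all distinct entries of $(\boldsymbol{x}_{i1}',\ldots,\boldsymbol{x}_{iT}')'$ (with further entries removed, if needed, until $E(\boldsymbol{z}_i\boldsymbol{z}_i')$ has full rank). Thus for each $t$ there is a constant $m\times K$ matrix $\boldsymbol{S}_t$ (a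 0/1 selection matrix when every entry of $\boldsymbol{x}_{it}$ is an entry of $\boldsymbol{z}_i$) such that, after subtracting means from both sides, $\boldsymbol{x}_{it}$ equals $\boldsymbol{S}_t'\boldsymbol{z}_i$. The linear projection of $\eta_i$ on $1$ and $\boldsymbol{z}_i$ is $\eta_i=\mu_0+\boldsymbol{z}_i'\boldsymbol{\theta}_0+a_i$, with $\boldsymbol{\theta}_0=\mathrm{Var}(\boldsymbol{z}_i)^{-1}\mathrm{Cov}(\boldsymbol{z}_i,\eta_i)$ and $\mu_0=-E(\boldsymbol{z}_i')\boldsymbol{\theta}_0$; so $a_i$ has mean zero and is uncorrelated with $\boldsymbol{z}_i$. Write $\boldsymbol{a}_i=a_i$, $\boldsymbol{u}_i=\boldsymbol{\Lambda}_0a_i+\boldsymbol{\epsilon}_i$, and $\boldsymbol{\psi}_0=(\boldsymbol{\beta}_0',\boldsymbol{\theta}_0',\boldsymbol{\lambda}_0')'$. Estimators. A generic parameter is $\boldsymbol{\psi}=(\boldsymbol{\beta}',\boldsymbol{\theta}',\boldsymbol{\lambda}')'\in\boldsymbol{\Psi}\subseteq\mathbb{R}^p$, $p=K+m+T-1$, with $\boldsymbol{\beta}\in\mathbb{R}^K$, $\boldsymbol{\theta}\in\mathbb{R}^m$, $\boldsymbol{\lambda}=(\lambda_2,\ldots,\lambda_T)'$, $\lambda_1:=1$, $\boldsymbol{\Lambda}'=(1,\boldsymbol{\lambda}')$; $\boldsymbol{\psi}_0\in\boldsymbol{\Psi}$. A dot denotes cross-sectional demeaning, e.g. $\dot{\boldsymbol{X}}_i=\boldsymbol{X}_i-\frac1n\sum_{j=1}^n\boldsymbol{X}_j$,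 and likewise $\dot{\boldsymbol{y}}_i,\dot{\boldsymbol{z}}_i$. $\widehat{\boldsymbol{\psi}}$ is the (measurable) minimizer, over a compact set $\overline{\boldsymbol{\Psi}}\subseteq\boldsymbol{\Psi}$ with $\boldsymbol{\psi}_0$ in its interior, of $$S_n(\boldsymbol{\psi})=\frac1{2n}\sum_{i=1}^n\left\|\dot{\boldsymbol{y}}_i-\dot{\boldsymbol{X}}_i\boldsymbol{\beta}-\boldsymbol{\Lambda}\dot{\boldsymbol{z}}_i'\boldsymbol{\theta}\right\|^2=\frac1{2n}\sum_{i=1}^n\sum_{t=1}^T\left(\dot y_{it}-\dot{\boldsymbol{z}}_i'\boldsymbol{\pi}_t(\boldsymbol{\psi})\right)^2,\qquad \boldsymbol{\pi}_t(\boldsymbol{\psi}):=\boldsymbol{S}_t\boldsymbol{\beta}+\lambda_t\boldsymbol{\theta}.$$ The two-way fixed effects (TWFE) estimator is $\widehat{\boldsymbol{\beta}}_{FE}=\left(\sum_i\dot{\boldsymbol{X}}_i'\boldsymbol{Q}\dot{\boldsymbol{X}}_i\right)^{-1}\sum_i\dot{\boldsymbol{X}}_i'\boldsymbol{Q}\dot{\boldsymbol{y}}_i$ with $\boldsymbol{Q}:=\boldsymbol{I}_T-\boldsymbol{\iota}_T(\boldsymbol{\iota}_T'\boldsymbol{\iota}_T)^{-1}\boldsymbol{\iota}_T'$. It is implicit that the TWFE estimator is well defined asymptotically, i.e. that $E(\boldsymbol{X}_1^{*\prime}\boldsymbol{Q}\boldsymbol{X}_1^{*})$ is nonsingular. Other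 notation. $\boldsymbol{X}_i^{*}:=\boldsymbol{X}_i-E(\boldsymbol{X}_1)$, $\boldsymbol{y}_i^{*}:=\boldsymbol{y}_i-E(\boldsymbol{y}_1)$. With $\boldsymbol{X}_{2i}$ the last $T-1$ rows of $\boldsymbol{X}_i$, $$\boldsymbol{R}_i:=\begin{pmatrix}\boldsymbol{x}_{i1}'&\boldsymbol{z}_i'&\boldsymbol{0}\\ \boldsymbol{X}_{2i}&\boldsymbol{\lambda}_0\boldsymbol{z}_i'&(\boldsymbol{z}_i'\boldsymbol{\theta}_0)\boldsymbol{I}_{T-1}\end{pmatrix}\ (T\times p),\qquad \boldsymbol{R}_i^{*}:=\boldsymbol{R}_i-E(\boldsymbol{R}_1).$$
   Formalization: The formal theorem additionally assumes that E(R_1*'R_1* ), the first block of H_0^+, is nonsingular; (A1)-(A5) do not imply this (global identification can hold with a singular derivative), and otherwise (H_0^+)^{-1} is undefined. *)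

(* Defs.v *)
From HB Require Import structures.
From mathcomp Require Import all_boot all_order all_algebra.
From mathcomp Require Import all_classical all_reals all_analysis.

Set Implicit Arguments.
Unset Strict Implicit.
Unset Printing Implicit Defensive.
Import Order.TTheory GRing.Theory Num.Theory.
Import numFieldNormedType.Exports.

Local Open Scope classical_set_scope.
Local Open Scope ring_scope.

Definition borel_mx (R : realType) (m n : nat) :=
  g_sigma_algebraType (@open 'M[R]_(m, n)).

Section random_matrices.
Context {d : measure_display} {Omega : measurableType d} {R : realType}.
Variable P : probability Omega R.

Definition measurable_mx m n (X : Omega -> 'M[R]_(m, n)) :=
  measurable_fun [set: Omega] (X : Omega -> borel_mx R m n).

Definition mx_expectation m n (X : Omega -> 'M[R]_(m, n)) : 'M[R]_(m, n) :=
  \matrix_(i, j) fine ('E_P[fun w => X w i j])%E.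

Definition cov_mx m n (U : Omega -> 'cV[R]_m) (V : Omega -> 'cV[R]_n) :
    'M[R]_(m, n) :=
  \matrix_(i, j) fine (covariance P (fun w => U w i 0) (fun w => V w j 0)).

(* [g] is a version of E(Y | W); the third condition is sigma(W)-measurability. *)
Definition is_cond_expectation n (Y : Omega -> R) (W : Omega -> 'cV[R]_n)
    (g : Omega -> R) : Prop :=
  [/\ P.-integrable [set: Omega] (EFin \o Y),
      P.-integrable [set: Omega] (EFin \o g),
      forall B : set R, measurable B ->
        exists2 C : set (borel_mx R n 1), measurable C & g @^-1` B = W @^-1` C &
      forall C : set (borel_mx R n 1), measurable C ->
        (\int[P]_(w in W @^-1` C) (g w)%:E =
         \int[P]_(w in W @^-1` C) (Y w)%:E)%E].

Definition mutually_independent n (V : nat -> Omega -> 'cV[R]_n) : Prop :=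
  forall (J : seq nat) (B : nat -> set (borel_mx R n 1)),
    uniq J -> (forall j, measurable (B j)) ->
    (P (\bigcap_(j in [set` J]) (V j @^-1` B j)) =
     \prod_(j <- J) P (V j @^-1` B j))%E.

Definition identically_distributed n (V : nat -> Omega -> 'cV[R]_n) : Prop :=
  forall (i j : nat) (B : set (borel_mx R n 1)), measurable B ->
    P (V i @^-1` B) = P (V j @^-1` B).

Definition iid n (V : nat -> Omega -> 'cV[R]_n) : Prop :=
  [/\ forall i, measurable_mx (V i),
      mutually_independent V & identically_distributed V].

Definition cvg_in_distribution n (V : nat -> Omega -> 'cV[R]_n)
    (nu : probability (borel_mx R n 1) R) : Prop :=
  forall f : 'cV[R]_n -> R, continuous f -> (exists M : R, forall x, `|f x| <= M) ->
    (fun k => \int[P]_w (f (V k w))%:E)%E @ \oo --> (\int[nu]_x (f x)%:E)%E.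

End random_matrices.

Section normal_laws.
Context {R : realType}.

Definition pos_def n (V : 'M[R]_n) : Prop :=
  V^T = V /\ forall c : 'cV[R]_n, c != 0 -> 0 < (c^T *m V *m c) 0 0.

Definition pos_semidef n (V : 'M[R]_n) : Prop :=
  V^T = V /\ forall c : 'cV[R]_n, 0 <= (c^T *m V *m c) 0 0.

(* N(mu, v) with variance v >= 0; [normal_prob mu 0] is not the point mass at
   mu, hence the case distinction. *)
Definition normal_law (mu v : R) (B : set R) : \bar R :=
  if v == 0 then (\d_mu B)%E else normal_prob mu (Num.sqrt v) B.

(* nu = N(mu, V), V possibly singular: every linear form c'x is normal with
   mean c'mu and variance c'Vc under nu. *)
Definition is_normal n (mu : 'cV[R]_n) (V : 'M[R]_n)
    (nu : probability (borel_mx R n 1) R) : Prop :=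
  pos_semidef V /\
  forall (c : 'cV[R]_n) (B : set R), measurable B ->
    nu [set x : 'cV[R]_n | B ((c^T *m x) 0 0)] =
    normal_law ((c^T *m mu) 0 0) ((c^T *m V *m c) 0 0) B.

Definition cvg_to_normal {d : measure_display} {Omega : measurableType d}
    (P : probability Omega R) n (V : nat -> Omega -> 'cV[R]_n)
    (mu : 'cV[R]_n) (Sigma : 'M[R]_n) : Prop :=
  exists2 nu : probability (borel_mx R n 1) R,
    is_normal mu Sigma nu & cvg_in_distribution P V nu.

End normal_laws.

(* The number of periods is 1 + T', so that column vectors over the periods
   split into the first period and the last T' ones. Individuals are indexed
   from 0: the first n individuals are those with index i < n, and index 0 is
   the representative individual of the population moments. *)
Section panel.
Context {R : realType}.

Definition ones_vec T : 'cV[R]_T := const_mx 1.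

Definition within_mx T : 'M[R]_T :=
  1%:M - ones_vec T *m invmx ((ones_vec T)^T *m ones_vec T) *m (ones_vec T)^T.

Definition loadings T' (lambda : 'cV[R]_T') : 'cV[R]_(1 + T') :=
  col_mx 1%:M lambda.

Definition normalized_loadings T' (Phi : 'cV[R]_(1 + T')) : 'cV[R]_T' :=
  (Phi ord0 0)^-1 *: dsubmx Phi.

Section parameter.
Variables (K m T' : nat) (psi : 'cV[R]_(K + m + T')).

Definition par_beta : 'cV[R]_K := usubmx (usubmx psi).
Definition par_theta : 'cV[R]_m := dsubmx (usubmx psi).
Definition par_lambda : 'cV[R]_T' := dsubmx psi.

Definition reduced_coef (S : 'I_(1 + T') -> 'M[R]_(m, K)) (t : 'I_(1 + T')) :
    'cV[R]_m :=
  S t *m par_beta + loadings par_lambda t 0 *: par_theta.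

End parameter.

Definition demean m n (x : nat -> 'M[R]_(m, n)) (N i : nat) : 'M[R]_(m, n) :=
  x i - N%:R^-1 *: \sum_(j < N) x j.

Definition sqnorm n (v : 'cV[R]_n) : R := \sum_(t < n) v t 0 ^+ 2.

Definition objective K m T' (y : nat -> 'cV[R]_(1 + T'))
    (X : nat -> 'M[R]_(1 + T', K)) (z : nat -> 'cV[R]_m) (N : nat)
    (psi : 'cV[R]_(K + m + T')) : R :=
  (2 * N%:R)^-1 * \sum_(i < N)
    sqnorm (demean y N i - demean X N i *m par_beta psi
            - loadings (par_lambda psi) *m (demean z N i)^T *m par_theta psi).

Definition is_minimizer_over n (D : set 'cV[R]_n) (S : 'cV[R]_n -> R)
    (psi : 'cV[R]_n) : Prop :=
  D psi /\ forall psi', D psi' -> S psi <= S psi'.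

Definition twfe K T (y : nat -> 'cV[R]_T) (X : nat -> 'M[R]_(T, K)) (N : nat) :
    'cV[R]_K :=
  invmx (\sum_(i < N) (demean X N i)^T *m within_mx T *m demean X N i) *m
  \sum_(i < N) (demean X N i)^T *m within_mx T *m demean y N i.

Definition regressor_mx K m T' (X : 'M[R]_(1 + T', K)) (z : 'cV[R]_m)
    (theta0 : 'cV[R]_m) (lambda0 : 'cV[R]_T') : 'M[R]_(1 + T', K + m + T') :=
  block_mx (row_mx (usubmx X) z^T) 0
           (row_mx (dsubmx X) (lambda0 *m z^T)) ((z^T *m theta0) 0 0)%:M.

End panel.

Section population.
Context {d : measure_display} {Omega : measurableType d} {R : realType}.
Variable P : probability Omega R.

Definition pop_center m n (x : nat -> Omega -> 'M[R]_(m, n)) (i : nat) (w : Omega) :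
    'M[R]_(m, n) :=
  x i w - mx_expectation P (x 0%N).

Definition regressor_loading T K (eta : Omega -> R) (X : Omega -> 'M[R]_(T, K))
    (t : 'I_T) : 'rV[R]_K :=
  \row_k ((fine ('V_P[eta])%E)^-1 *
          fine (covariance P eta (fun w => X w t k))).

Section plus.
Variables (K m T' : nat).
Variables (X : nat -> Omega -> 'M[R]_(1 + T', K)).
Variables (y : nat -> Omega -> 'cV[R]_(1 + T')) (z : nat -> Omega -> 'cV[R]_m).
Variables (a : nat -> Omega -> R) (eps : nat -> Omega -> 'cV[R]_(1 + T')).
Variables (beta0 : 'cV[R]_K) (theta0 : 'cV[R]_m) (lambda0 : 'cV[R]_T').

Definition Rmx (i : nat) (w : Omega) : 'M[R]_(1 + T', K + m + T') :=
  regressor_mx (X i w) (z i w) theta0 lambda0.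

Definition Rplus (i : nat) (w : Omega) :
    'M[R]_((1 + T') + (1 + T'), (K + m + T') + K) :=
  block_mx (pop_center Rmx i w) 0 0 (within_mx (1 + T') *m pop_center X i w).

Definition u_err (i : nat) (w : Omega) : 'cV[R]_(1 + T') :=
  a i w *: loadings lambda0 + eps i w.

Definition uplus (i : nat) (w : Omega) : 'cV[R]_((1 + T') + (1 + T')) :=
  col_mx (u_err i w) (pop_center y i w - pop_center X i w *m beta0).

Definition Hplus : 'M[R]_((K + m + T') + K) :=
  mx_expectation P (fun w => (Rplus 0 w)^T *m Rplus 0 w).

Definition Aplus : 'M[R]_((K + m + T') + K) :=
  mx_expectation P
    (fun w => (Rplus 0 w)^T *m uplus 0 w *m (uplus 0 w)^T *m Rplus 0 w).

End plus.
End population.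

(* Main.v *)
(* With z* and x* the centered z and x, and x*_t = S_t' z*, the data enter both
   estimators only through the sample variance Mn of z and the sample covariances
   N_t of z with u_t. The criterion of psihat is, up to a constant,
   sum_t (D_t' Mn D_t / 2 - D_t' N_t), where D_t = pi_t(psi) - pi_t(psi0) is
   quadratic in psi - psi0. Since N_t -> 0, compactness and identification force
   psihat -> psi0, and the first-order condition then says that
   H0 (psihat - psi0) - sum_t J_t' N_t is of order |N| (|N| + |Mn - M|), that is
   o_P(n^-1/2), J_t being the derivative of pi_t at psi0. Likewise TWFE solves a
   linear system whose matrix tends to G0 = E(X*' Q X* ) and whose right-hand side
   is sum_{t,s} Q_ts S_t' (sample covariance of z and lambda_s eta + eps_s). The
   limit of the latter, sum_{t,s} Q_ts lambda_s E(x*_t eta), vanishes under (A)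
   because Q kills lambda = iota, and under (B) because E(x*_t eta) does not depend
   on t and iota'Q = 0. So H0+ times the joint error is n^-1 times an iid centered
   sum plus o_P(n^-1/2).

   Convergence in law is tested on the functions cos(c'x + b): a bounded
   continuous function is approximated on a large cube by its Bernstein polynomial
   in phases (1 + sin(a x_j)) / 2, which is a trigonometric polynomial with the
   same bound everywhere. For these test functions the central limit theorem
   follows by replacing the summands one at a time. The limit, possibly singular,
   is built one coordinate at a time from a Schur decomposition of its variance. *)
Require Import Defs.
From HB Require Import structures.
From mathcomp Require Import all_boot all_order all_algebra.
From mathcomp Require Import all_classical all_reals all_analysis.
From mathcomp Require Import measurable_realfun ring lra.

Set Implicit Arguments.
Unset Strict Implicit.
Unset Printing Implicit Defensive.
Import Order.TTheory GRing.Theory Num.Theory.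
Import numFieldNormedType.Exports.

Local Open Scope classical_set_scope.
Local Open Scope ring_scope.

(** Real cosines with arbitrary phases replace characteristic functions: with
    [sin x = cos (x - pi / 2)] their span is an algebra, and the addition formula splits the cosine
    of a sum into products to which independence applies. A trigonometric approximation is close to
    a test function on a cube only. Outside, tightness makes the probability small but says nothing
    about values, so the approximant must keep the bound of the test function everywhere; a weighted
    mean of its values does. The relation between regressors and [z] holds almost surely, and the
    expansion of psihat is a deterministic statement valid only when the sample moments are close to
    their limits. Exceptional events handle both: what happens on them costs only their probability.
    Identification on the compact set yields only that psihat is close to psi0; the root-n rate
    needs [H0] nonsingular, so that near psi0 the linear part of D dominates the quadratic one.
    Fourth moments of [v] give a variance to the summands of the scores, which are built from
    products of two affine functions of [v]. *)

(** * Borel sets of matrices *)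

Section borel_matrices.
Context {R : realType} {m n : nat}.

Lemma open_measurable_mx (U : set 'M[R]_(m, n)) :
  open U -> measurable (U : set (borel_mx R m n)).
Proof. by move=> oU; exact: sub_sigma_algebra. Qed.

Lemma mx_norm_le (A : 'M[R]_(m, n)) (r : R) :
  0 <= r -> (forall i j, `|A i j| <= r) -> `|A| <= r.
Proof.
move=> r0 Ar; rewrite [leLHS]/Num.norm /= mx_normrE.
by apply/bigmax_leP; split => // -[i j] _; exact: Ar.
Qed.

Lemma ler_mx_norm (A : 'M[R]_(m, n)) i j : `|A i j| <= `|A|.
Proof.
rewrite [leRHS]/Num.norm /= mx_normrE.
exact: (le_bigmax _ (fun ij => `|A ij.1 ij.2|) (i, j)).
Qed.

Lemma continuous_mx_coords (T : topologicalType) (f : T -> 'M[R]_(m, n)) :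
  (forall i j, continuous (fun x => f x i j)) -> continuous f.
Proof.
move=> fc x A [P PM sPA]; rewrite /nbhs /=.
have : \forall y \near x, forall ij : 'I_m * 'I_n, P ij.1 ij.2 (f y ij.1 ij.2).
  apply: filter_forall => -[i j] /=; exact: (fc i j x).
apply: filterS => y Py; apply: sPA => i j; exact: (Py (i, j)).
Qed.

Lemma continuous_measurable_mx (f : 'M[R]_(m, n) -> R) : continuous f ->
  measurable_fun [set: borel_mx R m n] (f : borel_mx R m n -> R).
Proof.
move=> cf; apply: (measurability _ (measurable_realfun.RGenOpens.measurableE R)).
move=> _ [_ [a [b ->] <-]]; rewrite setTI.
apply: open_measurable_mx; apply: open_comp => // x _; exact: cf.
Qed.

Lemma measurable_mx_coord d (T : measurableType d) (X : T -> 'M[R]_(m, n)) i j :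
  measurable_mx X -> measurable_fun [set: T] (fun t => X t i j).
Proof.
move=> mX; apply: (measurableT_comp (f := fun A : borel_mx R m n => A i j) _ mX).
by apply: continuous_measurable_mx; exact: coord_continuous.
Qed.

(** An open set is a countable union of boxes with rational centres and radii [1 / (k + 1)], and the
    preimage of a box is a finite intersection of coordinate preimages. *)
Lemma measurable_mx_coords d (T : measurableType d) (X : T -> 'M[R]_(m, n)) :
  (forall i j, measurable_fun [set: T] (fun t => X t i j)) -> measurable_mx X.
Proof.
move=> mX; apply: (@measurability _ _ T (borel_mx R m n) _ X (@open 'M[R]_(m, n)) (erefl _)).
move=> _ [U oU <-]; rewrite setTI.
pose box (q : 'M[rat]_(m, n)) (k : nat) : set 'M[R]_(m, n) :=
  [set A | forall i j, `|A i j - ratr (q i j)| < k.+1%:R^-1].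
have mbox q k : measurable (X @^-1` box q k).
  have -> : X @^-1` box q k = \bigcap_(ij in [set: 'I_m * 'I_n])
      ((fun t => X t ij.1 ij.2) @^-1`
        [set x | `|x - ratr (q ij.1 ij.2)| < k.+1%:R^-1]).
    by apply/seteqP; split=> [t Xt [i j] _|t Xt i j] /=;
      [exact: Xt|exact: (Xt (i, j))].
  apply: fin_bigcap_measurable => [|[i j] _]; first exact: finite_finset.
  rewrite -[X in measurable X]setTI; apply: mX => //.
  rewrite (_ : mkset _ = `]ratr (q i j) - k.+1%:R^-1, ratr (q i j) + k.+1%:R^-1[%classic).
    exact: measurable_itv.
  by apply/seteqP; split=> x /=; rewrite in_itv /= ltr_distl.
(* Pairs of a centre and a radius are enumerated through [unpickle]; codes of nothing, and boxes not
   contained in [U], contribute the empty set. *)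
have UE : X @^-1` U = \bigcup_p (X @^-1` (if unpickle p is Some qk then
    if `[< box qk.1 qk.2 `<=` U >] then box qk.1 qk.2 else set0
    else set0)).
  apply/seteqP; split=> t /=; last first.
    move=> [p _] /=; case: unpickle => // -[q k] /=.
    by case: asboolP => // sU; exact: sU.
  move=> UXt.
  have /nbhs_ballP[e /= e0 sU] : nbhs (X t) U by exact: open_nbhs_nbhs.
  have [k ke] : exists k : nat, k.+1%:R^-1 < e / 2.
    have /(_ (e/2)) := @ltr_add_invr R 0; rewrite divr_gt0// => /(_ isT)[k].
    by rewrite add0r; exists k.
  have /choice[q qP] : forall ij : 'I_m * 'I_n, exists q : rat,
     `|X t ij.1 ij.2 - ratr q| < k.+1%:R^-1.
    move=> [i j] /=.
    have /rat_in_itvoo[q] : X t i j - k.+1%:R^-1 < X t i j + k.+1%:R^-1.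
      by rewrite ltrBlDr -addrA ltrDl addr_gt0.
    rewrite in_itv /= => qb; exists q.
    by rewrite distrC ltr_distl.
  exists (pickle (\matrix_(i, j) q (i, j), k)) => //.
  rewrite pickleK /=; case: asboolP => [_ i j|[]].
    by rewrite mxE; exact: (qP (i, j)).
  move=> A bA; apply: sU; split => // i j.
  rewrite /ball /= (le_lt_trans (ler_distD (ratr (q (i, j))) _ _))//.
  rewrite [e]splitr ltrD ?(lt_trans _ ke)//; first exact: (qP (i, j)).
  by rewrite distrC; have := bA i j; rewrite mxE.
rewrite UE; apply: bigcup_measurable => p _.
case: unpickle => [[q k]|]; last by rewrite preimage_set0.
by case: asboolP => _; rewrite ?preimage_set0//; exact: mbox.
Qed.

End borel_matrices.

(** * Trigonometric approximation *)

Section trig_polynomials.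
Context {R : realType} {n : nat}.
Implicit Types (c x : 'cV[R]_n) (f g : 'cV[R]_n -> R).

Definition dotv c x : R := (c^T *m x) 0 0.

Lemma dotvE c x : dotv c x = \sum_j c j 0 * x j 0.
Proof. by rewrite /dotv mxE; apply: eq_bigr => j _; rewrite mxE. Qed.

Lemma dotvDl c1 c2 x : dotv (c1 + c2) x = dotv c1 x + dotv c2 x.
Proof. by rewrite /dotv linearD /= mulmxDl mxE. Qed.

Lemma dotvNl c x : dotv (- c) x = - dotv c x.
Proof. by rewrite /dotv linearN /= mulNmx mxE. Qed.

Lemma dotvDr c x1 x2 : dotv c (x1 + x2) = dotv c x1 + dotv c x2.
Proof. by rewrite /dotv mulmxDr mxE. Qed.

Lemma dotvNr c x : dotv c (- x) = - dotv c x.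
Proof. by rewrite /dotv mulmxN mxE. Qed.

Lemma dotvZr c k x : dotv c (k *: x) = k * dotv c x.
Proof. by rewrite /dotv -scalemxAr mxE. Qed.

Lemma dotvZl c k x : dotv (k *: c) x = k * dotv c x.
Proof. by rewrite /dotv linearZ /= -scalemxAl mxE. Qed.

Lemma dotv_sumr c N (F : 'I_N -> 'cV[R]_n) :
  dotv c (\sum_i F i) = \sum_i dotv c (F i).
Proof. by rewrite /dotv mulmx_sumr summxE. Qed.

Lemma ler_dotv c x : `|dotv c x| <= n%:R * `|c| * `|x|.
Proof.
rewrite dotvE (le_trans (ler_norm_sum _ _ _))//.
have -> : n%:R * `|c| * `|x| = \sum_(j < n) `|c| * `|x|.
  by rewrite sumr_const card_ord -mulrA mulr_natl.
by apply: ler_sum => j _; rewrite normrM ler_pM// ler_mx_norm.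
Qed.

(** The phase [b] makes sines and constants available without complex exponentials, and lets the
    class be closed under products. *)
Inductive trig_poly : ('cV[R]_n -> R) -> Prop :=
| trig_cos c b : trig_poly (fun x => cos (dotv c x + b))
| trig_add f g : trig_poly f -> trig_poly g -> trig_poly (fun x => f x + g x)
| trig_scale k f : trig_poly f -> trig_poly (fun x => k * f x).

Lemma eq_trig_poly f g : f =1 g -> trig_poly f -> trig_poly g.
Proof. by move=> /funext ->. Qed.

Lemma trig_cst k : trig_poly (fun=> k).
Proof.
apply: eq_trig_poly (trig_scale k (trig_cos 0 0)) => x.
by rewrite dotvE big1 ?addr0 ?cos0 ?mulr1// => j _; rewrite mxE mul0r.
Qed.

(** Product-to-sum: [cos u * cos v] is the mean of [cos (u + v)] and [cos (u - v)]. *)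
Lemma trig_cosM c b g : trig_poly g ->
  trig_poly (fun x => cos (dotv c x + b) * g x).
Proof.
elim=> [c' b'|g1 g2 _ h1 _ h2|k g1 _ h].
- apply: eq_trig_poly (trig_scale (2^-1)
    (trig_add (trig_cos (c + c') (b + b')) (trig_cos (c - c') (b - b')))) => x.
  rewrite !dotvDl dotvNl.
  rewrite (_ : _ + (b + b') = (dotv c x + b) + (dotv c' x + b')); last by ring.
  rewrite (_ : _ + (b - b') = (dotv c x + b) - (dotv c' x + b')); last by ring.
  by rewrite cosD cosB; field.
- by apply: eq_trig_poly (trig_add h1 h2) => x; rewrite mulrDr.
- by apply: eq_trig_poly (trig_scale k h) => x; rewrite mulrCA.
Qed.

Lemma trig_mul f g : trig_poly f -> trig_poly g -> trig_poly (fun x => f x * g x).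
Proof.
move=> + tg; elim=> [c b|f1 f2 _ h1 _ h2|k f1 _ h]; first exact: trig_cosM.
- by apply: eq_trig_poly (trig_add h1 h2) => x; rewrite mulrDl.
- by apply: eq_trig_poly (trig_scale k h) => x; rewrite mulrA.
Qed.

Lemma trig_sum (I : Type) (s : seq I) (F : I -> 'cV[R]_n -> R) :
  (forall i, trig_poly (F i)) -> trig_poly (fun x => \sum_(i <- s) F i x).
Proof.
move=> tF; elim: s => [|i s IHs].
  by apply: eq_trig_poly (trig_cst 0) => x; rewrite big_nil.
by apply: eq_trig_poly (trig_add (tF i) IHs) => x; rewrite big_cons.
Qed.

Lemma trig_prod (I : Type) (s : seq I) (F : I -> 'cV[R]_n -> R) :
  (forall i, trig_poly (F i)) -> trig_poly (fun x => \prod_(i <- s) F i x).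
Proof.
move=> tF; elim: s => [|i s IHs].
  by apply: eq_trig_poly (trig_cst 1) => x; rewrite big_nil.
by apply: eq_trig_poly (trig_mul (tF i) IHs) => x; rewrite big_cons.
Qed.

Lemma continuous_dotv c : continuous (dotv c).
Proof.
have -> : dotv c = \sum_(j < n) (fun x => c j 0 * x j 0).
  by apply/funext => x; rewrite dotvE fct_sumE.
elim/big_ind: _ => [|f g cf cg|j _] x; first exact: cst_continuous.
  by apply: continuousD; [exact: cf|exact: cg].
by apply: continuousM; [exact: cst_continuous|exact: coord_continuous].
Qed.

Lemma trig_poly_continuous f : trig_poly f -> continuous f.
Proof.
elim=> [c b|f1 f2 _ h1 _ h2|k f1 _ h] x.
- apply: (@continuous_comp _ _ _ (fun x => dotv c x + b) cos); last exact: continuous_cos.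
  by apply: continuousD; [exact: continuous_dotv|exact: cst_continuous].
- by apply: continuousD; [exact: h1|exact: h2].
- by apply: continuousM; [exact: cst_continuous|exact: h].
Qed.

Lemma trig_poly_bounded f : trig_poly f -> exists M : R, forall x, `|f x| <= M.
Proof.
elim=> [c b|f1 f2 _ [M1 h1] _ [M2 h2]|k f1 _ [M h]].
- by exists 1 => x; exact: cos_max.
- by exists (M1 + M2) => x; rewrite (le_trans (ler_normD _ _))// lerD.
- by exists (`|k| * M) => x; rewrite normrM ler_wpM2l.
Qed.

End trig_polynomials.

(** * Binomial weights and their first two moments *)

Section bernstein_weights.
Context {R : realType}.
Implicit Types (t : R) (h : nat -> R).

(* the law of the number of successes in N independent trials *)
Fixpoint bern (N : nat) (t : R) (k : nat) : R :=
  match N with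
  | 0 => (k == 0)%:R
  | N'.+1 => (1 - t) * bern N' t k + (if k is k'.+1 then t * bern N' t k' else 0)
  end.

Lemma bern_ge0 N t k : 0 <= t <= 1 -> 0 <= bern N t k.
Proof.
move=> /andP[t0 t1]; elim: N k => [|N IHN] k //=.
by case: k => [|k]; rewrite ?addr0 ?addr_ge0// mulr_ge0// subr_ge0.
Qed.

Lemma bern_gt N t k : (N < k)%N -> bern N t k = 0.
Proof.
elim: N k => [|N IHN] [|k] //= Nk.
by rewrite !IHN ?mulr0 ?addr0// ltnW.
Qed.

(** Conditioning on one trial, which adds one to the count with probability [t]. The three moments
    below follow from it by induction. *)
Lemma bernS N t h : \sum_(k < N.+2) bern N.+1 t k * h k =
  (1 - t) * (\sum_(k < N.+1) bern N t k * h k) +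
  t * (\sum_(k < N.+1) bern N t k * h k.+1).
Proof.
under eq_bigr do rewrite /= mulrDl.
rewrite big_split /= big_ord_recr /= bern_gt// mulr0 mul0r addr0.
congr +%R; first by rewrite mulr_sumr; apply: eq_bigr => k _; rewrite mulrA.
rewrite big_ord_recl /= mul0r add0r mulr_sumr.
by apply: eq_bigr => k _; rewrite mulrA.
Qed.

Lemma bern_sum N t : \sum_(k < N.+1) bern N t k = 1.
Proof.
under eq_bigr do rewrite -[bern _ _ _]mulr1.
elim: N => [|N IHN]; first by rewrite big_ord1 /= mulr1.
by rewrite (bernS _ _ (fun=> 1)) IHN !mulr1 subrK.
Qed.

Lemma bern_mean N t : \sum_(k < N.+1) bern N t k * k%:R = N%:R * t.
Proof.
elim: N => [|N IHN]; first by rewrite big_ord1 /= mulr0 mul0r.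
rewrite (bernS _ _ (fun k => k%:R)) IHN.
under eq_bigr do rewrite -natr1 mulrDr mulr1.
by rewrite big_split /= IHN bern_sum -natr1; ring.
Qed.

Lemma bern_var N t :
  \sum_(k < N.+1) bern N t k * (k%:R - N%:R * t) ^+ 2 = N%:R * (t * (1 - t)).
Proof.
elim: N => [|N IHN]; first by rewrite big_ord1 /= !mul0r subrr expr0n mulr0.
rewrite (bernS _ _ (fun k => (k%:R - N.+1%:R * t) ^+ 2)).
(* Shifting the centre by [a] adds [a ^+ 2] to the variance, the cross term vanishing by
   [bern_mean]. The new trial shifts the centre by [- t] on failure and by [1 - t] on success. *)
have E (a : R) : \sum_(k < N.+1) bern N t k * (k%:R - N%:R * t + a) ^+ 2 =
    N%:R * (t * (1 - t)) + a ^+ 2.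
  transitivity (\sum_(k < N.+1) (bern N t k * (k%:R - N%:R * t) ^+ 2 +
     ((bern N t k * k%:R) * (2 * a) - bern N t k * (N%:R * t * (2 * a))
      + bern N t k * a ^+ 2))).
    by apply: eq_bigr => k _; ring.
  rewrite big_split /= IHN; congr +%R.
  rewrite big_split sumrB /= -!mulr_suml bern_mean bern_sum; ring.
have -> : \sum_(k < N.+1) bern N t k * (k%:R - N.+1%:R * t) ^+ 2 =
    N%:R * (t * (1 - t)) + t ^+ 2.
  by rewrite -sqrrN -E; apply: eq_bigr => k _; rewrite -natr1; congr (_ * _ ^+ 2); ring.
have -> : \sum_(k < N.+1) bern N t k * (k.+1%:R - N.+1%:R * t) ^+ 2 =
    N%:R * (t * (1 - t)) + (1 - t) ^+ 2.
  rewrite -E; apply: eq_bigr => k _; rewrite -[N.+1%:R]natr1 -[k.+1%:R]natr1.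
  by congr (_ * _ ^+ 2); ring.
by rewrite -natr1; ring.
Qed.

Lemma bern_var_scaled N t : (0 < N)%N -> 0 <= t <= 1 ->
  \sum_(k < N.+1) bern N t k * (k%:R / N%:R - t) ^+ 2 <= N%:R^-1.
Proof.
move=> N0 /andP[t0 t1].
have NN : N%:R != 0 :> R by rewrite pnatr_eq0 -lt0n.
have -> : \sum_(k < N.+1) bern N t k * (k%:R / N%:R - t) ^+ 2 =
   N%:R^-1 ^+ 2 * (N%:R * (t * (1 - t))).
  rewrite -bern_var mulr_sumr; apply: eq_bigr => k _.
  by field.
rewrite (_ : _ * _ = N%:R^-1 * (t * (1 - t))); last by field.
by rewrite ler_piMr//; nra.
Qed.

End bernstein_weights.

(** * Approximation on a cube with a global bound *)

Section density.
Context {R : realType} {n : nat}.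
Implicit Types (f : 'cV[R]_n -> R).

Lemma compact_cube (L : R) : compact [set x : 'cV[R]_n | forall j, `|x j 0| <= L].
Proof.
have cK := @rV_compact R n (fun=> `[- L, L]%classic) (fun=> @segment_compact _ _ _).
have cT : {within [set v : 'rV[R]_n | forall i, (`[- L, L]%classic : set R) (v ord0 i)],
    continuous (fun v : 'rV[R]_n => v^T : 'cV[R]_n)}.
  apply: continuous_subspaceT; apply: continuous_mx_coords => i j x.
  have -> : (fun v : 'rV[R]_n => (v^T) i j) = (fun v => v j i).
    by apply/funext => v; rewrite mxE.
  exact: coord_continuous.
have := continuous_compact cT cK; congr compact; apply/seteqP; split => [_ [v vL <-] j|x xL] /=.
  by rewrite mxE; have := vL j; rewrite /= in_itv /= ler_norml ord1.
exists x^T; last by rewrite trmxK.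
by move=> i /=; rewrite in_itv /= mxE -ler_norml.
Qed.

(** Heine-Cantor, from the covering form of compactness with the modulus [eta] as a parameter
    tending to [0] from the right. *)
Lemma uniformly_continuous_cube f (L e : R) : continuous f -> 0 < e ->
  exists2 eta : R, 0 < eta & forall x y : 'cV[R]_n,
    (forall j, `|x j 0| <= L) -> `|x - y| < eta -> `|f x - f y| <= e.
Proof.
move=> cf e0.
have /compact_near_coveringP := @compact_cube L.
move=> /(_ R (0^'+) (fun eta x => forall y, `|x - y| < eta -> `|f x - f y| <= e)).
case.
  move=> x _.
  have /cvgrPdist_lt/(_ (e / 2)) : f z @[z --> x] --> f x by exact: cf.
  rewrite divr_gt0// => /(_ isT) /nbhs_ballP[r /= r0 fr].
  exists (ball x (r / 2), [set eta | eta < r / 2]) => /=.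
    by split; [apply: nbhsx_ballx; rewrite divr_gt0|apply: nbhs_right_lt; rewrite divr_gt0].
  move=> [x' eta] /= [xx' etar] y x'y.
  rewrite (splitr e) (le_trans (ler_distD (f x) _ _))// lerD//.
    rewrite distrC ltW//; apply: fr; apply: le_ball xx'.
    by rewrite ler_pdivrMr// ler_peMr ?ltW// ltr1n.
  have x'y2 : ball x' (r / 2) y by rewrite -ball_normE /=; exact: lt_trans etar.
  by rewrite ltW//; apply: fr; rewrite (splitr r); exact: ball_triangle xx' x'y2.
move=> eta0 /= eta00 H.
exists (eta0 / 2); first by rewrite divr_gt0.
move=> x y xL xy; apply: (H (eta0 / 2)) => //=.
- by rewrite sub0r normrN ger0_norm ?divr_ge0 ?ltW// ltr_pdivrMr// ltr_pMr// ltr1n.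
- by rewrite divr_gt0.
Qed.

Section phase.
Variable L : R.
Hypothesis L0 : 0 < L.

(** The frequency carries [[-L, L]] onto [[-pi/2, pi/2]], where the sine is increasing. As the phase
    is a probability at every real [x], it can be fed to [bern] outside the cube too. *)
Definition phase (x : R) : R := (1 + sin (pi / (2 * L) * x)) / 2.

Let scaleP : exists a : R, [/\ pi / (2 * L) = a, 0 < a & L * a = pi / 2].
Proof.
exists (pi / (2 * L)); split => //; first by rewrite divr_gt0 ?pi_gt0// mulr_gt0.
by field; rewrite gt_eqF.
Qed.

Lemma phase_itv x : 0 <= phase x <= 1.
Proof.
have := sin_geN1 (pi / (2 * L) * x); have := sin_le1 (pi / (2 * L) * x).
by rewrite /phase; lra.
Qed.

Lemma phase_surj u : 0 <= u <= 1 -> exists2 x, `|x| <= L & phase x = u.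
Proof.
move=> u01; have [a [aE a0 La]] := scaleP.
have u11 : -1 <= 2 * u - 1 <= 1 by lra.
exists (asin (2 * u - 1) / a).
  have := asin_geNpi2 u11; have := asin_lepi2 u11; rewrite -La => h1 h2.
  rewrite normrM normfV (gtr0_norm a0) ler_pdivrMr// ler_norml h1 andbT.
  by [].
rewrite /phase aE mulrCA divff ?gt_eqF// mulr1 asinK.
  by field.
by rewrite in_itv.
Qed.

(** With [mm] and [h] the half-sum and half-difference of the two angles, the phases differ by
    [cos mm * sin h]. In the cube [|mm| <= pi / 2 - h], so [cos mm >= sin h] and the difference is
    at least [sin h ^+ 2]. *)
Lemma phase_sep eta : 0 < eta -> exists2 delta, 0 < delta &
  forall x y, `|x| <= L -> `|y| <= L -> eta <= `|x - y| ->
    delta <= `|phase x - phase y|.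
Proof.
move=> eta0; have [a [aE a0 La]] := scaleP.
(* Two points of the cube are never more than [2 * L] apart, so beyond that any [delta] will do. *)
have [Leta|etaL] := ltP (2 * L) eta.
  exists 1 => // x y xL yL; rewrite leNgt (le_lt_trans _ Leta)//.
  by rewrite (le_trans (ler_normB _ _))// mulr_natl mulr2n lerD.
have s0 : 0 < a * eta / 2 <= pi / 2.
  apply/andP; split; first by rewrite divr_gt0 ?mulr_gt0.
  by rewrite -La; nra.
have ss : 0 < sin (a * eta / 2).
  apply: sin_gt0_pi; case/andP: s0 => -> /=.
  by move=> /le_lt_trans; apply; rewrite ltr_pdivrMr// ltr_pMr ?pi_gt0// ltr1n.
exists (sin (a * eta / 2) ^+ 2); first by rewrite exprn_gt0.
suff W x y : `|x| <= L -> `|y| <= L -> eta <= x - y ->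
    sin (a * eta / 2) ^+ 2 <= phase x - phase y.
  move=> x y xL yL; have [xy|yx] := lerP 0 (x - y) => h.
    by rewrite (le_trans (W _ _ xL yL _))// ?ler_norm// -(ger0_norm xy).
  rewrite distrC (le_trans (W y x yL xL _))// ?ler_norm//.
  by rewrite -opprB -(ltr0_norm yx).
move=> xL yL xy.
pose h := a * (x - y) / 2; pose mm := a * (x + y) / 2.
have -> : phase x - phase y = cos mm * sin h.
  have -> : phase x - phase y = (sin (mm + h) - sin (mm - h)) / 2.
    rewrite /phase aE (_ : mm + h = a * x); last by rewrite /mm /h; field.
    rewrite (_ : mm - h = a * y); last by rewrite /mm /h; field.
    by field.
  by rewrite sinD sinB; field.
move: xL yL; rewrite !ler_norml => /andP[x1 x2] /andP[y1 y2].
have p0 := @pi_gt0 R.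
have aeta : a * eta / 2 <= h.
  by rewrite /h ler_pM2r ?invr_gt0// ler_pM2l.
have hp : h <= pi / 2.
  by rewrite /h -La; nra.
have sh : sin (a * eta / 2) <= sin h.
  case/andP: s0 => s1 s2.
  move: aeta; rewrite le_eqVlt => /predU1P[->//|aeta].
  by rewrite ltW// ltr_sin// in_itv /=; apply/andP; split; lra.
have cm : sin h <= cos mm.
  rewrite -cosBpihalf -[leRHS]cos_norm -[leLHS]cosN opprB.
  have hm : `|mm| <= pi / 2 - h.
    by rewrite -La /mm /h ler_norml; apply/andP; split; nra.
  move: hm; rewrite le_eqVlt => /predU1P[->//|hm].
  case/andP: s0 => s1 s2.
  by rewrite ltW// ltr_cos// in_itv /= ?normr_ge0; apply/andP; split; lra.
by rewrite expr2; apply: ler_pM => //; rewrite ?(le_trans _ cm)// ltW.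
Qed.

End phase.

Lemma trig_phase L (j : 'I_n) : trig_poly (fun x : 'cV[R]_n => phase L (x j 0)).
Proof.
apply: eq_trig_poly (trig_add (trig_cst (2^-1))
  (trig_scale (2^-1) (trig_cos ((pi / (2 * L)) *: delta_mx j 0) (- (pi / 2))))) => x.
rewrite cosBpihalf dotvZl dotvE (bigD1 j)//= big1 ?addr0; last first.
  by move=> i ij; rewrite mxE (negbTE ij) mul0r.
by rewrite mxE !eqxx mul1r /phase; field.
Qed.

Lemma trig_bern (t : 'cV[R]_n -> R) N k : trig_poly t ->
  trig_poly (fun x => bern N (t x) k).
Proof.
move=> tt; elim: N k => [|N IHN] k /=; first exact: trig_cst.
apply: trig_add; last by case: k => [|k]; [exact: trig_cst|exact: trig_mul].
apply: trig_mul => //; apply: trig_add; first exact: trig_cst.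
by apply: eq_trig_poly (trig_scale (-1) tt) => x; rewrite mulN1r.
Qed.

(* Bernstein's polynomial of f in the variables phase L (x j 0), which run
   through [0, 1] as x runs through the cube; being a weighted mean of values of
   f, it stays bounded by M outside the cube. *)
Lemma trig_approx f (M L e : R) : continuous f -> (forall x, `|f x| <= M) ->
  0 < L -> 0 < e ->
  exists g, [/\ trig_poly g, forall x, `|g x| <= M &
    forall x : 'cV[R]_n, (forall j, `|x j 0| <= L) -> `|f x - g x| <= e].
Proof.
move=> cf fM L0 e0.
have M0 : 0 <= M by exact: le_trans (fM 0).
have e20 : 0 < e / 2 by rewrite divr_gt0.
have [eta eta0 etaP] := uniformly_continuous_cube L cf e20.
have [delta delta0 deltaP] := phase_sep L0 eta0.
(* By Chebyshev, the nodes whose phase is off by [delta] in some coordinate have total weight at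
   most [n / (N * delta ^+ 2)], and on them [f] differs from its value at [x] by at most [2 * M]. *)
have [N N0 NP] : exists2 N, (0 < N)%N &
    2 * M / delta ^+ 2 * (n%:R / N%:R) <= e / 2.
  pose C := 2 * M / delta ^+ 2 * n%:R.
  have C0 : 0 <= C by rewrite !mulr_ge0// invr_ge0 exprn_ge0// ltW.
  exists (Num.truncn (C / (e / 2))).+1 => //.
  rewrite mulrA -/C ler_pdivrMr ?ltr0n// mulrC -ler_pdivrMr//.
  by rewrite ltW// truncnS_gt.
have nodes : forall k : 'I_N.+1, exists y, `|y| <= L /\ phase L y = k%:R / N%:R.
  move=> k; have [|y yL yk] := @phase_surj L L0 (k%:R / N%:R); last by exists y.
  by rewrite divr_ge0//= ler_pdivrMr ?ltr0n// mul1r ler_nat -ltnS.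
have [node nodeP] := choice nodes.
pose nd (k : {ffun 'I_n -> 'I_N.+1}) : 'cV[R]_n := \col_j node (k j).
pose w (k : {ffun 'I_n -> 'I_N.+1}) (x : 'cV[R]_n) :=
  \prod_j bern N (phase L (x j 0)) (k j).
have w0 k x : 0 <= w k x by apply: prodr_ge0 => j _; apply: bern_ge0; exact: phase_itv.
have w1 x : \sum_k w k x = 1.
  rewrite /w -(bigA_distr_bigA (fun j (i : 'I_N.+1) => bern N (phase L (x j 0)) i)).
  by rewrite big1// => j _; exact: bern_sum.
(* The sum over multi-indices factors over the coordinates, and each factor other than the [j]-th is
   a full sum of weights, equal to [1]. *)
have wvar x j : \sum_k w k x * ((k j)%:R / N%:R - phase L (x j 0)) ^+ 2 <= N%:R^-1.
  pose F (j' : 'I_n) (i : 'I_N.+1) := bern N (phase L (x j' 0)) i *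
     (if j' == j then (i%:R / N%:R - phase L (x j' 0)) ^+ 2 else 1).
  have -> : \sum_k w k x * ((k j)%:R / N%:R - phase L (x j 0)) ^+ 2 =
      \sum_(k : {ffun 'I_n -> 'I_N.+1}) \prod_j' F j' (k j').
    apply: eq_bigr => k _; rewrite /F big_split /=; congr (_ * _).
    by rewrite (bigD1 j)//= ?eqxx big1 ?mulr1// => i /negbTE ->.
  rewrite -(bigA_distr_bigA F) (bigD1 j)//= [X in _ * X]big1 ?mulr1.
    by rewrite /F eqxx; apply: bern_var_scaled => //; exact: phase_itv.
  by move=> i ij; rewrite /F (negbTE ij); under eq_bigr do rewrite mulr1; exact: bern_sum.
exists (fun x => \sum_k w k x * f (nd k)); split.
- apply: trig_sum => k; apply: trig_mul; last exact: trig_cst.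
  by apply: trig_prod => j; apply: trig_bern; exact: trig_phase.
- move=> x; rewrite (le_trans (ler_norm_sum _ _ _))//.
  rewrite -[M]mul1r -(w1 x) mulr_suml; apply: ler_sum => k _.
  by rewrite normrM ger0_norm// ler_wpM2l.
move=> x xL.
have -> : f x - \sum_k w k x * f (nd k) = \sum_k w k x * (f x - f (nd k)).
  under [RHS]eq_bigr do rewrite mulrBr.
  by rewrite sumrB -mulr_suml w1 mul1r.
rewrite (le_trans (ler_norm_sum _ _ _))//.
pose v k := \sum_j ((k j : 'I_N.+1)%:R / N%:R - phase L (x j 0)) ^+ 2.
(* Either the node is within [eta] of [x] in every coordinate and uniform continuity applies, or
   some phase is off by [delta] and [v k / delta ^+ 2 >= 1] covers the trivial bound [2 * M]. *)
have key k : `|f x - f (nd k)| <= e / 2 + 2 * M / delta ^+ 2 * v k.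
  have v0 : 0 <= v k by apply: sumr_ge0 => j _; rewrite sqr_ge0.
  have [close|] := boolP [forall j, `|x j 0 - nd k j 0| < eta].
    rewrite (le_trans (etaP x (nd k) xL _)) ?lerDl//; last first.
      by rewrite !mulr_ge0// invr_ge0 exprn_ge0// ltW.
    rewrite -[ltLHS]/(Num.norm (x - nd k)) {1}/Num.norm /= mx_normrE.
    apply/bigmax_ltP; split => // -[i j] _ /=.
    by rewrite mxE [in X in _ + X]mxE ord1; exact: (forallP close i).
  rewrite negb_forall => /existsP[j]; rewrite -leNgt => far.
  have dv : delta ^+ 2 <= v k.
    rewrite /v (bigD1 j)//= ler_wpDr ?sumr_ge0//; first by move=> ? _; rewrite sqr_ge0.
    have [ndL ndP] := nodeP (k j).
    have : delta <= `|phase L (x j 0) - phase L (node (k j))|.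
      by apply: deltaP => //; move: far; rewrite mxE.
    rewrite ndP distrC => h; rewrite -[leRHS]ger0_norm ?sqr_ge0// normrX.
    by rewrite lerXn2r ?nnegrE// ltW.
  apply: (@le_trans _ _ (2 * M)).
    by rewrite (le_trans (ler_normB _ _))// mulr_natl mulr2n lerD.
  rewrite -[leLHS]add0r lerD ?(ltW e20)// -mulrA ler_peMr ?mulr_ge0//.
  by rewrite mulrC ler_pdivlMr ?mul1r// exprn_gt0.
apply: (@le_trans _ _ (\sum_k (w k x * (e / 2) + 2 * M / delta ^+ 2 * (w k x * v k)))).
  apply: ler_sum => k _; rewrite normrM ger0_norm//.
  by rewrite [X in _ <= _ + X]mulrCA -mulrDr ler_wpM2l.
rewrite big_split /= -mulr_suml w1 mul1r [leRHS]splitr lerD// -mulr_sumr.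
apply: le_trans NP; rewrite ler_wpM2l//.
  by rewrite !mulr_ge0// invr_ge0 exprn_ge0// ltW.
rewrite /v; under eq_bigr do rewrite mulr_sumr.
rewrite exchange_big /= -[n in leRHS]card_ord mulr_natl -sumr_const.
by apply: ler_sum => j _; exact: wvar.
Qed.

End density.

(** * Expectations and orders in probability *)

Section expectations.
Context {d : measure_display} {T : measurableType d} {R : realType}.
Variable P : probability T R.
Implicit Types X Y : T -> R.

Definition rv_int X := P.-integrable [set: T] (EFin \o X).

Lemma rv_int_measurable X : rv_int X -> measurable_fun [set: T] X.
Proof. by move=> /integrableP[/measurable_EFinP]. Qed.

Lemma le_rv_int X Y : measurable_fun [set: T] X ->
  (forall w, `|X w| <= Y w) -> rv_int Y -> rv_int X.
Proof.
move=> mX XY; apply: le_integrable => //; first exact/measurable_EFinP.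
by move=> w _ /=; rewrite lee_fin (le_trans (XY w)) ?ler_norm.
Qed.

Lemma rv_int_cst k : rv_int (fun=> k).
Proof.
apply: measurable_bounded_integrable => //; last exact: bounded_cst.
by rewrite /= probability_setT ltry.
Qed.

Lemma rv_int_bounded X M : measurable_fun [set: T] X ->
  (forall w, `|X w| <= M) -> rv_int X.
Proof. by move=> mX XM; apply: le_rv_int XM _ => //; exact: rv_int_cst. Qed.

Lemma rv_intD X Y : rv_int X -> rv_int Y -> rv_int (fun w => X w + Y w).
Proof.
move=> iX iY; rewrite /rv_int.
by rewrite (_ : _ \o _ = ((EFin \o X) \+ (EFin \o Y))%E)//; exact: integrableD.
Qed.

Lemma rv_intZ k X : rv_int X -> rv_int (fun w => k * X w).
Proof.
move=> iX; rewrite /rv_int.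
by rewrite (_ : _ \o _ = (fun w => k%:E * (EFin \o X) w)%E)//; exact: integrableZl.
Qed.

Lemma rv_intB X Y : rv_int X -> rv_int Y -> rv_int (fun w => X w - Y w).
Proof.
move=> iX iY; rewrite /rv_int.
by rewrite (_ : _ \o _ = ((EFin \o X) \- (EFin \o Y))%E)//; exact: integrableB.
Qed.

Lemma rv_int_sum (I : Type) (s : seq I) (F : I -> T -> R) :
  (forall i, rv_int (F i)) -> rv_int (fun w => \sum_(i <- s) F i w).
Proof.
move=> iF; elim: s => [|i s IHs].
  by under eq_fun do rewrite big_nil; exact: rv_int_cst.
by under eq_fun do rewrite big_cons; exact: rv_intD.
Qed.

Lemma rv_int_norm X : rv_int X -> rv_int (fun w => `|X w|).
Proof. by move=> iX; exact: integrable_abse iX. Qed.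

Lemma ex_cst k : \int[P]_w k = k.
Proof. by rewrite Rintegral_cst// [X in fine X](@probability_setT _ _ _ P) /= mulr1. Qed.

Lemma exD X Y : rv_int X -> rv_int Y ->
  \int[P]_w (X w + Y w) = \int[P]_w X w + \int[P]_w Y w.
Proof. exact: RintegralD. Qed.

Lemma exB X Y : rv_int X -> rv_int Y ->
  \int[P]_w (X w - Y w) = \int[P]_w X w - \int[P]_w Y w.
Proof. exact: RintegralB. Qed.

Lemma exZ k X : rv_int X -> \int[P]_w (k * X w) = k * \int[P]_w X w.
Proof. exact: RintegralZl. Qed.

Lemma ex_sum (I : Type) (s : seq I) (F : I -> T -> R) :
  (forall i, rv_int (F i)) ->
  \int[P]_w (\sum_(i <- s) F i w) = \sum_(i <- s) \int[P]_w F i w.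
Proof.
move=> iF; elim: s => [|i s IHs].
  by under eq_Rintegral do rewrite big_nil; rewrite ex_cst big_nil.
under eq_Rintegral do rewrite big_cons.
by rewrite exD ?IHs ?big_cons//; exact: rv_int_sum.
Qed.

Lemma le_ex X Y : rv_int X -> rv_int Y -> (forall w, X w <= Y w) ->
  \int[P]_w X w <= \int[P]_w Y w.
Proof. by move=> iX iY XY; apply: le_Rintegral. Qed.

Lemma ler_norm_ex X Y : rv_int X -> rv_int Y -> (forall w, `|X w| <= Y w) ->
  `|\int[P]_w X w| <= \int[P]_w Y w.
Proof.
move=> iX iY XY; rewrite (le_trans (le_normr_Rintegral _ _))// le_ex//.
exact: rv_int_norm.
Qed.

Lemma EFin_ex X : rv_int X -> (\int[P]_w X w)%:E = (\int[P]_w (X w)%:E)%E.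
Proof. by move=> iX; rewrite /Rintegral fineK//; exact: integrable_fin_num. Qed.

Lemma ex_ae_eq X Y : measurable_fun [set: T] X -> measurable_fun [set: T] Y ->
  {ae P, forall w, X w = Y w} -> \int[P]_w X w = \int[P]_w Y w.
Proof.
move=> mX mY XY; rewrite /Rintegral; congr fine; apply: ae_eq_integral => //.
- exact/measurable_EFinP.
- exact/measurable_EFinP.
- by apply: filterS XY => w -> _.
Qed.

Lemma ex_split (X : T -> R) A (e M delta : R) : measurable_fun [set: T] X ->
  measurable A -> (P A <= delta%:E)%E -> 0 <= e -> 0 <= M ->
  (forall w, ~ A w -> `|X w| <= e) -> (forall w, `|X w| <= M) ->
  `|\int[P]_w X w| <= e + M * delta.
Proof.
move=> mX mA PA e0 M0 Xe XM.
have i1 : rv_int (\1_A : T -> R).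
  by apply: (@rv_int_bounded _ 1) => // w; rewrite indicE; case: (_ \in _); rewrite ?normr1 ?normr0.
apply: (@le_trans _ _ (\int[P]_w (e + M * \1_A w))).
  apply: ler_norm_ex.
  - exact: rv_int_bounded XM.
  - by apply: rv_intD; [exact: rv_int_cst|exact: rv_intZ].
  move=> w; rewrite indicE; have [Aw|/negP nAw] := boolP (w \in A).
    by rewrite mulr1 (le_trans (XM w))// lerDr.
  by rewrite mulr0 addr0 Xe//; move/mem_set.
rewrite exD; [|exact: rv_int_cst|exact: rv_intZ].
rewrite ex_cst exZ// lerD2l ler_wpM2l// /Rintegral integral_indic// setIT.
by rewrite -lee_fin fineK// fin_num_measure.
Qed.

Lemma ex_indic A : measurable A -> \int[P]_w \1_A w = fine (P A).
Proof. by move=> mA; rewrite /Rintegral integral_indic// setIT. Qed.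

Lemma markov_sq X (e : R) : measurable_fun [set: T] X -> 0 < e ->
  rv_int (fun w => X w ^+ 2) ->
  (P [set w | (e < `|X w|)%R] <= (e ^- 2 * \int[P]_w (X w ^+ 2))%:E)%E.
Proof.
move=> mX e0 iX.
set A := [set w | _].
have mA : measurable A.
  rewrite -[A]setTI (_ : A = (fun w => `|X w|) @^-1` `]e, +oo[%classic); last first.
    by apply/seteqP; split=> w; rewrite /A /= in_itv /= andbT.
  by apply: measurableT_comp.
have i1 : rv_int (\1_A : T -> R).
  by apply: (@rv_int_bounded _ 1) => // w; rewrite indicE; case: (_ \in _); rewrite ?normr1 ?normr0.
rewrite -[leLHS]fineK ?fin_num_measure// lee_fin -ex_indic// -exZ//.
apply: le_ex => //; first exact: rv_intZ.
move=> w; rewrite indicE; have [/set_mem Aw|_] := boolP (w \in A); last first.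
  by rewrite mulr_ge0 ?sqr_ge0// invr_ge0 exprn_ge0// ltW.
rewrite mulrC ler_pdivlMr ?exprn_gt0// mul1r -[leRHS]ger0_norm ?sqr_ge0//.
by rewrite normrX lerXn2r ?nnegrE ?(ltW e0)// ltW.
Qed.

End expectations.

Section stochastic_orders.
Context {d : measure_display} {T : measurableType d} {R : realType}.
Variable P : probability T R.

Definition whp_le (delta : R) (U : nat -> T -> R) (K : R) : Prop :=
  exists N, forall n, (N <= n)%N -> exists A, [/\ measurable A,
    (P A <= delta%:E)%E & forall w, ~ A w -> U n w <= K].

(* [Obig] and [osmall] are O_P(1) and o_P(1), phrased with measurable exceptional
   events so that U itself need not be measurable. *)
Definition Obig (U : nat -> T -> R) : Prop :=
  forall delta, 0 < delta -> exists2 K, 0 < K & whp_le delta (fun n w => `|U n w|) K.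

Definition osmall (U : nat -> T -> R) : Prop :=
  forall delta e, 0 < delta -> 0 < e -> whp_le delta (fun n w => `|U n w|) e.

Lemma whp_le2 (d1 d2 : R) U1 U2 U3 (K1 K2 K3 : R) :
  whp_le d1 U1 K1 -> whp_le d2 U2 K2 ->
  (forall n w, U1 n w <= K1 -> U2 n w <= K2 -> U3 n w <= K3) ->
  whp_le (d1 + d2) U3 K3.
Proof.
move=> [N1 h1] [N2 h2] h; exists (maxn N1 N2) => n; rewrite geq_max => /andP[n1 n2].
have [A1 [mA1 PA1 A1P]] := h1 _ n1; have [A2 [mA2 PA2 A2P]] := h2 _ n2.
exists (A1 `|` A2); split; first exact: measurableU.
  by rewrite (le_trans (measureU2 _ _ _))// EFinD leeD.
by move=> w /not_orP[nA1 nA2]; apply: h; [exact: A1P|exact: A2P].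
Qed.

Lemma osmall_Obig U : osmall U -> Obig U.
Proof. by move=> oU delta d0; exists 1 => //; exact: oU. Qed.

Lemma le_osmall U V : osmall U -> (forall n w, `|V n w| <= `|U n w|) -> osmall V.
Proof.
move=> oU UV delta e d0 e0; have [N h] := oU _ _ d0 e0; exists N => n /h[A [mA PA AP]].
by exists A; split=> // w /AP; exact: le_trans.
Qed.

Lemma le_Obig U V : Obig U -> (forall n w, `|V n w| <= `|U n w|) -> Obig V.
Proof.
move=> oU UV delta d0; have [K K0 [N h]] := oU _ d0; exists K => //; exists N => n /h[A [mA PA AP]].
by exists A; split=> // w /AP; exact: le_trans.
Qed.

Lemma osmallD U V : osmall U -> osmall V -> osmall (fun n w => U n w + V n w).
Proof.
move=> oU oV delta e d0 e0; rewrite (splitr delta).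
have d20 : 0 < delta / 2 by rewrite divr_gt0.
have e20 : 0 < e / 2 by rewrite divr_gt0.
apply: (whp_le2 (oU _ _ d20 e20) (oV _ _ d20 e20)) => n w h1 h2.
by rewrite (le_trans (ler_normD _ _))// (splitr e) lerD.
Qed.

Lemma ObigD U V : Obig U -> Obig V -> Obig (fun n w => U n w + V n w).
Proof.
move=> oU oV delta d0; rewrite (splitr delta).
have d20 : 0 < delta / 2 by rewrite divr_gt0.
have [K K0 hK] := oU _ d20; have [L L0 hL] := oV _ d20.
exists (K + L); first by rewrite addr_gt0.
apply: (whp_le2 hK hL) => n w h1 h2.
by rewrite (le_trans (ler_normD _ _))// lerD.
Qed.

Lemma osmallM U V : osmall U -> Obig V -> osmall (fun n w => U n w * V n w).
Proof.
move=> oU oV delta e d0 e0; rewrite (splitr delta).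
have d20 : 0 < delta / 2 by rewrite divr_gt0.
have [K K0 hK] := oV _ d20.
have eK0 : 0 < e / K by rewrite divr_gt0.
apply: (whp_le2 (oU _ _ d20 eK0) hK) => n w h1 h2.
have -> : e = e / K * K by rewrite divfK// gt_eqF.
by rewrite normrM ler_pM.
Qed.

Lemma ObigM U V : Obig U -> Obig V -> Obig (fun n w => U n w * V n w).
Proof.
move=> oU oV delta d0; rewrite (splitr delta).
have d20 : 0 < delta / 2 by rewrite divr_gt0.
have [K K0 hK] := oU _ d20; have [L L0 hL] := oV _ d20.
exists (K * L); first by rewrite mulr_gt0.
by apply: (whp_le2 hK hL) => n w h1 h2; rewrite normrM ler_pM.
Qed.

Lemma osmall_cvg0 (u : nat -> R) : u @ \oo --> 0 -> osmall (fun n _ => u n).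
Proof.
move=> /cvgr0Pnorm_le u0 delta e d0 e0; have [N _ h] := u0 _ e0.
exists N => n /h une; exists set0; split=> //; by rewrite measure0 lee_fin ltW.
Qed.

Lemma Obig_cst k : Obig (fun _ _ => k).
Proof.
move=> delta d0; exists (`|k| + 1); first by rewrite ltr_wpDl.
by exists 0 => n _; exists set0; split=> //; [rewrite measure0 lee_fin ltW|move=> w _; rewrite lerDl].
Qed.

Lemma osmall0 : osmall (fun _ _ => 0).
Proof. by apply: osmall_cvg0; exact: cvg_cst. Qed.

Lemma osmall_sum (I : Type) (s : seq I) (F : I -> nat -> T -> R) :
  (forall i, osmall (F i)) -> osmall (fun n w => \sum_(i <- s) F i n w).
Proof.
move=> oF; elim: s => [|i s IHs].
  by under eq_fun do under eq_fun do rewrite big_nil; exact: osmall0.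
by under eq_fun do under eq_fun do rewrite big_cons; exact: osmallD.
Qed.

Lemma Obig_sum (I : Type) (s : seq I) (F : I -> nat -> T -> R) :
  (forall i, Obig (F i)) -> Obig (fun n w => \sum_(i <- s) F i n w).
Proof.
move=> oF; elim: s => [|i s IHs].
  by under eq_fun do under eq_fun do rewrite big_nil; exact: Obig_cst.
by under eq_fun do under eq_fun do rewrite big_cons; exact: ObigD.
Qed.

Lemma ler_mx_norm_sum m n (A : 'M[R]_(m, n)) : `|A| <= \sum_i \sum_j `|A i j|.
Proof.
apply: mx_norm_le => [|i j].
  by apply: sumr_ge0 => i _; apply: sumr_ge0.
rewrite (bigD1 i)//= (bigD1 j)//= -addrA lerDl addr_ge0//; first by apply: sumr_ge0.
by apply: sumr_ge0 => i' _; apply: sumr_ge0.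
Qed.

Lemma osmall_norm U : osmall U -> osmall (fun n w => `|U n w|).
Proof. by move=> /le_osmall; apply=> n w; rewrite normr_id. Qed.

Lemma Obig_norm U : Obig U -> Obig (fun n w => `|U n w|).
Proof. by move=> /le_Obig; apply=> n w; rewrite normr_id. Qed.

Lemma osmall_mx m p (U : nat -> T -> 'M[R]_(m, p)) :
  (forall i j, osmall (fun n w => U n w i j)) -> osmall (fun n w => `|U n w|).
Proof.
move=> oU; apply: le_osmall (_ : osmall (fun n w => \sum_i \sum_j `|U n w i j|)) _.
  by apply: osmall_sum => i; apply: osmall_sum => j; apply: osmall_norm.
move=> n w; rewrite normr_id (le_trans (ler_mx_norm_sum _))// ler_norm//.
Qed.

Lemma Obig_mx m p (U : nat -> T -> 'M[R]_(m, p)) :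
  (forall i j, Obig (fun n w => U n w i j)) -> Obig (fun n w => `|U n w|).
Proof.
move=> oU; apply: le_Obig (_ : Obig (fun n w => \sum_i \sum_j `|U n w i j|)) _.
  by apply: Obig_sum => i; apply: Obig_sum => j; apply: Obig_norm.
move=> n w; rewrite normr_id (le_trans (ler_mx_norm_sum _))// ler_norm//.
Qed.

End stochastic_orders.

(** The events [|x| > k] decrease to the empty set, so their measures tend to [0]. *)
Lemma finite_measure_tight (R : realType) n (nu : probability (borel_mx R n 1) R) (delta : R) :
  0 < delta -> exists2 L : R, 0 < L & exists A : set (borel_mx R n 1),
    [/\ measurable A, (nu A <= delta%:E)%E &
     forall x : 'cV[R]_n, ~ A x -> forall j, `|x j 0| <= L].
Proof.
move=> d0.
pose A (k : nat) : set (borel_mx R n 1) := [set x : 'cV[R]_n | k%:R < `|x| ].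
have mA k : measurable (A k).
  have mn : measurable_fun [set: borel_mx R n 1] ((fun x : 'cV[R]_n => `|x|) : borel_mx R n 1 -> R).
    by apply: continuous_measurable_mx; exact: norm_continuous.
  rewrite (_ : A k = (fun x : 'cV[R]_n => `|x|) @^-1` `]k%:R, +oo[%classic).
    by rewrite -[X in measurable X]setTI; exact: mn.
  by apply/seteqP; split=> x; rewrite /A /= in_itv /= andbT.
have : nu (A k) @[k --> \oo] --> nu (\bigcap_k A k).
  apply: nonincreasing_cvg_mu => //.
  - by rewrite (le_lt_trans (probability_le1 _ _))// ltry.
  - exact: bigcap_measurable.
  - move=> k l kl; apply/subsetPset => x; rewrite /A /=.
    by apply: le_lt_trans; rewrite ler_nat.
have -> : \bigcap_k A k = set0.
  apply/seteqP; split=> // x /(_ (Num.truncn `|x : 'cV[R]_n|).+1 I); rewrite /A /=.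
  by rewrite ltNge ltW// truncnS_gt.
rewrite measure0 => /fine_cvgP[_ /cvgr0Pnorm_le/(_ _ d0)[N _ h]].
exists N.+1%:R => //; exists (A N.+1); split=> //.
  have := h N.+1 (leqnSn _); rewrite /= ger0_norm ?fine_ge0// -lee_fin fineK// fin_num_measure//.
by move=> x /negP; rewrite -leNgt => xN j; exact: le_trans (ler_mx_norm _ _ _) xN.
Qed.

(** * Weak convergence tested on cosines *)

Section weak_convergence.
Context {d : measure_display} {Omega : measurableType d} {R : realType}.
Variable P : probability Omega R.
Context {n : nat}.
Variables (Z : nat -> Omega -> 'cV[R]_n) (nu : probability (borel_mx R n 1) R).
Hypothesis mZ : forall k, measurable_mx (Z k).

Let measZ (f : 'cV[R]_n -> R) k : continuous f -> measurable_fun [set: Omega] (fun w => f (Z k w)).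
Proof.
by move=> cf; exact: (measurableT_comp (continuous_measurable_mx cf) (mZ k)).
Qed.

Lemma cvg_trig_poly g :
  (forall c b, \int[P]_w cos (dotv c (Z k w) + b) @[k --> \oo] -->
     \int[nu]_x cos (dotv c x + b)) ->
  trig_poly g -> \int[P]_w g (Z k w) @[k --> \oo] --> \int[nu]_x g x.
Proof.
move=> hcos; have iP k f : trig_poly f -> rv_int P (fun w => f (Z k w)).
  move=> tf; have [M fM] := trig_poly_bounded tf.
  apply: (@rv_int_bounded _ _ _ _ _ M) => //.
  by apply: measZ; exact: trig_poly_continuous.
have iN f : trig_poly f -> rv_int nu f.
  move=> tf; have [M fM] := trig_poly_bounded tf.
  apply: (@rv_int_bounded _ _ _ _ _ M) => //.
  by apply: continuous_measurable_mx; exact: trig_poly_continuous.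
elim=> [c b|f1 f2 t1 h1 t2 h2|k f1 t h]; first exact: hcos.
- rewrite (exD (iN _ t1) (iN _ t2)).
  under eq_fun do rewrite (exD (iP _ _ t1) (iP _ _ t2)).
  exact: cvgD.
- rewrite (exZ _ (iN _ t)).
  under eq_fun do rewrite (exZ _ (iP _ _ t)).
  by apply: cvgM => //; exact: cvg_cst.
Qed.

(** Under each law the mean of [f] is replaced by that of a trigonometric polynomial [g]. The cost
    is [e5] on a cube carrying both laws up to [dl], plus [2 * M * dl] outside it; for [g] the
    convergence is already known. *)
Lemma cvg_in_distribution_cos : Obig P (fun k w => `|Z k w|) ->
  (forall c b, \int[P]_w cos (dotv c (Z k w) + b) @[k --> \oo] -->
     \int[nu]_x cos (dotv c x + b)) ->
  cvg_in_distribution P Z nu.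
Proof.
move=> tight hcos f cf [M fM].
have M0 : 0 <= M by exact: le_trans (fM 0).
have iP k h M' : continuous h -> (forall x, `|h x| <= M') -> rv_int P (fun w => h (Z k w)).
  by move=> ch hM; apply: (@rv_int_bounded _ _ _ _ _ M') => //; apply: measZ.
have iN h M' : continuous h -> (forall x : 'cV[R]_n, `|h x| <= M') -> rv_int nu h.
  by move=> ch hM; apply: (@rv_int_bounded _ _ _ _ _ M') => //; exact: continuous_measurable_mx.
rewrite -(EFin_ex (iN _ _ cf fM)).
under eq_fun do rewrite -(EFin_ex (iP _ _ _ cf fM)).
apply: cvg_EFin; first by near=> k.
apply/cvgrPdist_le => e e0.
pose e5 := e / 5.
have e50 : 0 < e5 by rewrite divr_gt0.
(* The [+ 1] keeps the denominator positive when [M = 0]; the part outside the cube then costs at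
   most [e5]. *)
pose dl := e5 / (2 * M + 1).
have dl0 : 0 < dl by rewrite divr_gt0// ltr_wpDl// mulr_ge0.
have Mdl : 2 * M * dl <= e5.
  rewrite /dl mulrCA ler_piMr ?(ltW e50)// ler_pdivrMr ?ltr_wpDl ?mulr_ge0// mul1r lerDl//.
have [L1 L10 [N1 hL1]] := tight _ dl0.
have [L2 L20 [B [mB nuB hL2]]] := finite_measure_tight nu dl0.
(* One cube has to serve both the sequence and its limit. *)
pose L := L1 + L2.
have L0 : 0 < L by rewrite addr_gt0.
have [g [tg gM gf]] := trig_approx cf fM L0 e50.
have cg := trig_poly_continuous tg.
have cfg : continuous (fun x => f x - g x).
  by move=> x; apply: continuousB; [exact: cf|exact: cg].
have fgM x : `|f x - g x| <= 2 * M.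
  by rewrite (le_trans (ler_normB _ _))// mulr_natl mulr2n lerD.
have nuX : `|\int[nu]_x f x - \int[nu]_x g x| <= e5 + e5.
  rewrite -(exB (iN _ _ cf fM) (iN _ _ cg gM)).
  apply: le_trans (_ : e5 + 2 * M * dl <= _); last by rewrite lerD2l.
  apply: (@ex_split _ _ _ nu _ B) => //.
  - exact: continuous_measurable_mx.
  - exact: ltW.
  - by rewrite mulr_ge0.
  - by move=> x /hL2 xL; apply: gf => j; rewrite (le_trans (xL j))// lerDr ltW.
have /cvgrPdist_le/(_ _ e50)[N2 _ hN2] := cvg_trig_poly hcos tg.
exists (maxn N1 N2) => // k; rewrite /= geq_max => /andP[/hL1[A [mA PA AP]] /hN2 /= gk].
have PX : `|\int[P]_w f (Z k w) - \int[P]_w g (Z k w)| <= e5 + e5.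
  rewrite -(exB (iP _ _ _ cf fM) (iP _ _ _ cg gM)).
  apply: le_trans (_ : e5 + 2 * M * dl <= _); last by rewrite lerD2l.
  apply: (@ex_split _ _ _ P _ A) => //.
  - exact: (measZ k cfg).
  - exact: ltW.
  - by rewrite mulr_ge0.
  - move=> w /AP; rewrite normr_id => ZL; apply: gf => j.
    by rewrite (le_trans (ler_mx_norm _ _ _))// (le_trans ZL)// lerDl ltW.
rewrite (_ : _ - _ = (\int[nu]_x f x - \int[nu]_x g x) +
   (\int[nu]_x g x - \int[P]_w g (Z k w)) -
   (\int[P]_w f (Z k w) - \int[P]_w g (Z k w))); last by ring.
rewrite (le_trans (ler_normB _ _))// (_ : e = (e5 + e5) + e5 + (e5 + e5)); last by rewrite /e5; field.
by rewrite lerD// (le_trans (ler_normD _ _))// lerD.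
Unshelve. all: by end_near.
Qed.

End weak_convergence.

(** * Laws and Gaussian vectors *)

Section laws.
Context {d d' : measure_display} {T : measurableType d} {T' : measurableType d'}.
Context {R : realType}.

Definition law (P : probability T R) (X : T -> T') (mX : measurable_fun [set: T] X) :
    probability T' R :=
  distribution P (HB.pack X (isMeasurableFun.Build _ _ _ _ X mX) : {mfun T >-> T'}).

Lemma rv_int_law (P : probability T R) X (mX : measurable_fun [set: T] X) (f : T' -> R) :
  measurable_fun [set: T'] f -> rv_int P (fun w => f (X w)) -> rv_int (law P mX) f.
Proof.
move=> mf iX; apply: integrable_pushforward => //; exact/measurable_EFinP.
Qed.

Lemma ex_law (P : probability T R) X (mX : measurable_fun [set: T] X) (f : T' -> R) :
  measurable_fun [set: T'] f -> rv_int P (fun w => f (X w)) ->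
  \int[law P mX]_x f x = \int[P]_w f (X w).
Proof.
move=> mf iX; rewrite /Rintegral; congr fine.
by rewrite integral_distribution//; exact/measurable_EFinP.
Qed.

Lemma rv_int_eq_measure (P Q : probability T R) (f : T -> R) :
  (forall B, measurable B -> P B = Q B) -> rv_int P f -> rv_int Q f.
Proof.
move=> PQ /integrableP[mf fi]; apply/integrableP; split=> //.
by rewrite (eq_measure_integral P)// => B mB _; exact/esym/PQ.
Qed.

Lemma ex_eq_measure (P Q : probability T R) (f : T -> R) :
  (forall B, measurable B -> P B = Q B) -> \int[P]_x f x = \int[Q]_x f x.
Proof.
by move=> PQ; rewrite /Rintegral; congr fine; apply: eq_measure_integral => B mB _; exact: PQ.
Qed.

End laws.

(** * A real law is determined by its cosine integrals *)

Section law_unique.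
Context {R : realType}.
Variables mu1 mu2 : probability R R.
Hypothesis cos_eq : forall t b,
  \int[mu1]_x cos (t * x + b) = \int[mu2]_x cos (t * x + b).

Let emb (x : R) : 'cV[R]_1 := x%:M.

Let mxM : measurable_mx emb.
Proof.
apply: measurable_mx_coords => i j; rewrite /emb !ord1.
rewrite (_ : (fun t => _) = id); first exact: measurable_id.
by apply/funext => x; rewrite mxE.
Qed.

Let rv_cos (mu : probability R R) t b : rv_int mu (fun x : R => cos (t * x + b)).
Proof.
apply: (@rv_int_bounded _ _ _ _ _ 1) => [|w]; last exact: cos_max.
apply: continuous_measurable_fun => x.
apply: (@continuous_comp _ _ _ (fun x => t * x + b) cos); last exact: continuous_cos.
by apply: continuousD; [apply: mulrl_continuous|exact: cst_continuous].
Qed.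

(** The convergence criterion is applied to the constant sequence of law [mu1] with limit [mu2],
    both carried to 1 by 1 matrices by [emb]: a constant sequence converges only to its own
    value. *)
Lemma ex_bounded_eq (h : R -> R) (M : R) : continuous h -> (forall x, `|h x| <= M) ->
  \int[mu1]_x h x = \int[mu2]_x h x.
Proof.
move=> ch hM.
have mh : measurable_fun [set: R] h by exact: continuous_measurable_fun.
have ih (mu : probability R R) : rv_int mu h by exact: rv_int_bounded hM.
have mcoord : measurable_fun [set: borel_mx R 1 1] (fun v : borel_mx R 1 1 => v 0 0 : R).
  by apply: continuous_measurable_mx; exact: coord_continuous.
have cf : continuous (fun v : 'cV[R]_1 => h (v 0 0)).
  move=> v; apply: (@continuous_comp _ _ _ (fun v : 'cV[R]_1 => v 0 0) h); last exact: ch.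
  exact: coord_continuous.
have dE (c : 'cV[R]_1) x : dotv c (emb x) = c 0 0 * x.
  by rewrite dotvE big_ord1 mxE.
have tight : Obig mu1 (fun (_ : nat) w => `|emb w|).
  move=> delta d0; have [L L0 [A [mA PA AL]]] := finite_measure_tight (law mu1 mxM) d0.
  exists L => //; exists 0 => n _; exists (emb @^-1` A); split => //.
    by rewrite -[X in measurable X]setTI; exact: mxM.
  move=> w /AL xL; rewrite normr_id; apply: mx_norm_le; first exact: ltW.
  by move=> i j; rewrite !ord1.
have hcos c b : \int[mu1]_w cos (dotv c (emb w) + b) @[_ --> \oo] -->
     \int[law mu2 mxM]_x cos (dotv c (x : 'cV[R]_1) + b).
  rewrite (@ex_law _ _ R (borel_mx R 1 1) R mu2 (emb : R -> borel_mx R 1 1) mxM).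
  + under [X in _ --> X]eq_Rintegral do rewrite dE.
    under [X in fmap (fun _ => X)]eq_Rintegral do rewrite dE.
    by rewrite cos_eq; exact: cvg_cst.
  + apply: continuous_measurable_mx.
    exact: trig_poly_continuous (trig_cos c b).
  + by under eq_fun do rewrite dE; exact: rv_cos.
have hM' : exists M, forall v : 'cV[R]_1, `|h (v 0 0)| <= M by exists M.
have := cvg_in_distribution_cos (fun=> mxM) tight hcos cf hM'.
move=> /(cvg_lim (@ereal_hausdorff R)); rewrite lim_cst; last exact: ereal_hausdorff.
have eE (x : R) : h (emb x 0 0) = h x by rewrite mxE.
under eq_integral do rewrite eE.
move=> E; transitivity (\int[law mu2 mxM]_v h ((v : 'cV[R]_1) 0 0)).
  by rewrite /Rintegral E.
have ihe : rv_int mu2 (fun w : R => h (emb w 0 0)) by under eq_fun do rewrite eE; exact: ih.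
rewrite (@ex_law _ _ R (borel_mx R 1 1) R mu2 (emb : R -> borel_mx R 1 1) mxM
  (fun v => h ((v : 'cV[R]_1) 0 0)) (continuous_measurable_mx cf) ihe).
by under eq_Rintegral do rewrite eE.
Qed.

(** Open half-lines form a pi-system generating the Borel sets, and their indicators are pointwise
    limits of bounded continuous ramps. *)
Lemma law_unique_cos B : measurable B -> mu1 B = mu2 B.
Proof.
pose ray := [set A : set R | exists x, A = `]x, +oo[%classic].
have rayE A : ray A -> mu1 A = mu2 A.
  move=> [x ->].
  pose h (k : nat) (y : R) := Num.min 1 (Num.max 0 (k%:R * (y - x))).
  have ch k : continuous (h k).
    move=> y; apply: (@continuous_min _ _ (fun=> 1) (fun y => Num.max 0 (k%:R * (y - x)))).
      exact: cst_continuous.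
    apply: (@continuous_max _ _ (fun=> 0) (fun y => k%:R * (y - x))).
      exact: cst_continuous.
    apply: continuousM; first exact: cst_continuous.
    by apply: continuousB => //; exact: cst_continuous.
  have hb k y : `|h k y| <= 1.
    by rewrite ger0_norm /h ?ge_min ?lexx// le_min ler01 le_max lexx.
  have hlim y : (h k y)%:E @[k --> \oo] --> (\1_(`]x, +oo[%classic) y)%:E.
    rewrite indicE; have [/set_mem|/negP yx] := boolP (y \in _).
      rewrite /= in_itv /= andbT -subr_gt0 => yx.
      apply: cvg_near_cst; exists (Num.truncn (y - x)^-1).+1 => // k /= k1.
      rewrite /h max_r ?mulr_ge0 ?(ltW yx)// min_l//.
      rewrite -ler_pdivrMr// mul1r (le_trans (ltW (truncnS_gt _)))// ler_nat//.
    have yx' : y - x <= 0.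
      by rewrite subr_le0 leNgt; apply/negP => xy; apply: yx; rewrite inE /= in_itv /= xy.
    apply: cvg_near_cst; near=> k.
    by rewrite /h max_l ?min_r// mulr_ge0_le0.
  have lim (mu : probability R R) : \int[mu]_y h k y @[k --> \oo] --> fine (mu `]x, +oo[%classic).
    rewrite -(@ex_indic _ _ _ mu `]x, +oo[%classic (measurable_itv _)).
    have ih k : rv_int mu (h k).
      by apply: (@rv_int_bounded _ _ _ _ _ 1) => //; exact: continuous_measurable_fun.
    have i1 : rv_int mu (\1_(`]x, +oo[%classic) : R -> R).
      by apply: (@rv_int_bounded _ _ _ _ _ 1) => // w; rewrite indicE; case: (_ \in _); rewrite ?normr1 ?normr0.
    apply: fine_cvg; rewrite fineK; last exact: integrable_fin_num.
    have [] := @dominated_convergence _ _ _ mu setT measurableT (fun k y => (h k y)%:E)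
      (fun y => (\1_(`]x, +oo[%classic) y)%:E) (fun=> 1%E) => //.
    - by move=> k; apply/measurable_EFinP; exact: continuous_measurable_fun.
    - by apply/measurable_EFinP.
    - by apply: aeW => y _; exact: hlim.
    - exact: (rv_int_cst mu 1).
    - by apply: aeW => y k _; rewrite lee_fin.
  have := lim mu1.
  under eq_fun do rewrite (ex_bounded_eq (ch _) (hb _)).
  move=> lim1; have E := cvg_unique _ lim1 (lim mu2).
  have fin (mu : probability R R) : mu `]x, +oo[%classic \is a fin_num.
    by apply: fin_num_measure; exact: measurable_itv.
  by rewrite -(fineK (fin mu1)) -(fineK (fin mu2)) E.
move=> mB.
apply: (@dynkin_induction _ R ray (fun B => mu1 B = mu2 B)) => //.
- exact: measurable_realfun.RGenOInfty.measurableE.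
- move=> _ _ [x ->] [y ->]; exists (Num.max x y).
  apply/seteqP; split=> z /=; rewrite !in_itv /= !andbT gt_max.
    by move=> [-> ->].
  by move=> /andP[].
- by rewrite !probability_setT.
- by move=> S mS SE; rewrite !probability_setC//; congr (_ - _)%E.
- move=> F mF tF FE; rewrite !measure_bigcup//.
  by apply: eq_eseriesr => i _; exact: FE.
- have mB' : @measurable _ (g_sigma_algebraType (@measurable_realfun.RGenOInfty.G R)) B.
    by rewrite -measurable_realfun.RGenOInfty.measurableE.
  exact: mB'.
Unshelve. all: by end_near.
Qed.

End law_unique.

Section derivatives.
Context {R : realType}.
Implicit Types k t b x : R.

Lemma is_derive_affine t b x : is_derive x 1 (fun y : R => t * y + b) t.
Proof.
have h1 := @is_deriveZ R R^o R^o id t x 1 1 (is_derive_id _ _).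
have h2 := is_deriveD h1 (is_derive_cst b x 1).
by apply: (@is_derive_eq _ _ _ _ _ _ _ _ h2); rewrite addr0 /GRing.scale /= mulr1.
Qed.

Lemma is_derive_sqr k x : is_derive x 1 (fun y : R => k * y ^+ 2) (2 * k * x).
Proof.
have h : is_derive x 1 (fun y : R => y * y) (x * 1 + x * 1) by exact: is_deriveM.
have h2 := @is_deriveZ R R^o R^o (fun y : R => y * y) k x 1 _ h.
by apply: (@is_derive_eq _ _ _ (k \*: (fun y : R => y * y))); rewrite /GRing.scale /=; ring.
Qed.

Lemma is_derive_gauss k x :
  is_derive x 1 (fun y : R => expR (k * y ^+ 2)) (expR (k * x ^+ 2) * (2 * k * x)).
Proof.
exact: (@is_derive1_comp R expR (fun y : R => k * y ^+ 2) x _ _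
  (is_derive_expR _) (is_derive_sqr k x)).
Qed.

Lemma is_derive_cos_affine t b x :
  is_derive x 1 (fun y : R => cos (t * y + b)) (- sin (t * x + b) * t).
Proof.
exact: (@is_derive1_comp R cos (fun y : R => t * y + b) x _ _
  (is_derive_cos _) (is_derive_affine t b x)).
Qed.

Lemma is_derive_sin_affine t b x :
  is_derive x 1 (fun y : R => sin (t * y + b)) (cos (t * x + b) * t).
Proof.
exact: (@is_derive1_comp R sin (fun y : R => t * y + b) x _ _
  (is_derive_sin _) (is_derive_affine t b x)).
Qed.

Lemma is_derive_continuous (f : R -> R) (df : R -> R) :
  (forall x, is_derive x 1 f (df x)) -> continuous f.
Proof.
move=> fd x; apply: differentiable_continuous; apply/derivable1_diffP.
exact: ex_derive.
Qed.

Lemma continuous_cos_affine t b : continuous (fun y : R => cos (t * y + b)).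
Proof. by apply: is_derive_continuous; exact: is_derive_cos_affine. Qed.

Lemma continuous_sin_affine t b : continuous (fun y : R => sin (t * y + b)).
Proof. by apply: is_derive_continuous; exact: is_derive_sin_affine. Qed.

End derivatives.

(** * Cosine integrals of a normal law *)

Section normal_cos.
Context {R : realType}.
Variable s : R.
Hypothesis s0 : s != 0.
Local Notation mu := (@lebesgue_measure R).
Local Notation p := (normal_pdf 0 s).

Let s20 : 0 < s ^+ 2.
Proof. by rewrite exprn_even_gt0. Qed.

Let pE : p = (fun x => normal_peak s * expR (- (2 * s ^+ 2)^-1 * x ^+ 2)).
Proof.
apply/funext => x; rewrite normal_pdfE// /normal_fun subr0; congr (_ * expR _).
by rewrite mulNr mulNr mulrC mulr2n [in RHS]mulr_natl mulr2n.
Qed.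

Let p_ge0 x : 0 <= p x.
Proof. exact: normal_pdf_ge0. Qed.

Let is_derive_p (x : R) : is_derive x 1 (p : R -> R) (- (s ^+ 2)^-1 * (x * p x)).
Proof.
have h := @is_deriveZ R R^o R^o _ (normal_peak s) x 1 _ (is_derive_gauss (- (2 * s ^+ 2)^-1) x).
rewrite pE; apply: (@is_derive_eq _ _ _ _ _ _ _ _ h).
rewrite /GRing.scale /=; move: (normal_peak s) (expR _) => c e.
by field.
Qed.

Let continuous_p : continuous (p : R -> R).
Proof. exact: is_derive_continuous is_derive_p. Qed.

(** An integrable envelope of [|x| * p x]. With [y = 3 / 8 * x ^+ 2 / s ^+ 2], passing from
    parameter [s] to [2 * s] multiplies the density by [expR y], up to the ratio of the peaks, and
    [|x| <= 1 + x ^+ 2 <= (1 + 8 / 3 * s ^+ 2) * expR y]. *)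
Let g (x : R) : R := (1 + 8 / 3 * s ^+ 2) * normal_peak s / normal_peak (2 * s) * normal_pdf 0 (2 * s) x.

Let c0 : 0 <= (1 + 8 / 3 * s ^+ 2) * normal_peak s / normal_peak (2 * s).
Proof.
apply: mulr_ge0; last by rewrite invr_ge0 normal_peak_ge0.
by apply: mulr_ge0; [have := s20; nra|exact: normal_peak_ge0].
Qed.

Let g_ge0 x : 0 <= g x.
Proof. by rewrite mulr_ge0 ?c0 ?normal_pdf_ge0. Qed.

Let int_g : mu.-integrable [set: R] (EFin \o g).
Proof.
rewrite (_ : _ \o _ = (fun x => ((1 + 8 / 3 * s ^+ 2) * normal_peak s / normal_peak (2 * s))%:E * (normal_pdf 0 (2 * s) x)%:E)%E)//.
by apply: integrableZl => //; exact: integrable_normal_pdf.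
Qed.

Let int_p : mu.-integrable [set: R] (EFin \o p).
Proof. exact: integrable_normal_pdf. Qed.

Let le_xp (x : R) : `|x| * p x <= g x.
Proof.
have s20' : 2 * s != 0 by rewrite mulf_neq0.
rewrite /g pE (normal_pdfE _ s20') /normal_fun subr0.
have := normal_peak_gt0 s20'; have := normal_peak_gt0 s0.
move: (normal_peak s) (normal_peak (2 * s)) => c1 c2 c10 c20.
rewrite (_ : - x ^+ 2 / ((2 * s) ^+ 2 *+ 2) = - (8 * s ^+ 2)^-1 * x ^+ 2); last first.
  by rewrite -mulr_natl; field; rewrite s0.
rewrite (_ : - (2 * s ^+ 2)^-1 * x ^+ 2 = - (8 * s ^+ 2)^-1 * x ^+ 2 - 3 / 8 * x ^+ 2 / s ^+ 2); last first.
  by field; rewrite s0.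
rewrite expRD (_ : _ / c2 * _ = c1 * expR (- (8 * s ^+ 2)^-1 * x ^+ 2) * (1 + 8 / 3 * s ^+ 2)); last first.
  by field; rewrite gt_eqF.
rewrite (_ : `|x| * _ = c1 * expR (- (8 * s ^+ 2)^-1 * x ^+ 2) * (`|x| * expR (- (3 / 8 * x ^+ 2 / s ^+ 2)))); last by ring.
rewrite ler_wpM2l//; first by rewrite mulr_ge0 ?expR_ge0// ltW.
rewrite expRN ler_pdivrMr ?expR_gt0//.
set y := 3 / 8 * x ^+ 2 / s ^+ 2.
have y0 : 0 <= y by rewrite /y divr_ge0 ?sqr_ge0// mulr_ge0 ?sqr_ge0//; lra.
have xy : x ^+ 2 = 8 / 3 * s ^+ 2 * y by rewrite /y; field; rewrite s0.
have x1 : `|x| <= 1 + x ^+ 2 by rewrite -(real_normK (num_real x)); have := sqr_ge0 (`|x| - 1); nra.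
have e1 := expR_ge1Dx y; have := s20; nra.
Qed.

Let meas_trig (h : R -> R) : continuous h -> measurable_fun [set: R] h.
Proof. exact: continuous_measurable_fun. Qed.

Let le_int (f : R -> R) : continuous f -> (exists k : R, forall x, `|f x| <= k * p x + k * g x) ->
  mu.-integrable [set: R] (EFin \o f).
Proof.
move=> cf [k fk].
have i2 : mu.-integrable [set: R] (fun x => (k%:E * (EFin \o p) x + k%:E * (EFin \o g) x)%E).
  by apply: integrableD => //; apply: integrableZl => //.
apply: (le_integrable _ _ _ i2) => //; first by apply/measurable_EFinP; exact: meas_trig.
by move=> x _ /=; rewrite lee_fin (le_trans (fk x))// ler_norm.
Qed.

Let int_cosp t b : mu.-integrable [set: R] (EFin \o (fun x : R => cos (t * x + b) * p x)).
Proof.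
apply: le_int => [x|].
  by apply: continuousM; [exact: continuous_cos_affine|exact: continuous_p].
exists 1 => x; rewrite !mul1r normrM (ger0_norm (p_ge0 x)).
by rewrite (le_trans (ler_piMl _ (cos_max _)))// lerDl g_ge0.
Qed.

Let int_xsinp t b : mu.-integrable [set: R] (EFin \o (fun x : R => sin (t * x + b) * (x * p x))).
Proof.
apply: le_int => [x|].
  apply: (@continuousM R R (fun x => sin (t * x + b)) (fun x => x * p x)).
    exact: continuous_sin_affine.
  by apply: (@continuousM R R id p) => //; exact: continuous_p.
exists 1 => x; rewrite !mul1r normrM normrM (ger0_norm (p_ge0 x)).
rewrite (le_trans (ler_piMl _ (sin_max _))) ?mulr_ge0//.
by rewrite (le_trans (le_xp x))// lerDr.
Qed.

(* Stein's identity, from the vanishing of the integral of the derivative of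
   sin (t x + b) p x *)
Let stein t b : \int[mu]_x (sin (t * x + b) * (x * p x)) =
  s ^+ 2 * t * \int[mu]_x (cos (t * x + b) * p x).
Proof.
pose h (x : R) : R := sin (t * x + b) * p x.
pose dh (x : R) : R := t * (cos (t * x + b) * p x) - (s ^+ 2)^-1 * (sin (t * x + b) * (x * p x)).
have hd (x : R) : is_derive x 1 h (dh x).
  have h1 := is_deriveM (is_derive_sin_affine t b x) (is_derive_p x).
  apply: (@is_derive_eq _ _ _ _ _ _ _ _ h1).
  by rewrite /GRing.scale /= /dh; ring.
have ch : continuous h by exact: is_derive_continuous hd.
have cdh : continuous dh.
  move=> x; apply: (@continuousB R R R (fun x => t * (cos (t * x + b) * p x))
    (fun x => (s ^+ 2)^-1 * (sin (t * x + b) * (x * p x)))).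
    apply: (@continuousM R R (fun=> t) (fun x => cos (t * x + b) * p x)).
      exact: cst_continuous.
    by apply: continuousM; [exact: continuous_cos_affine|exact: continuous_p].
  apply: (@continuousM R R (fun=> (s ^+ 2)^-1) (fun x => sin (t * x + b) * (x * p x))).
    exact: cst_continuous.
  apply: (@continuousM R R (fun x => sin (t * x + b)) (fun x => x * p x)).
    exact: continuous_sin_affine.
  by apply: (@continuousM R R id p) => //; exact: continuous_p.
have int1 : mu.-integrable [set: R] (EFin \o (fun x : R => t * (cos (t * x + b) * p x))).
  by have := integrableZl measurableT t (int_cosp t b).
have int2 : mu.-integrable [set: R] (EFin \o (fun x : R => (s ^+ 2)^-1 * (sin (t * x + b) * (x * p x)))).
  by have := integrableZl measurableT (s ^+ 2)^-1 (int_xsinp t b).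
have int_dh : mu.-integrable [set: R] (EFin \o dh).
  by have := integrableB measurableT int1 int2.
suff dh0 : \int[mu]_x dh x = 0.
  move: dh0; rewrite /dh RintegralB//.
  rewrite !RintegralZl// => /eqP; rewrite subr_eq0 => /eqP E.
  by rewrite -mulrA E mulrA mulfV ?mul1r// gt_eqF.
(* On [I n] the integral of [dh] is a difference of boundary values of [h], which tend to [0]
   because [|x| * |h x|] is bounded; dominated convergence passes to the whole line. *)
pose I (n : nat) : set R := `[(- n.+1%:R), n.+1%:R]%classic.
have mI n : measurable (I n) by rewrite /I; exact: (@measurable_itv R).
have lim1 : (\int[mu]_x (dh x * \1_(I n) x)%:E @[n --> \oo] --> \int[mu]_x (dh x)%:E)%E.
  have [] := @dominated_convergence _ _ _ mu setT measurableT
    (fun n x => (dh x * \1_(I n) x)%:E) (fun x => (dh x)%:E) (fun x => `|(dh x)%:E|%E) => //.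
  - move=> n; apply/measurable_EFinP; apply: measurable_funM.
      exact: (meas_trig cdh).
    by apply: measurable_indic; exact: mI.
  - by apply/measurable_EFinP; exact: (meas_trig cdh).
  - apply: aeW => x _; apply: cvg_near_cst.
    exists (Num.truncn `|x|) => // n /= xn.
    rewrite indicE mem_set ?mulr1// /I /= in_itv /= -ler_norml.
    by rewrite ltW// (lt_le_trans (truncnS_gt _))// ler_nat.
  - exact: integrable_abse.
  - apply: aeW => x n _ /=; rewrite lee_fin normrM indicE.
    by case: (_ \in _); rewrite ?normr1 ?normr0 ?mulr1 ?mulr0.
have intI n : (\int[mu]_x (dh x * \1_(I n) x)%:E = (h n.+1%:R - h (- n.+1%:R))%:E)%E.
  transitivity (\int[mu]_(x in I n) (dh x)%:E)%E.
    rewrite [RHS]integral_mkcond; apply: eq_integral => x _.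
    by rewrite patchE indicE; case: ifPn; rewrite ?mulr1 ?mulr0.
  rewrite (@continuous_FTC2 _ dh h) ?EFinB//.
  - by rewrite -subr_gt0 opprK addr_gt0.
  - exact: continuous_subspaceT.
  - split.
    + by move=> x _; have [] := hd x.
    + by apply: cvg_at_right_filter; exact: ch.
    + by apply: cvg_at_left_filter; exact: ch.
  - by move=> x _; rewrite derive1E; have [_] := hd x.
have [C hle] : exists C, forall x, `|x| * `|h x| <= C.
  exists ((1 + 8 / 3 * s ^+ 2) * normal_peak s / normal_peak (2 * s) * normal_peak (2 * s)) => x.
  rewrite /h normrM (ger0_norm (p_ge0 x)) mulrCA.
  rewrite (le_trans (ler_piMl _ (sin_max _)))//; first by rewrite mulr_ge0.
  rewrite (le_trans (le_xp x))// /g ler_wpM2l ?c0// normal_pdf_ub//.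
  by rewrite mulf_neq0.
have lim2 : (\int[mu]_x (dh x * \1_(I n) x)%:E @[n --> \oo] --> 0)%E.
  under eq_fun do rewrite intI.
  apply: cvg_EFin; first by near=> n.
  apply/cvgr0Pnorm_le => e e0.
  exists (Num.truncn (2 * C / e)) => // n /= nC.
  have nC' : 2 * C <= n.+1%:R * e.
    rewrite -ler_pdivrMr// ltW// (lt_le_trans (truncnS_gt _))// ler_nat//.
  have h1 := hle n.+1%:R; have h2 := hle (- n.+1%:R).
  move: h1 h2; rewrite normrN normr_nat => h1 h2.
  rewrite -(ler_pM2l (ltr0Sn R n)) (le_trans _ nC')//.
  apply: (@le_trans _ _ (n.+1%:R * (`|h n.+1%:R| + `|h (- n.+1%:R)|))).
    by rewrite ler_wpM2l// ler_normB.
  by rewrite mulrDr [leRHS]mulr_natl mulr2n lerD.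
by rewrite /Rintegral (cvg_unique _ lim1 lim2).
Unshelve. all: by end_near.
Qed.

(** Differentiation under the integral, with envelope [g], and Stein's identity give the equation
    [F' a = - s ^+ 2 * a * F a]; multiplied by its integrating factor, [F] becomes constant. *)
Lemma normal_cos_pdf t b : \int[mu]_x (cos (t * x + b) * p x) =
  expR (- (s ^+ 2 * t ^+ 2 / 2)) * cos b.
Proof.
pose F t := \int[mu]_x (cos (t * x + b) * p x).
have dF (a : R) : is_derive a 1 F (- (s ^+ 2 * a) * F a).
  pose f (a x : R) := cos (a * x + b) * p x.
  have df (x a' : R) : is_derive a' 1 (f ^~ x) (- (sin (a' * x + b) * (x * p x))).
    have h1 : is_derive a' 1 (fun a : R => cos (x * a + b)) (- sin (x * a' + b) * x).
      exact: is_derive_cos_affine.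
    have h2 := @is_deriveZ R R^o R^o _ (p x) a' 1 _ h1.
    rewrite (_ : f ^~ x = p x \*: (fun a : R => cos (x * a + b))); last first.
      by apply/funext => a''; rewrite /f /GRing.scale /= mulrC (mulrC x).
    by apply: (@is_derive_eq _ _ _ _ _ _ _ _ h2); rewrite /GRing.scale /= (mulrC x); ring.
  have d1E x a' : partial1of2 f a' x = - (sin (a' * x + b) * (x * p x)).
    by rewrite partial1of2E; have [_] := df x a'.
  have Ia : (`]a - 1, a + 1[%classic : set R) a.
    by rewrite /= in_itv /= ltrBlDr ltrDl ltr01.
  have intf x : `]a - 1, a + 1[%classic x -> mu.-integrable [set: R] (EFin \o f x).
    by move=> _; exact: int_cosp.
  have derf x y : `]a - 1, a + 1[%classic x -> [set: R] y -> derivable (f ^~ y) x 1.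
    by move=> _ _; have [] := df y x.
  have ub x y : `]a - 1, a + 1[%classic x -> [set: R] y -> `|partial1of2 f x y| <= g y.
    move=> _ _; rewrite d1E normrN normrM normrM (ger0_norm (p_ge0 y)).
    by rewrite (le_trans (ler_piMl _ (sin_max _)))// mulr_ge0.
  have E := differentiation_under_integral measurableT Ia intf derf g_ge0 int_g ub.
  have D := derivable_under_integral measurableT Ia intf derf g_ge0 int_g ub.
  apply: DeriveDef; first exact: D.
  rewrite -derive1E [LHS]E.
  under eq_Rintegral do rewrite d1E -mulN1r.
  by rewrite RintegralZl ?stein ?mulN1r ?mulNr ?mulrA//; exact: int_xsinp.
pose G (a : R) : R := expR (s ^+ 2 / 2 * a ^+ 2) * F a.
have dG (a : R) : is_derive a 1 G 0.
  have h := is_deriveM (is_derive_gauss (s ^+ 2 / 2) a) (dF a).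
  apply: (@is_derive_eq _ _ _ _ _ _ _ _ h).
  by rewrite /GRing.scale /=; field.
have GE : G t = G 0 by exact: is_derive_0_is_cst.
have G0 : G 0 = cos b.
  rewrite /G expr0n /= mulr0 expR0 mul1r /F.
  under eq_Rintegral do rewrite mul0r add0r.
  rewrite RintegralZl//.
  by rewrite /Rintegral integral_normal_pdf /= mulr1.
rewrite -/(F t) -G0 -GE /G mulrA -expRD.
by rewrite [X in expR X](_ : _ = 0) ?expR0 ?mul1r//; field.
Qed.

(** [normal_prob] is given by its values on sets, so its Radon-Nikodym derivative is first
    identified with [normal_pdf] almost everywhere. *)
Lemma ex_normal_prob (f : R -> R) M : measurable_fun [set: R] f -> (forall x, `|f x| <= M) ->
  \int[normal_prob 0 s]_x f x = \int[mu]_x (f x * p x).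
Proof.
move=> mf fM; rewrite /Rintegral; congr fine.
have intf : (normal_prob 0 s).-integrable [set: R] (EFin \o f).
  exact: (rv_int_bounded (normal_prob 0 s) mf fM).
rewrite -(Radon_Nikodym_change_of_variables (normal_prob_dominates 0 s))//=.
apply: ae_eq_integral => //.
- apply: emeasurable_funM; first exact/measurable_EFinP.
  apply: (measurable_int mu).
  by apply: Radon_Nikodym_integrable; exact: normal_prob_dominates.
- apply/measurable_EFinP; apply: measurable_funM => //; exact: measurable_normal_pdf.
- rewrite (_ : (fun x => (f x * p x)%:E) = (fun x => (f x)%:E * (p x)%:E)%E)//.
  apply: ae_eqe_mul2l => /=.
  rewrite Radon_NikodymE//=; first exact: normal_prob_dominates.
  move=> abmu.
  case: cid => /= h [h1 h2 h3].
  apply: integral_ae_eq => //=.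
  + by apply/measurable_EFinP; exact: measurable_normal_pdf.
  + by move=> E E01 mE; rewrite -h3.
Qed.

End normal_cos.

(** * Gaussian vectors with possibly singular variance *)

Section gaussian_vectors.
Context {R : realType}.

Lemma col_mx_dotv p q (a c : 'cV[R]_p) (b e : 'cV[R]_q) :
  dotv (col_mx a b) (col_mx c e) = dotv a c + dotv b e.
Proof. by rewrite /dotv tr_col_mx mul_row_col mxE. Qed.

Lemma dotvC p (c u : 'cV[R]_p) : dotv c u = dotv u c.
Proof. by rewrite !dotvE; apply: eq_bigr => j _; rewrite mulrC. Qed.

Lemma rank1_quad n (c u : 'cV[R]_n) : (c^T *m (u *m u^T) *m c) 0 0 = dotv c u ^+ 2.
Proof.
rewrite mulmxA -mulmxA mxE big_ord1 expr2 -[X in _ * X]/(dotv u c) dotvC.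
by rewrite -[X in X * _]/(dotv c u) dotvC.
Qed.

(** One step of a Cholesky factorization. If the corner [a] is positive, [u] is the first column
    divided by the root of [a] and [S] is the Schur complement; if it is zero, semidefiniteness
    forces the first column to vanish. *)
Lemma schur_decomposition n (V : 'M[R]_(1 + n)) : pos_semidef V ->
  exists (u : 'cV[R]_(1 + n)) (S : 'M[R]_n), pos_semidef S /\
    V = u *m u^T + block_mx 0 0 0 S.
Proof.
move=> [VT V0].
pose a := V 0 0; pose w := dlsubmx V; pose W := drsubmx V.
have VE : V = block_mx a%:M w^T w W.
  rewrite -[LHS]submxK; congr block_mx; last first.
    by rewrite /w trmx_dlsub VT.
  apply/matrixP => i j; rewrite !ord1 !mxE.
  by congr (V _ _); apply/val_inj.
have WT : W^T = W by rewrite /W trmx_drsub VT.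
have quad (x : R) c : ((col_mx x%:M c)^T *m V *m col_mx x%:M c) 0 0 =
    a * x ^+ 2 + 2 * (dotv w c * x) + (c^T *m W *m c) 0 0.
  rewrite VE tr_col_mx mul_row_block mul_row_col tr_scalar_mx.
  rewrite -scalar_mxM mul_mx_scalar !mul_scalar_mx mulmxDl.
  have cw : \sum_j c^T 0 j * w j 0 = dotv w c.
    by rewrite dotvE; apply: eq_bigr => j _; rewrite mxE mulrC.
  have wc : (w^T *m c) 0 0 = dotv w c by [].
  by rewrite -scalemxAl !(mxE, wc) eqxx ?mulr1n cw; ring.
have a0 : 0 <= a.
  have := V0 (col_mx 1%:M 0); rewrite quad.
  by rewrite !(mulmx0, mxE) /dotv mulmx0 mxE mul0r mulr0 !addr0 expr1n mulr1.
have [a_eq0|a_neq0] := eqVneq a 0.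
  have w0 : w = 0.
    apply/matrixP => i j; rewrite ord1 [RHS]mxE; apply: contrapT => /eqP wi0.
    pose c : 'cV[R]_n := delta_mx i 0.
    have wc : dotv w c = w i 0.
      rewrite dotvE (bigD1 i)//= big1 => [|k ki]; rewrite /c [delta_mx _ _ _ _]mxE.
        by rewrite !eqxx mulr1 addr0.
      by rewrite (negbTE ki) mulr0.
    pose r := (c^T *m W *m c) 0 0.
    (* This first coordinate gives the form the value [- (1 + r) + r = - 1], a contradiction. *)
    have := V0 (col_mx (- (1 + r) / (2 * w i 0))%:M c).
    rewrite quad a_eq0 mul0r add0r wc -/r.
    rewrite (_ : 2 * _ = - (1 + r)); last by field.
    by lra.
  exists 0, W; split; last first.
    by rewrite mul0mx add0r VE w0 a_eq0 trmx0 raddf0.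
  split=> // c; have := V0 (col_mx 0%:M c).
  by rewrite quad expr0n !mulr0 !add0r.
have a_gt0 : 0 < a by rewrite lt_def a_neq0.
pose sa := Num.sqrt a.
have sa0 : sa != 0 by rewrite gt_eqF ?sqrtr_gt0.
have saE : sa ^+ 2 = a by rewrite sqr_sqrtr.
pose u : 'cV[R]_(1 + n) := col_mx sa%:M (sa^-1 *: w).
pose S : 'M[R]_n := W - a^-1 *: (w *m w^T).
have VuS : V = u *m u^T + block_mx 0 0 0 S.
  rewrite /u tr_col_mx mul_col_row add_block_mx !addr0 VE tr_scalar_mx linearZ /=.
  rewrite -scalar_mxM -expr2 saE mul_scalar_mx mul_mx_scalar !scalerA mulfV// !scale1r.
  congr block_mx; rewrite /S -scalemxAl -scalemxAr scalerA -expr2 exprVn saE.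
  by rewrite addrC subrK.
exists u, S; split=> //; split.
  by rewrite /S linearB /= linearZ /= trmx_mul trmxK WT.
move=> c.
(* The first coordinate that minimizes the form for given [c]: it annihilates the rank-one part and
   leaves the form of [S]. *)
pose x := - dotv w c / a.
have := V0 (col_mx x%:M c).
rewrite VuS mulmxDr mulmxDl mxE rank1_quad /u col_mx_dotv.
have -> : dotv x%:M sa%:M + dotv c (sa^-1 *: w) = 0.
  rewrite dotvZr (dotvC c) dotvE big_ord1 !mxE eqxx !mulr1n /x -saE.
  by field.
rewrite expr0n add0r tr_col_mx mul_row_block !mulmx0 !addr0 mul_row_col mul0mx !add0r.
by [].
Qed.

End gaussian_vectors.

Section gaussian_existence.
Context {R : realType}.

Lemma measurable_cos_affine (t b : R) : measurable_fun [set: R] (fun x : R => cos (t * x + b)).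
Proof. by apply: continuous_measurable_fun; exact: continuous_cos_affine. Qed.

Lemma measurable_cos_dotv n (c : 'cV[R]_n) b :
  measurable_fun [set: borel_mx R n 1] (fun x : borel_mx R n 1 => cos (dotv c (x : 'cV[R]_n) + b)).
Proof.
apply: continuous_measurable_mx; exact: trig_poly_continuous (trig_cos c b).
Qed.

Let measurable_idR : measurable_fun [set: measurableTypeR R] (idfun : measurableTypeR R -> R).
Proof. by move=> _ B mB; rewrite setTI. Qed.

(* [normal_prob] lives on [measurableTypeR R], whose display is not that of [R] *)
Definition centered_normal (s : R) : probability R R :=
  law [the probability (measurableTypeR R) R of normal_prob 0 s] measurable_idR.

Lemma ex_normal_cos (s t b : R) : s != 0 ->
  \int[centered_normal s]_x cos (t * x + b) = expR (- (s ^+ 2 * t ^+ 2 / 2)) * cos b.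
Proof.
move=> s0.
rewrite (@ex_law _ _ (measurableTypeR R) R R [the probability (measurableTypeR R) R of normal_prob 0 s]
  idfun measurable_idR (fun x => cos (t * x + b)) (measurable_cos_affine t b)); last first.
  by apply: (@rv_int_bounded _ _ _ _ _ 1) => [|x]; [exact: measurable_cos_affine|exact: cos_max].
rewrite (@ex_normal_prob _ s (fun x => cos (t * x + b)) 1).
- exact: normal_cos_pdf.
- exact: measurable_cos_affine.
- by move=> x; exact: cos_max.
Qed.

(** The law of [g u + (0, x)] with [g] standard normal and [x] independent of variance [S].
    Integrating [g] out first produces the factor [expR (- (dotv c u ^+ 2 / 2))], and the two
    exponents add up to the quadratic form of [V]. *)
Lemma gaussian_exists n (V : 'M[R]_n) : pos_semidef V ->
  exists nu : probability (borel_mx R n 1) R, forall c b,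
    \int[nu]_x cos (dotv c (x : 'cV[R]_n) + b) =
    expR (- ((c^T *m V *m c) 0 0 / 2)) * cos b.
Proof.
elim: n V => [|n IHn] V pV.
  exists [the probability _ _ of \d_(0 : borel_mx R 0 1)] => c b.
  rewrite /Rintegral integral_dirac//; last first.
    by apply/measurable_EFinP; exact: measurable_cos_dotv.
  rewrite diracT mul1e /=.
  by rewrite dotvE big_ord0 mxE big_ord0 mul0r oppr0 expR0 mul1r add0r.
have [u [S [pS VE]]] := @schur_decomposition R n V pV.
have [nu nuE] := IHn S pS.
pose T := (borel_mx R n 1 * R)%type.
pose N01 := centered_normal 1.
pose PP : probability T R := [the probability _ _ of (nu \x N01)%E].
pose f (xg : T) : 'cV[R]_(1 + n) := xg.2 *: u + col_mx 0 (xg.1 : 'cV[R]_n).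
have mf : measurable_fun [set: T] (f : T -> borel_mx R n.+1 1).
  apply: measurable_mx_coords => i j.
  have -> : (fun xg : T => f xg i j) =
      (fun xg : T => xg.2 * u i j + (col_mx 0 (xg.1 : 'cV[R]_n) : 'cV[R]_(1 + n)) i j).
    by apply/funext => xg; rewrite /f !mxE.
  apply: measurable_funD; first by apply: measurable_funM.
  rewrite -[i](@splitK 1 n i); case: (fintype.split _) => k /=.
    under eq_fun do rewrite col_mxEu mxE.
    exact: measurable_cst.
  under eq_fun do rewrite col_mxEd.
  have mk : measurable_fun [set: borel_mx R n 1] (fun x : borel_mx R n 1 => (x : 'cV[R]_n) k j).
    by apply: continuous_measurable_mx; exact: coord_continuous.
  exact: (measurableT_comp mk measurable_fst).
exists (law PP mf) => c b.
have cE : c = col_mx (usubmx (c : 'cV[R]_(1 + n))) (dsubmx (c : 'cV[R]_(1 + n))).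
  by rewrite vsubmxK.
have dE (xg : T) : dotv c (f xg) = dotv c u * xg.2 + dotv (dsubmx (c : 'cV[R]_(1 + n))) (xg.1 : 'cV[R]_n).
  rewrite /f dotvDr dotvZr mulrC; congr (_ + _).
  by rewrite {1}cE (@col_mx_dotv _ 1 n) [X in X + _]/dotv mulmx0 mxE add0r.
have mcos : measurable_fun [set: T] (fun xg => cos (dotv c (f xg) + b)).
  exact: (measurableT_comp (measurable_cos_dotv c b) mf).
have icos : rv_int PP (fun xg => cos (dotv c (f xg) + b)).
  by apply: (@rv_int_bounded _ _ _ _ _ 1) => // xg; exact: cos_max.
rewrite (ex_law mf (measurable_cos_dotv c b) icos).
have inner (x : 'cV[R]_n) : (\int[N01]_g (cos (dotv c (f (x, g)) + b))%:E)%E =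
    (expR (- (dotv c u ^+ 2 / 2)) * cos (dotv (dsubmx (c : 'cV[R]_(1 + n))) x + b))%:E.
  under eq_integral do rewrite dE /= -addrA.
  rewrite -EFin_ex ?ex_normal_cos ?oner_neq0 ?expr1n ?mul1r//.
  apply: (@rv_int_bounded _ _ _ _ _ 1); first exact: measurable_cos_affine.
  by move=> g; exact: cos_max.
have -> : \int[PP]_xg cos (dotv c (f xg) + b) =
    \int[nu]_x (expR (- (dotv c u ^+ 2 / 2)) * cos (dotv (dsubmx (c : 'cV[R]_(1 + n))) (x : 'cV[R]_n) + b)).
  rewrite /Rintegral; congr fine.
  rewrite -(@integral12_prod_meas1 _ _ _ _ R nu N01 _ icos).
  by apply: eq_integral => x _; exact: inner.
rewrite exZ; last first.
  apply: (@rv_int_bounded _ _ _ _ _ 1); first exact: measurable_cos_dotv.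
  by move=> x; exact: cos_max.
rewrite nuE mulrA -expRD; congr (expR _ * _).
rewrite -opprD -mulrDl; congr (- (_ / _)).
have blockE : c^T *m (block_mx 0 0 0 S : 'M[R]_(1 + n, 1 + n)) *m c =
    (dsubmx (c : 'cV[R]_(1 + n)))^T *m S *m dsubmx (c : 'cV[R]_(1 + n)).
  rewrite {1 2}cE (@tr_col_mx _ 1 n) (@mul_row_block _ _ 1 n 1 n) !mulmx0 !addr0.
  by rewrite (@mul_row_col _ _ 1 n) mul0mx !add0r.
by rewrite VE mulmxDr mulmxDl [in RHS]mxE rank1_quad blockE.
Qed.

(** The law of [dotv c x] has the cosine integrals of a centred normal law of variance [v], or of
    the point mass at [0] when [v = 0], and these determine it. *)
Lemma gaussian_is_normal n (V : 'M[R]_n) (nu : probability (borel_mx R n 1) R) :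
  pos_semidef V ->
  (forall c b, \int[nu]_x cos (dotv c (x : 'cV[R]_n) + b) =
    expR (- ((c^T *m V *m c) 0 0 / 2)) * cos b) ->
  is_normal 0 V nu.
Proof.
move=> pV nuE; split=> // c B mB.
rewrite mulmx0 mxE.
have mc : measurable_fun [set: borel_mx R n 1] (dotv c : borel_mx R n 1 -> R).
  by apply: continuous_measurable_mx; exact: continuous_dotv.
pose v := (c^T *m V *m c) 0 0.
have cosE t b : \int[law nu mc]_x cos (t * x + b) = expR (- (v * t ^+ 2 / 2)) * cos b.
  rewrite (@ex_law _ _ _ _ _ nu _ mc (fun x => cos (t * x + b)) (measurable_cos_affine t b)).
    under eq_Rintegral do rewrite -dotvZl.
    have ctE : (t *: c)^T = t *: c^T by rewrite linearZ.
    rewrite nuE ctE -!scalemxAl -scalemxAr scalerA -expr2 mxE -/v.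
    by rewrite (mulrC v).
  apply: (@rv_int_bounded _ _ _ _ _ 1); last by move=> w; exact: cos_max.
  exact: (measurableT_comp (measurable_cos_affine t b) mc).
change (law nu mc B = normal_law 0 v B).
rewrite /normal_law; case: ifPn => [/eqP v0|v0].
  apply: (law_unique_cos (mu2 := [the probability R R of \d_(0 : R)])) => // t b.
  rewrite cosE v0 !mul0r oppr0 expR0 mul1r /Rintegral integral_dirac//; last first.
    by apply/measurable_EFinP; exact: measurable_cos_affine.
  by rewrite diracT mul1e /= mulr0 add0r.
have v_gt0 : 0 < v by rewrite lt_def v0 pV.2.
have s0 : Num.sqrt v != 0 by rewrite gt_eqF// sqrtr_gt0.
rewrite -[RHS]/(centered_normal (Num.sqrt v) B).
apply: law_unique_cos => // t b.
by rewrite cosE ex_normal_cos// sqr_sqrtr// ltW.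
Qed.

End gaussian_existence.

(** * Central limit theorem *)

Section independence.
Context {d : measure_display} {T : measurableType d} {R : realType}.
Variable P : probability T R.

Definition indep_rv (X Y : T -> R) : Prop := forall A B : set R,
  measurable A -> measurable B ->
  P (X @^-1` A `&` Y @^-1` B) = (P (X @^-1` A) * P (Y @^-1` B))%E.

(** Independence makes the joint law the product of the marginals, by uniqueness of product
    measures; Fubini does the rest. *)
Lemma indep_exM X Y : rv_int P X -> rv_int P Y -> indep_rv X Y ->
  rv_int P (fun w => X w * Y w) /\
  \int[P]_w (X w * Y w) = \int[P]_w X w * \int[P]_w Y w.
Proof.
move=> iX iY XY.
have mX := rv_int_measurable iX; have mY := rv_int_measurable iY.
have mW : measurable_fun [set: T] (fun w => (X w, Y w)) by exact: measurable_fun_pair.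
pose PX := law P mX; pose PY := law P mY; pose PW := law P mW.
have PWE B : measurable B -> (PX \x PY)%E B = PW B.
  by apply: product_measure_unique => A1 A2 mA1 mA2; exact: XY.
pose f (xy : R * R) : R := xy.1 * xy.2.
have mf : measurable_fun [set: R * R] f by exact: measurable_funM.
have iPX : rv_int PX idfun by apply: rv_int_law => //; exact: measurable_id.
have iPY : rv_int PY idfun by apply: rv_int_law => //; exact: measurable_id.
have mabs : measurable_fun [set: R] (fun y : R => (`|y|)%:E) by exact/measurable_EFinP.
have fin1 (Z : T -> R) (mZ : measurable_fun [set: T] Z) : rv_int P Z ->
    (\int[law P mZ]_y (`|y|)%:E < +oo)%E.
  move=> iZ; have : rv_int (law P mZ) idfun.
    by apply: rv_int_law => //; exact: measurable_id.
  by case/integrableP.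
have iprod : (PX \x PY)%E.-integrable [set: R * R] (EFin \o f).
  apply/integrable12ltyP; first exact/measurable_EFinP.
  have E1 x : (\int[PY]_y `|(EFin \o f) (x, y)| = `|x|%:E * \int[PY]_y (`|y|)%:E)%E.
    rewrite -ge0_integralZl//.
    by apply: eq_integral => y _; rewrite /f /= normrM EFinM.
  under eq_integral do rewrite E1.
  rewrite ge0_integralZr//; last exact: integral_ge0.
  rewrite lte_mul_pinfty//; [exact: integral_ge0| |exact: fin1].
  by rewrite ge0_fin_numE; [exact: fin1|exact: integral_ge0].
have EW (h : R * R -> \bar R) : (\int[(PX \x PY)%E]_z h z = \int[PW]_z h z)%E.
  by apply: eq_measure_integral => A mA _; exact: PWE.
have iXY : rv_int P (fun w => X w * Y w).
  apply/integrableP; split; first by apply/measurable_EFinP; exact: measurable_funM.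
  case/integrableP : iprod => _.
  rewrite EW.
  rewrite ge0_integral_pushforward//.
  by apply: measurableT_comp => //; exact/measurable_EFinP.
split=> //.
transitivity (\int[PW]_xy f xy); first by rewrite ex_law.
rewrite /Rintegral -EW.
rewrite -(integral12_prod_meas1 iprod).
have E2 x : fubini_F PY (EFin \o f) x = (x * \int[P]_w Y w)%:E.
  rewrite /fubini_F /f /=.
  have <- : \int[PY]_y (x * idfun y) = x * \int[P]_w Y w.
    by rewrite (exZ x iPY) (ex_law mY (@measurable_id _ _ _) iY).
  by rewrite EFin_ex//; exact: rv_intZ.
rewrite (eq_integral (fun x : R => (x * \int[P]_w Y w)%:E)) => [|x _]; last exact: E2.
rewrite -[LHS]/(\int[PX]_x (x * \int[P]_w Y w)) (@RintegralZr _ _ _ PX _ idfun)//.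
by rewrite (ex_law mX (@measurable_id _ _ _) iX).
Qed.

Variable q : nat.
Variable V : nat -> T -> 'cV[R]_q.
Hypothesis V_iid : iid P V.

Let mV i : measurable_mx (V i). Proof. by case: V_iid. Qed.

Lemma iid_measurable_comp (g : borel_mx R q 1 -> R) i :
  measurable_fun [set: borel_mx R q 1] g -> measurable_fun [set: T] (fun w => g (V i w)).
Proof. by move=> mg; exact: (measurableT_comp mg (mV i)). Qed.

Lemma iid_int (g : borel_mx R q 1 -> R) i : measurable_fun [set: borel_mx R q 1] g ->
  rv_int P (fun w => g (V 0%N w)) -> rv_int P (fun w => g (V i w)).
Proof.
move=> mg i0; have := rv_int_law (mV 0%N) mg i0.
have [_ _ idist] := V_iid.
move=> /(@rv_int_eq_measure _ _ _ (law P (mV 0%N)) (law P (mV i)) g).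
case/(_ _)/integrableP => [B mB|mg' gfin]; first exact: idist.
apply/integrableP; split; first by apply/measurable_EFinP; exact: iid_measurable_comp.
move: gfin; rewrite ge0_integral_pushforward//.
by apply: measurableT_comp.
Qed.

Lemma iid_ex (g : borel_mx R q 1 -> R) i : measurable_fun [set: borel_mx R q 1] g ->
  rv_int P (fun w => g (V 0%N w)) ->
  \int[P]_w g (V i w) = \int[P]_w g (V 0%N w).
Proof.
move=> mg i0.
have E0 := ex_law (mV 0%N) mg i0.
have Ei := ex_law (mV i) mg (iid_int i mg i0).
apply: etrans (esym Ei) _; apply: etrans _ E0.
apply: (@ex_eq_measure _ _ _ (law P (mV i)) (law P (mV 0%N)) g) => B mB.
by have [_ _] := V_iid; exact.
Qed.

Section past.
Variable k : nat.

(** Cylinders over the first [k] vectors: a pi-system on which independence from [V k] is an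
    instance of mutual independence. Dynkin induction extends it to the generated sigma-algebra,
    hence to all functions of the first [k] vectors. *)
Let past : set (set T) := [set A | exists2 B : nat -> set (borel_mx R q 1),
  (forall j, measurable (B j)) & A = \bigcap_(j in `I_k) V j @^-1` B j].

Let past_sub : <<s past >> `<=` @measurable _ T.
Proof.
apply: smallest_sub; first exact: sigma_algebra_measurable.
move=> _ [B mB ->]; apply: fin_bigcap_measurable => // j _.
by rewrite -[X in measurable X]setTI; exact: mV.
Qed.

Let past_indep (C : set (borel_mx R q 1)) A : measurable C -> <<s past >> A ->
  P (A `&` V k @^-1` C) = (P A * P (V k @^-1` C))%E.
Proof.
move=> mC; set D := V k @^-1` C.
have mD : measurable D by rewrite -[D]setTI; exact: mV.
have finD : P D \is a fin_num by exact: fin_num_measure.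
apply: (@dynkin_induction _ (g_sigma_algebraType past) past
  (fun A => P (A `&` D) = (P A * P D)%E)) => //.
- move=> _ _ [B1 mB1 ->] [B2 mB2 ->]; exists (fun j => B1 j `&` B2 j).
    by move=> j; exact: measurableI.
  by rewrite -bigcapI.
- by rewrite setTI [X in (X * _)%E]probability_setT mul1e.
- move=> _ [B mB ->].
  have [_ mindep _] := V_iid.
  pose B' j := if j == k then C else B j.
  have mB' j : measurable (B' j) by rewrite /B'; case: ifP.
  have uk : uniq (k :: iota 0 k) by rewrite /= iota_uniq mem_iota add0n ltnn.
  have -> : `I_k = [set` iota 0 k] by apply/seteqP; split=> j /=; rewrite mem_iota add0n.
  rewrite (mindep (iota 0 k) B (iota_uniq _ _) mB).
  have -> : \bigcap_(j in [set` iota 0 k]) V j @^-1` B j `&` D =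
      \bigcap_(j in [set` k :: iota 0 k]) V j @^-1` B' j.
    apply/seteqP; split=> w /=.
      move=> [wB wD] j /=; rewrite inE /B'; case: eqP => [->//|_ /=].
      exact: wB.
    move=> h; split=> [j jk|].
      have := h j; rewrite /= inE /B' jk orbT.
      by move: jk; rewrite /= mem_iota add0n => /ltn_eqF -> /(_ isT).
    by have := h k; rewrite /= inE /B' eqxx => /(_ isT).
  rewrite (mindep (k :: iota 0 k) B' uk mB') big_cons muleC /B' eqxx.
  congr (_ * _)%E; apply: eq_big_seq => j; rewrite mem_iota add0n => /= jk.
  by rewrite ltn_eqF.
- move=> S mS SE.
  have mS' : @measurable _ T S := past_sub mS.
  have -> : ~` S `&` D = D `\` S by rewrite setDE setIC.
  rewrite measureD//; last by rewrite (le_lt_trans (probability_le1 _ _))// ltry.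
  transitivity (P D - P S * P D)%E.
    by congr (_ - _)%E; rewrite setIC; exact: SE.
  transitivity ((1 - P S) * P D)%E; last by congr (_ * _)%E; exact/esym/probability_setC.
  by rewrite muleBl ?mul1e// fin_num_adde_defr.
- move=> F mF tF FE.
  have mF' n : @measurable _ T (F n) := past_sub (mF n).
  have FE' : (P (\bigcup_n F n) = \sum_(0 <= i <oo) P (F i))%E.
    by apply: measure_semi_bigcup => //; exact: bigcupT_measurable.
  have FD : (P (\bigcup_n (F n `&` D)) = \sum_(0 <= i <oo) P (F i `&` D))%E.
    apply: measure_semi_bigcup => //.
    + by move=> n; exact: measurableI.
    + exact: trivIset_setIr.
    + by apply: bigcupT_measurable => n; exact: measurableI.
  rewrite setI_bigcupl FD FE' (eq_eseriesr (fun i _ => FE i)).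
  under eq_eseriesr do rewrite muleC.
  by rewrite -(fineK finD) nneseriesZl ?fineK// muleC.
Qed.

Lemma iid_indep_sum (g h : borel_mx R q 1 -> R) :
  measurable_fun [set: borel_mx R q 1] g -> measurable_fun [set: borel_mx R q 1] h ->
  indep_rv (fun w => \sum_(i < k) g (V i w)) (fun w => h (V k w)).
Proof.
move=> mg mh A B mA mB.
have -> : (fun w => h (V k w)) @^-1` B = V k @^-1` (h @^-1` B) by [].
apply: past_indep; first by rewrite -[X in measurable X]setTI; exact: mh.
(* Measurability with respect to the past, and not merely the ambient sigma-algebra, is what brings
   the event under [past_indep]. *)
have mS : measurable_fun [set: g_sigma_algebraType past]
    (fun w : g_sigma_algebraType past => \sum_(i < k) g (V i w)).
  apply: measurable_sum => i _ D mD; rewrite setTI.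
  apply: sub_sigma_algebra; exists (fun j => if j == i :> nat then g @^-1` D else setT).
    move=> j; case: ifP => // _.
    by rewrite -[X in measurable X]setTI; exact: mg.
  apply/seteqP; split=> w /=.
    by move=> gD j _; case: eqP => // ->.
  by move=> /(_ i (ltn_ord i)); rewrite eqxx.
by have := mS measurableT A mA; rewrite setTI.
Qed.

End past.

End independence.

(** * Taylor bounds for the cosine *)

Section trig_taylor.
Context {R : realType}.
Implicit Types x b : R.

Lemma le_abs_MVT (f df : R -> R) (k : R) x : (forall y : R, is_derive y 1 f (df y)) ->
  (forall y, `|y| <= `|x| -> `|df y| <= k) -> `|f x - f 0| <= k * `|x|.
Proof.
move=> fd dfk.
have cf a c : {within `[a, c], continuous f}.
  by apply: continuous_subspaceT; exact: is_derive_continuous fd.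
have [x0|x0] := leP 0 x.
  have [y + ->] := MVT_segment x0 (fun y _ => fd y) (cf 0 x).
  rewrite in_itv /= => /andP[y0 yx]; rewrite subr0 normrM ler_wpM2r//.
  by apply: dfk; rewrite !ger0_norm.
have [y + E] := MVT_segment (ltW x0) (fun y _ => fd y) (cf x 0).
rewrite in_itv /= => /andP[xy y0]; rewrite distrC E sub0r normrM normrN ler_wpM2r//.
by apply: dfk; rewrite !ler0_norm ?lerN2// ltW.
Qed.

Lemma cos_lipschitz x y : `|cos x - cos y| <= `|x - y|.
Proof.
have := @le_abs_MVT _ _ 1 (x - y) (is_derive_cos_affine 1 y).
rewrite !mul1r add0r subrK => -> // z _.
by rewrite mulr1 normrN sin_max.
Qed.

Lemma ler_sin_abs x : `|sin x| <= `|x|.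
Proof.
have := @le_abs_MVT sin cos 1 x (fun y => is_derive_sin y) (fun y _ => cos_max y).
by rewrite sin0 subr0 mul1r.
Qed.

(** Half-angle formula: [1 - cos x = 2 * sin (x / 2) ^+ 2]. The two bounds that follow integrate
    this one by the mean value theorem, once and then once more. *)
Lemma onem_cos_le x : 0 <= 1 - cos x <= x ^+ 2 / 2.
Proof.
rewrite subr_ge0 cos_le1 /= [X in cos X](_ : x = (x / 2) *+ 2); last by rewrite mulr2n -splitr.
rewrite cos_mulr2n cos2sin2.
have := ler_sin_abs (x / 2); rewrite -ler_sqr ?nnegrE// !real_normK ?num_real//.
by rewrite -mulr_natl; lra.
Qed.

Lemma sub_sin_le x : `|x - sin x| <= `|x| ^+ 3 / 2.
Proof.
have hd (y : R) : is_derive y 1 (fun y : R => y - sin y) (1 - cos y).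
  by apply: is_deriveB.
have := @le_abs_MVT (fun y => y - sin y) (fun y => 1 - cos y) (x ^+ 2 / 2) x hd.
rewrite sin0 subr0 subr0 -(real_normK (num_real x)) => h.
rewrite (_ : _ ^+ 3 / 2 = `|x| ^+ 2 / 2 * `|x|); last by rewrite exprS; ring.
apply: h => y yx.
have /andP[c0 c1] := onem_cos_le y.
rewrite /= ger0_norm// (le_trans c1)// ler_pM2r ?invr_gt0// -(real_normK (num_real y)).
by rewrite lerXn2r ?nnegrE.
Qed.

Lemma cos_sub_le x : `|cos x - 1 + x ^+ 2 / 2| <= `|x| ^+ 4 / 2.
Proof.
have hd (y : R) : is_derive y 1 (fun y : R => cos y + 2^-1 * y ^+ 2) (y - sin y).
  have h := is_deriveD (is_derive_cos y) (is_derive_sqr (2^-1) y).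
  by apply: (@is_derive_eq _ _ _ _ _ _ _ _ h); field.
have := @le_abs_MVT _ _ (`|x| ^+ 3 / 2) x hd.
rewrite cos0 expr0n /= mulr0 addr0 => h.
rewrite (_ : _ ^+ 4 / 2 = `|x| ^+ 3 / 2 * `|x|); last by rewrite exprS; ring.
rewrite (_ : _ + _ / 2 = cos x + 2^-1 * x ^+ 2 - 1); last by ring.
apply: h => y yx; rewrite /= (le_trans (sub_sin_le y))// ler_pM2r ?invr_gt0//.
by rewrite lerXn2r ?nnegrE.
Qed.

(** The factor [Num.min 1 |x|] tends to [0] with [x] while staying bounded, so second moments alone
    control the remainder in the central limit theorem. For [|x| <= 1] the Taylor bounds apply,
    beyond it the crude ones. *)
Lemma cos_taylor2 x b :
  `|cos (x + b) - (1 - x ^+ 2 / 2) * cos b + x * sin b| <= 3 * (x ^+ 2 * Num.min 1 `|x|).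
Proof.
rewrite cosD (_ : _ + x * sin b =
  (cos x - 1 + x ^+ 2 / 2) * cos b + (x - sin x) * sin b); last by ring.
rewrite (le_trans (ler_normD _ _))// !normrM.
rewrite (@le_trans _ _ (`|cos x - 1 + x ^+ 2 / 2| + `|x - sin x|))//.
  by rewrite lerD// ler_piMr// ?cos_max ?sin_max.
have [x1|x1] := lerP `|x| 1.
  have h1 := cos_sub_le x; have h2 := sub_sin_le x.
  rewrite (le_trans (lerD h1 h2))// -(real_normK (num_real x)).
  have x0 := normr_ge0 x; move: (`|x|) x0 x1 => y y0 y1.
  rewrite !exprS expr0 mulr1.
  have : y * (y * (y * y)) <= y * (y * y) by rewrite ler_wpM2l// ler_wpM2l// ler_piMr.
  have : 0 <= y * (y * y) by rewrite !mulr_ge0.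
  by lra.
have /andP[c0 c1] := onem_cos_le x.
have h1 : `|cos x - 1 + x ^+ 2 / 2| <= x ^+ 2 / 2 by rewrite ger0_norm; lra.
have h2 : `|x - sin x| <= 2 * `|x|.
  by rewrite (le_trans (ler_normB _ _))// mulr_natl mulr2n lerD// ler_sin_abs.
rewrite (le_trans (lerD h1 h2))// -(real_normK (num_real x)) mulr1 expr2.
by move: (`|x|) x1 => y y1; nra.
Qed.

Lemma expRN_taylor (y : R) : 0 <= y -> `|expR (- y) - (1 - y)| <= y ^+ 2.
Proof.
move=> y0; have := expR_ge1Dx (- y) => h; rewrite ger0_norm ?subr_ge0//.
have h2 := expR_ge1Dx y.
have : expR (- y) * expR y = 1 by rewrite -expRD addNr expR0.
have := expR_gt0 (- y); move: (expR _) (expR _) h h2 => u v; nra.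
Qed.

End trig_taylor.

Section eventual_domination.
Context {d : measure_display} {T : measurableType d} {R : realType}.
Variable P : probability T R.

Lemma osmall_ae U (V : nat -> T -> R) : osmall P U ->
  (exists N, forall n, (N <= n)%N -> {ae P, forall w, `|V n w| <= `|U n w|}) ->
  osmall P V.
Proof.
move=> oU [M UV] delta e d0 e0; have [N h] := oU _ _ d0 e0.
exists (maxn M N) => n; rewrite geq_max => /andP[/UV [B [mB PB BP]] /h[A [mA PA AP]]].
exists (A `|` B); split; first exact: measurableU.
  rewrite (le_trans (measureU2 _ _ _))// -[leRHS]adde0 leeD//.
  by rewrite [X in (X <= _)%E]PB.
move=> w /not_orP[nA nB]; apply: le_trans (AP w nA).
by apply: contrapT => nle; apply: nB; apply: BP.
Qed.

(** Absorbs [n = 0], where the convention [0^-1 = 0] invalidates the algebra of sample means. *)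
Lemma osmall_eventually U (V : nat -> T -> R) : osmall P U ->
  (forall n w, (0 < n)%N -> V n w = U n w) -> osmall P V.
Proof.
move=> oU UV; apply: osmall_ae oU _; exists 1 => n n0.
by apply: aeW => w; rewrite UV.
Qed.

End eventual_domination.

Section iid_sums.
Context {d : measure_display} {T : measurableType d} {R : realType}.
Variable P : probability T R.
Variable q : nat.
Variable V : nat -> T -> 'cV[R]_q.
Hypothesis V_iid : iid P V.
Implicit Types g : borel_mx R q 1 -> R.

Lemma rv_int_of_sq (X : T -> R) : measurable_fun [set: T] X ->
  rv_int P (fun w => X w ^+ 2) -> rv_int P X.
Proof.
move=> mX iX2; apply: le_rv_int (_ : rv_int P (fun w => 1 + X w ^+ 2)) => //.
  by move=> w; rewrite -(real_normK (num_real _)); have := sqr_ge0 (`|X w| - 1); nra.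
by apply: rv_intD => //; exact: rv_int_cst.
Qed.

Lemma rv_int_mul (X Y : T -> R) : measurable_fun [set: T] X -> measurable_fun [set: T] Y ->
  rv_int P (fun w => X w ^+ 2) -> rv_int P (fun w => Y w ^+ 2) ->
  rv_int P (fun w => X w * Y w).
Proof.
move=> mX mY iX iY; apply: le_rv_int (_ : rv_int P (fun w => X w ^+ 2 + Y w ^+ 2)).
- exact: measurable_funM.
- move=> w; rewrite normrM -(real_normK (num_real (X w))) -(real_normK (num_real (Y w))).
  have := sqr_ge0 (`|X w| - `|Y w|); have := sqr_ge0 (`|X w| + `|Y w|); nra.
- exact: rv_intD.
Qed.

Section centered.
Variable g : borel_mx R q 1 -> R.
Hypothesis mg : measurable_fun [set: borel_mx R q 1] g.
Hypothesis g2 : rv_int P (fun w => g (V 0%N w) ^+ 2).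
Hypothesis g0 : \int[P]_w g (V 0%N w) = 0.

Let mg2 : measurable_fun [set: borel_mx R q 1] (fun x => g x ^+ 2).
Proof. exact: measurable_funX. Qed.

Let mgV i : measurable_fun [set: T] (fun w => g (V i w)).
Proof. exact: (iid_measurable_comp V_iid i mg). Qed.

Let g1 : rv_int P (fun w => g (V 0%N w)).
Proof. exact: rv_int_of_sq. Qed.

(** The cross term of the new summand with the past sum has mean zero by independence. *)
Lemma iid_sum_sq n :
  rv_int P (fun w => (\sum_(i < n) g (V i w)) ^+ 2) /\
  \int[P]_w (\sum_(i < n) g (V i w)) ^+ 2 = n%:R * \int[P]_w (g (V 0%N w) ^+ 2).
Proof.
elim: n => [|n [IH1 IH2]].
  have -> : (fun w => (\sum_(i < 0) g (V i w)) ^+ 2) = (fun=> 0).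
    by apply/funext => w; rewrite big_ord0 expr0n.
  by rewrite ex_cst mul0r; split=> //; exact: rv_int_cst.
set S := fun w => \sum_(i < n) g (V i w).
have mS : measurable_fun [set: T] S by apply: measurable_sum => i; exact: mgV.
have iS : rv_int P S by exact: rv_int_of_sq.
have iXn : rv_int P (fun w => g (V n w)) by exact: (iid_int V_iid n mg).
have iXn2 : rv_int P (fun w => g (V n w) ^+ 2) by exact: (iid_int V_iid n mg2).
have [iSX ESX] := indep_exM iS iXn (iid_indep_sum V_iid n mg mg).
have -> : (fun w => (\sum_(i < n.+1) g (V i w)) ^+ 2) =
    (fun w => (S w ^+ 2 + 2 * (S w * g (V n w))) + g (V n w) ^+ 2).
  by apply/funext => w; rewrite big_ord_recr /= -/(S w); ring.
have i12 : rv_int P (fun w => S w ^+ 2 + 2 * (S w * g (V n w))).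
  by apply: rv_intD => //; exact: rv_intZ.
split; first exact: rv_intD.
rewrite exD// exD ?exZ ?ESX//; last exact: rv_intZ.
rewrite (iid_ex V_iid n mg)// g0 mulr0 mulr0 addr0 [X in X + _]IH2.
by rewrite (iid_ex V_iid n mg2)// -natr1 mulrDl mul1r.
Qed.

Lemma iid_root_sum_Obig : Obig P (fun n w => (Num.sqrt n%:R)^-1 * \sum_(i < n) g (V i w)).
Proof.
move=> delta d0; set s2 := \int[P]_w (g (V 0%N w) ^+ 2).
have s20 : 0 <= s2 by apply: Rintegral_ge0 => w _; rewrite sqr_ge0.
(* Chebyshev then bounds the probability by [s2 / K ^+ 2 <= delta]; the [+ 1] keeps [K] positive
   when the variance is zero. *)
pose K := Num.sqrt ((s2 + 1) / delta).
have K0 : 0 < K by rewrite sqrtr_gt0 divr_gt0// ltr_wpDl.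
exists K => //; exists 0 => n _.
pose X w := (Num.sqrt n%:R)^-1 * \sum_(i < n) g (V i w).
have mX : measurable_fun [set: T] X.
  by apply: measurable_funM => //; apply: measurable_sum => i; exact: mgV.
have [i1 i2] := iid_sum_sq n.
have XE : (fun w => X w ^+ 2) = (fun w => n%:R^-1 * (\sum_(i < n) g (V i w)) ^+ 2).
  by apply/funext => w; rewrite /X exprMn exprVn sqr_sqrtr.
have iX : rv_int P (fun w => X w ^+ 2).
  by rewrite XE; exact: rv_intZ.
exists [set w | K < `|X w|]; split.
- rewrite (_ : mkset _ = (fun w => `|X w|) @^-1` `]K, +oo[%classic).
    by rewrite -[X in measurable X]setTI; apply: measurableT_comp.
  by apply/seteqP; split=> w /=; rewrite in_itv /= andbT.
- apply: le_trans (markov_sq mX K0 iX) _; rewrite lee_fin.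
  rewrite XE exZ// i2 -/s2 sqr_sqrtr ?divr_ge0 ?addr_ge0 ?(ltW d0)//.
  have ns : n%:R^-1 * (n%:R * s2) <= s2.
    have [->|n0] := eqVneq n 0; first by rewrite invr0 !mul0r.
    by rewrite mulrA mulVf ?mul1r// pnatr_eq0.
  rewrite invf_div -mulrA ler_piMr ?(ltW d0)// mulrC ler_pdivrMr ?ltr_wpDl//.
  by rewrite mul1r (le_trans ns)// lerDl.
- by move=> w /negP; rewrite -leNgt.
Qed.

Lemma iid_mean_osmall0 : osmall P (fun n w => n%:R^-1 * \sum_(i < n) g (V i w)).
Proof.
have r0 : osmall P (fun (n : nat) (_ : T) => (Num.sqrt n%:R)^-1 : R).
  move=> delta e d0 e0; exists (Num.truncn (e ^- 2)).+1 => n ne.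
  exists set0; split=> //; first by rewrite measure0 lee_fin ltW.
  move=> _ _; rewrite ger0_norm ?invr_ge0//.
  have n0 : 0 < n%:R :> R by rewrite ltr0n (leq_trans _ ne).
  rewrite -[leRHS]invrK lef_pV2 ?posrE ?sqrtr_gt0 ?invr_gt0//.
  rewrite -[leLHS]ger0_norm ?invr_ge0 ?(ltW e0)// -sqrtr_sqr ler_sqrt// exprVn.
  by rewrite (le_trans (ltW (truncnS_gt _)))// ler_nat.
apply: le_osmall (osmallM r0 iid_root_sum_Obig) _ => n w.
by rewrite /= mulrA -invfM -expr2 sqr_sqrtr.
Qed.

End centered.

Lemma iid_mean_osmall g : measurable_fun [set: borel_mx R q 1] g ->
  rv_int P (fun w => g (V 0%N w) ^+ 2) ->
  osmall P (fun n w => n%:R^-1 * \sum_(i < n) g (V i w) - \int[P]_w g (V 0%N w)).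
Proof.
move=> mg g2; set e := \int[P]_w _.
have mgV : measurable_fun [set: T] (fun w => g (V 0%N w)) by exact: (iid_measurable_comp V_iid 0 mg).
have g1 : rv_int P (fun w => g (V 0%N w)) by exact: rv_int_of_sq.
pose h x := g x - e.
have mh : measurable_fun [set: borel_mx R q 1] h by exact: measurable_funB.
have h2 : rv_int P (fun w => h (V 0%N w) ^+ 2).
  rewrite (_ : (fun w => _) = (fun w => (g (V 0%N w) ^+ 2 - (2 * e) * g (V 0%N w)) + e ^+ 2)); last first.
    by apply/funext => w; rewrite /h; ring.
  by apply: rv_intD; [apply: rv_intB => //; exact: rv_intZ|exact: rv_int_cst].
have h0 : \int[P]_w h (V 0%N w) = 0.
  by rewrite exB ?ex_cst ?subrr//; exact: rv_int_cst.
apply: osmall_eventually (iid_mean_osmall0 mh h2 h0) _ => n w n0.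
rewrite /h sumrB mulrBr; congr (_ - _).
by rewrite sumr_const card_ord -[e *+ n]mulr_natl mulrA mulVf ?mul1r// pnatr_eq0 -lt0n.
Qed.

End iid_sums.

Section central_limit.
Context {d : measure_display} {T : measurableType d} {R : realType}.
Variable P : probability T R.
Variable q : nat.
Variable V : nat -> T -> 'cV[R]_q.
Hypothesis V_iid : iid P V.

Let rv_cos (X : T -> R) b : measurable_fun [set: T] X -> rv_int P (fun w => cos (X w + b)).
Proof.
move=> mX; apply: (@rv_int_bounded _ _ _ _ _ 1) => [|w]; last exact: cos_max.
have mc : measurable_fun [set: R] (fun x : R => cos (1 * x + b)).
  by apply: continuous_measurable_fun; exact: continuous_cos_affine.
rewrite (_ : (fun w => _) = (fun w => cos (1 * X w + b))).
  exact: (measurableT_comp mc mX).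
by apply/funext => w; rewrite mul1r.
Qed.

(** The sines appear as shifted cosines, so that each factor is again a cosine with a phase, the
    form in which the one-summand bound is available for all phases. *)
Let cosS (x y : R) : cos (x + y) = cos (x + 0) * cos (y + 0) - cos (x - pi / 2) * cos (y - pi / 2).
Proof. by rewrite cosD !addr0 !cosBpihalf. Qed.

(** Replacing the last summand by the factor [a] costs [2 * delta], since the addition formula
    yields two products whose factor from the past is at most [1] in absolute value. Earlier
    replacements are not amplified because [a <= 1]. *)
Lemma cos_iid_telescope (h : borel_mx R q 1 -> R) (a delta : R) :
  measurable_fun [set: borel_mx R q 1] h -> 0 <= a <= 1 ->
  (forall b, `|\int[P]_w cos (h (V 0%N w) + b) - a * cos b| <= delta) ->
  forall k b, `|\int[P]_w cos (\sum_(i < k) h (V i w) + b) - a ^+ k * cos b| <= k%:R * (2 * delta).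
Proof.
move=> mh /andP[a0 a1] hd; elim=> [|k IHk] b.
  have -> : (fun w => cos (\sum_(i < 0) h (V i w) + b)) = (fun=> cos b).
    by apply/funext => w; rewrite big_ord0 add0r.
  by rewrite ex_cst expr0 !mul1r subrr normr0 mul0r.
pose S w := \sum_(i < k) h (V i w).
have mhV i : measurable_fun [set: T] (fun w => h (V i w)) by exact: (iid_measurable_comp V_iid i mh).
have mS : measurable_fun [set: T] S by apply: measurable_sum => i; exact: mhV.
have mcos (b' : R) : measurable_fun [set: R] (fun x : R => cos (x + b')).
  rewrite (_ : (fun x => _) = (fun x => cos (1 * x + b'))).
    by apply: continuous_measurable_fun; exact: continuous_cos_affine.
  by apply/funext => x; rewrite mul1r.
have split b1 b2 : rv_int P (fun w => cos (S w + b1) * cos (h (V k w) + b2)) /\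
    \int[P]_w (cos (S w + b1) * cos (h (V k w) + b2)) =
    \int[P]_w cos (S w + b1) * \int[P]_w cos (h (V 0%N w) + b2).
  have mcosh : measurable_fun [set: borel_mx R q 1] (fun x => cos (h x + b2)).
    exact: (measurableT_comp (mcos b2) mh).
  rewrite -(iid_ex V_iid k mcosh); last exact: rv_cos (mhV 0%N).
  apply: indep_exM; [exact: rv_cos|exact: rv_cos|].
  move=> A B mA mB.
  have mA' : measurable ((fun x : R => cos (x + b1)) @^-1` A).
    by rewrite -[X in measurable X]setTI; exact: mcos.
  have mB' : measurable ((fun x : R => cos (x + b2)) @^-1` B).
    by rewrite -[X in measurable X]setTI; exact: mcos.
  exact: (iid_indep_sum V_iid k mh mh mA' mB').
pose C := \int[P]_w cos (S w + 0); pose D := \int[P]_w cos (S w - pi / 2).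
have E1 : \int[P]_w cos (\sum_(i < k.+1) h (V i w) + b) =
    C * \int[P]_w cos (h (V 0%N w) + b) - D * \int[P]_w cos (h (V 0%N w) + (b - pi / 2)).
  have [i1 e1] := split 0 b; have [i2 e2] := split (- (pi / 2)) (b - pi / 2).
  rewrite -e1 -e2 -exB//; apply: eq_Rintegral => w _.
  rewrite big_ord_recr /= -addrA -/(S w) (cosS (S w) (_ + b)) !addr0.
  by rewrite [X in _ = _ - _ * cos X]addrA.
have E2 : \int[P]_w cos (S w + b) = C * cos b - D * cos (b - pi / 2).
  rewrite mulrC [D * _]mulrC -exZ; last exact: rv_cos.
  rewrite -(exZ (cos (b - pi / 2))); last exact: rv_cos.
  rewrite -exB; last 2 first.
  - by apply: rv_intZ; exact: rv_cos.
  - by apply: rv_intZ; exact: rv_cos.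
  apply: eq_Rintegral => w _; rewrite cosS !addr0.
  by congr (_ - _); rewrite mulrC.
have bound b' : `|\int[P]_w cos (S w + b')| <= 1.
  rewrite (le_trans (ler_norm_ex (rv_cos b' mS) (rv_int_cst P 1) _)) ?ex_cst//.
  by move=> w; exact: cos_max.
rewrite E1 (_ : _ - _ = C * (\int[P]_w cos (h (V 0%N w) + b) - a * cos b) -
   D * (\int[P]_w cos (h (V 0%N w) + (b - pi / 2)) - a * cos (b - pi / 2)) +
   a * (\int[P]_w cos (S w + b) - a ^+ k * cos b)); last first.
  by rewrite E2 exprS; ring.
rewrite -[k.+1%:R]natr1 [leRHS]mulrDl [leRHS]addrC [X in _ <= X + _]mul1r (le_trans (ler_normD _ _))// lerD//.
  rewrite (le_trans (ler_normB _ _))// !normrM mulr_natl mulr2n.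
  by apply: lerD; rewrite -[leRHS]mul1r ler_pM ?bound ?hd.
rewrite normrM (ger0_norm a0) (le_trans (ler_piMl _ a1))//.
Qed.

(** For one summand the cosine integral is within [delta n] of [a n * cos b], and [n * delta n]
    tends to [0]: its main part is a multiple of [M n], the second moment damped by
    [Num.min 1 (r n * |X|)], which vanishes by dominated convergence. *)
Lemma clt_cos (g : borel_mx R q 1 -> R) b :
  measurable_fun [set: borel_mx R q 1] g ->
  rv_int P (fun w => g (V 0%N w) ^+ 2) -> \int[P]_w g (V 0%N w) = 0 ->
  \int[P]_w cos ((Num.sqrt n%:R)^-1 * (\sum_(i < n) g (V i w)) + b) @[n --> \oo] -->
  expR (- (\int[P]_w (g (V 0%N w) ^+ 2) / 2)) * cos b.
Proof.
move=> mg g2 g0; set s2 := \int[P]_w _.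
pose X w := g (V 0%N w).
have mX : measurable_fun [set: T] X by exact: (iid_measurable_comp V_iid 0 mg).
have iX : rv_int P X by exact: rv_int_of_sq.
have s20 : 0 <= s2 by apply: Rintegral_ge0 => w _; rewrite sqr_ge0.
pose r (n : nat) : R := (Num.sqrt n%:R)^-1.
have r0 n : 0 <= r n by rewrite invr_ge0.
have r2 n : r n ^+ 2 = n%:R^-1 by rewrite /r exprVn sqr_sqrtr.
pose m (n : nat) w := X w ^+ 2 * Num.min 1 (r n * `|X w|).
have mm n : measurable_fun [set: T] (m n).
  apply: measurable_funM; first exact: measurable_funX.
  apply: measurable_minr => //; apply: measurable_funM => //.
  exact: measurableT_comp.
have m_ge0 n w : 0 <= m n w by rewrite mulr_ge0 ?sqr_ge0// le_min ler01 mulr_ge0.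
have m_le n w : m n w <= X w ^+ 2 by rewrite ler_piMr ?sqr_ge0// ge_min lexx.
have im n : rv_int P (m n).
  apply: le_rv_int g2 => // w; rewrite ger0_norm//; exact: m_le.
pose M n := \int[P]_w m n w.
have M_ge0 n : 0 <= M n by apply: Rintegral_ge0.
have step n b' : `|\int[P]_w cos (r n * X w + b') - (1 - r n ^+ 2 * s2 / 2) * cos b'| <=
    3 * (r n ^+ 2 * M n).
  rewrite /s2 /M.
  have -> : \int[P]_w cos (r n * X w + b') - (1 - r n ^+ 2 * s2 / 2) * cos b' =
      \int[P]_w (cos (r n * X w + b') + ((- cos b' + (r n ^+ 2 / 2 * cos b') * X w ^+ 2) + (r n * sin b') * X w)).
    rewrite exD; [|exact: (rv_cos b' (measurable_funM _ mX))|]; last first.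
      by apply: rv_intD; [apply: rv_intD; [exact: rv_int_cst|exact: rv_intZ]|exact: rv_intZ].
    rewrite exD; [|by apply: rv_intD; [exact: rv_int_cst|exact: rv_intZ]|exact: rv_intZ].
    rewrite exD; [|exact: rv_int_cst|exact: rv_intZ].
    by rewrite ex_cst exZ// exZ// [\int[P]_w X w]g0 -/s2; field.
  rewrite -exZ// -exZ; last exact: rv_intZ.
  apply: ler_norm_ex.
  - apply: rv_intD; first exact: (rv_cos b' (measurable_funM _ mX)).
    by apply: rv_intD; [apply: rv_intD; [exact: rv_int_cst|exact: rv_intZ]|exact: rv_intZ].
  - by do 2 apply: rv_intZ.
  move=> w; rewrite (_ : _ + _ = cos (r n * X w + b') -
     (1 - (r n * X w) ^+ 2 / 2) * cos b' + (r n * X w) * sin b'); last by field.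
  rewrite (le_trans (cos_taylor2 _ _))// normrM (ger0_norm (r0 n)) /m.
  by rewrite exprMn -!mulrA.
(* Chosen so that [a n ^+ n] is exactly the limit [expR (- (s2 / 2))]; what remains is its distance
   to the Taylor value [1 - n%:R^-1 * s2 / 2]. *)
pose a (n : nat) := expR (- (n%:R^-1 * s2 / 2)).
pose delta n := 3 * (n%:R^-1 * M n) + (n%:R^-1 * s2 / 2) ^+ 2.
have y0 n : 0 <= n%:R^-1 * s2 / 2 by rewrite divr_ge0// mulr_ge0.
have step2 n b' : `|\int[P]_w cos (r n * X w + b') - a n * cos b'| <= delta n.
  rewrite (_ : _ - _ = (\int[P]_w cos (r n * X w + b') - (1 - r n ^+ 2 * s2 / 2) * cos b') -
     (a n - (1 - n%:R^-1 * s2 / 2)) * cos b'); last by rewrite r2; ring.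
  rewrite (le_trans (ler_normB _ _))// lerD//; first by rewrite -(r2 n); exact: step.
  by rewrite normrM (le_trans (ler_piMr _ (cos_max _)))// expRN_taylor.
have a01 n : 0 <= a n <= 1 by rewrite expR_ge0 -[leRHS]expR0 ler_expR oppr_le0 y0.
have tele n : (0 < n)%N ->
    `|\int[P]_w cos (r n * (\sum_(i < n) g (V i w)) + b) - expR (- (s2 / 2)) * cos b| <=
    6 * M n + 2 * (s2 / 2) ^+ 2 * n%:R^-1.
  move=> n0; have nn : n%:R != 0 :> R by rewrite pnatr_eq0 -lt0n.
  have mh : measurable_fun [set: borel_mx R q 1] (fun x => r n * g x).
    exact: measurable_funM.
  have := cos_iid_telescope mh (a01 n) (step2 n) n b.
  rewrite -expRM_natl (_ : n%:R * - _ = - (s2 / 2)); last by field.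
  rewrite (_ : n%:R * (2 * delta n) = 6 * M n + 2 * (s2 / 2) ^+ 2 * n%:R^-1); last first.
    by rewrite /delta; field.
  rewrite (_ : (fun w => cos (\sum_(i < n) r n * g (V i w) + b)) =
     (fun w => cos (r n * (\sum_(i < n) g (V i w)) + b)))//.
  by apply/funext => w; rewrite mulr_sumr.
have ninv : (n%:R^-1 : R) @[n --> \oo] --> 0.
  by apply/gtr0_cvgV0; [exists 1 => // n n0; rewrite ltr0n|exact: cvgr_idn].
have rinv : r n @[n --> \oo] --> 0.
  rewrite -[X in _ --> X]sqrtr0; under eq_fun do rewrite -(ger0_norm (r0 _)) -sqrtr_sqr r2.
  by apply: continuous_cvg => //; exact: sqrt_continuous.
have M0 : M n @[n --> \oo] --> 0.
  have mlim w : (m n w)%:E @[n --> \oo] --> 0%:E.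
    apply: cvg_EFin; first by near=> n.
    have hi : X w ^+ 2 * (r n * `|X w|) @[n --> \oo] --> 0.
      rewrite -[X in _ --> X](mulr0 (X w ^+ 2)); apply: cvgM; first exact: cvg_cst.
      by rewrite -[X in _ --> X](mul0r `|X w|); apply: cvgM => //; exact: cvg_cst.
    apply: (squeeze_cvgr _ (cvg_cst 0) hi).
    by near=> k; rewrite m_ge0 /= /m ler_wpM2l ?sqr_ge0// ge_min lexx orbT.
  have [] := @dominated_convergence _ _ _ P setT measurableT (fun n w => (m n w)%:E)
    (fun=> 0%:E) (fun w => (X w ^+ 2)%:E) => //.
  - by move=> n; apply/measurable_EFinP; exact: mm.
  - by apply: aeW => w _; exact: mlim.
  - by apply: aeW => w n _ /=; rewrite lee_fin ger0_norm// m_le.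
  by rewrite integral0 => _ _ /fine_cvg.
have bnd0 : 6 * M n + 2 * (s2 / 2) ^+ 2 * n%:R^-1 @[n --> \oo] --> 0.
  rewrite -[X in _ --> X]addr0; apply: cvgD.
    by rewrite -[X in _ --> X](mulr0 6); apply: cvgM => //; exact: cvg_cst.
  by rewrite -[X in _ --> X](mulr0 (2 * (s2 / 2) ^+ 2)); apply: cvgM => //; exact: cvg_cst.
apply/cvgrPdist_le => e e0.
have /cvgr0Pnorm_le/(_ _ e0)[N _ hN] := bnd0.
exists N.+1 => // n /= Nn; rewrite distrC.
rewrite (le_trans (tele n _)) ?(leq_trans _ Nn)//.
by rewrite (le_trans (ler_norm _))// hN//=; exact: ltnW.
Unshelve. all: by end_near.
Qed.

End central_limit.

Lemma ler_norm_mulmx (R : realType) m n p (A : 'M[R]_(m, n)) (B : 'M[R]_(n, p)) :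
  `|A *m B| <= n%:R * `|A| * `|B|.
Proof.
apply: mx_norm_le => [|i k]; first by rewrite !mulr_ge0.
rewrite mxE (le_trans (ler_norm_sum _ _ _))//.
have -> : n%:R * `|A| * `|B| = \sum_(j < n) `|A| * `|B|.
  by rewrite sumr_const card_ord -mulrA mulr_natl.
by apply: ler_sum => j _; rewrite normrM ler_pM// ler_mx_norm.
Qed.

(** * Asymptotically linear estimators *)

Section asymptotically_linear.
Context {d : measure_display} {T : measurableType d} {R : realType}.
Variable P : probability T R.

Lemma ex_osmall (U : nat -> T -> R) (M : R) :
  (forall n, measurable_fun [set: T] (U n)) -> (forall n w, `|U n w| <= M) ->
  osmall P U -> \int[P]_w U n w @[n --> \oo] --> 0.
Proof.
move=> mU UM oU; apply/cvgr0Pnorm_le => e e0.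
have [w0 _] : [set: T] !=set0 by exists point.
have M0 : 0 <= M by exact: le_trans (UM 0%N w0).
have e20 : 0 < e / 2 by rewrite divr_gt0.
have d0 : 0 < e / 2 / (M + 1) by rewrite divr_gt0// ltr_wpDl.
have [N h] := oU _ _ d0 e20; exists N => // n /h[A [mA PA AP]] /=.
rewrite (le_trans (ex_split (mU n) mA PA (ltW e20) M0 AP (UM n)))//.
rewrite [leRHS]splitr lerD2l mulrA ler_pdivrMr ?ltr_wpDl//.
by rewrite mulrC ler_wpM2l ?(ltW e20)// lerDl.
Qed.

Variables (q p : nat).
Variable V : nat -> T -> 'cV[R]_q.
Hypothesis V_iid : iid P V.
Variable G : 'cV[R]_q -> 'cV[R]_p.
Hypothesis mG : forall j, measurable_fun [set: borel_mx R q 1] (fun x : borel_mx R q 1 => G x j 0).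
Hypothesis G2 : forall j, rv_int P (fun w => G (V 0%N w) j 0 ^+ 2).
Hypothesis G0 : forall j, \int[P]_w G (V 0%N w) j 0 = 0.

Let Cov : 'M[R]_p := \matrix_(j, k) \int[P]_w (G (V 0%N w) j 0 * G (V 0%N w) k 0).

Let mGV j i : measurable_fun [set: T] (fun w => G (V i w) j 0).
Proof. exact: (iid_measurable_comp V_iid i (mG j)). Qed.

Let iGG j k : rv_int P (fun w => G (V 0%N w) j 0 * G (V 0%N w) k 0).
Proof. by apply: rv_int_mul. Qed.

Let iG j : rv_int P (fun w => G (V 0%N w) j 0).
Proof. exact: rv_int_of_sq. Qed.

Let sqE (c : 'cV[R]_p) w : dotv c (G (V 0%N w)) ^+ 2 =
  \sum_j \sum_k (c j 0 * c k 0) * (G (V 0%N w) j 0 * G (V 0%N w) k 0).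
Proof.
rewrite dotvE expr2 mulr_suml; apply: eq_bigr => j _.
by rewrite mulr_sumr; apply: eq_bigr => k _; ring.
Qed.

Let isum (c : 'cV[R]_p) j : rv_int P (fun w =>
  \sum_k (c j 0 * c k 0) * (G (V 0%N w) j 0 * G (V 0%N w) k 0)).
Proof.
apply: (@rv_int_sum _ _ _ P _ _ (fun k w => (c j 0 * c k 0) * (G (V 0%N w) j 0 * G (V 0%N w) k 0))) => k.
exact: rv_intZ.
Qed.

Let isq (c : 'cV[R]_p) : rv_int P (fun w => dotv c (G (V 0%N w)) ^+ 2).
Proof.
rewrite (_ : (fun w => _) = fun w =>
  \sum_j \sum_k (c j 0 * c k 0) * (G (V 0%N w) j 0 * G (V 0%N w) k 0)); last first.
  by apply/funext => w; exact: sqE.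
exact: (rv_int_sum _ (isum c)).
Qed.

Let exsq (c : 'cV[R]_p) : \int[P]_w (dotv c (G (V 0%N w)) ^+ 2) = (c^T *m Cov *m c) 0 0.
Proof.
under eq_Rintegral do rewrite sqE.
rewrite (ex_sum _ (isum c)).
rewrite mxE; under [RHS]eq_bigr do rewrite mxE mulr_suml.
rewrite [RHS]exchange_big /=; apply: eq_bigr => j _.
rewrite ex_sum => [|k]; last exact: rv_intZ.
by apply: eq_bigr => k _; rewrite exZ// !mxE; ring.
Qed.

Variables (Z : nat -> T -> 'cV[R]_p) (B : 'M[R]_p).
Hypothesis mZ : forall n, measurable_mx (Z n).

Let W n w : 'cV[R]_p := (Num.sqrt n%:R)^-1 *: \sum_(i < n) G (V i w).

Hypothesis ZW : osmall P (fun n w => `|Z n w - B *m W n w|).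

(** [Z] is tight because [W] is. The cosine being 1-Lipschitz, [Z] may be replaced by [B *m W] in
    every test function, and there the scalar central limit theorem applies to the summands
    [dotv (B^T *m c) (G x)]. *)
Lemma cvg_to_normal_linear : cvg_to_normal P Z 0 (B *m Cov *m B^T).
Proof.
have CovT : Cov^T = Cov.
  by apply/matrixP => j k; rewrite !mxE; apply: eq_Rintegral => w _; rewrite mulrC.
have quad c : (c^T *m (B *m Cov *m B^T) *m c) 0 0 =
    \int[P]_w (dotv (B^T *m c) (G (V 0%N w)) ^+ 2).
  by rewrite exsq trmx_mul trmxK !mulmxA.
have psd : pos_semidef (B *m Cov *m B^T).
  split; first by rewrite !trmx_mul trmxK CovT mulmxA.
  by move=> c; rewrite quad; apply: Rintegral_ge0 => w _; rewrite sqr_ge0.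
have [nu nuE] := gaussian_exists psd.
exists nu; first exact: gaussian_is_normal.
apply: cvg_in_distribution_cos => //.
  have oW : Obig P (fun n w => `|W n w|).
    apply: Obig_mx => j k; rewrite ord1.
    apply: le_Obig (iid_root_sum_Obig V_iid (mG j) (G2 j) (G0 j)) _ => n w.
    by rewrite /W mxE summxE.
  apply: le_Obig (ObigD (osmall_Obig ZW) (ObigM (Obig_cst P (p%:R * `|B|)) oW)) _ => n w.
  rewrite normr_id -[X in `|X| <= _](subrK (B *m W n w)) (le_trans (ler_normD _ _))//.
  rewrite ger0_norm ?addr_ge0 ?mulr_ge0// lerD2l//.
  exact: ler_norm_mulmx.
move=> c b; rewrite nuE quad.
pose g (x : borel_mx R q 1) := dotv (B^T *m c) (G x).
have gE : g = (fun x => \sum_j (B^T *m c) j 0 * G x j 0).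
  by apply/funext => x; rewrite /g dotvE.
have mg : measurable_fun [set: borel_mx R q 1] g.
  by rewrite gE; apply: measurable_sum => j; exact: measurable_funM.
have g2 : rv_int P (fun w => g (V 0%N w) ^+ 2) by exact: isq.
have g0 : \int[P]_w g (V 0%N w) = 0.
  rewrite gE ex_sum => [|j]; last exact: rv_intZ.
  by rewrite big1// => j _; rewrite exZ// G0 mulr0.
have WE n w : dotv c (B *m W n w) = (Num.sqrt n%:R)^-1 * \sum_(i < n) g (V i w).
  rewrite /g -dotv_sumr -dotvZr /dotv trmx_mul trmxK mulmxA.
  by rewrite -!scalemxAr.
have mdot n : measurable_fun [set: T] (fun w => cos (dotv c (Z n w) + b)).
  exact: (measurableT_comp (measurable_cos_dotv c b) (mZ n)).
have mdotW n : measurable_fun [set: T] (fun w => cos (dotv c (B *m W n w) + b)).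
  have mc : measurable_fun [set: R] (fun x : R => cos (1 * x + b)).
    exact: measurable_cos_affine.
  rewrite (_ : (fun w => _) =
      (fun w => cos (1 * ((Num.sqrt n%:R)^-1 * \sum_(i < n) g (V i w)) + b))).
    apply: (measurableT_comp mc); apply: measurable_funM => //.
    by apply: measurable_sum => i; exact: (iid_measurable_comp V_iid i mg).
  by apply/funext => w; rewrite WE mul1r.
have i1 (X : T -> R) : measurable_fun [set: T] (fun w => cos (X w)) -> rv_int P (fun w => cos (X w)).
  by move=> mX; apply: (@rv_int_bounded _ _ _ _ _ 1) => // w; exact: cos_max.
have lim0 : \int[P]_w (cos (dotv c (Z n w) + b) - cos (dotv c (B *m W n w) + b)) @[n --> \oo] --> 0.
  apply: (@ex_osmall _ 2).
  - by move=> n; exact: measurable_funB.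
  - move=> n w; rewrite (le_trans (ler_normB _ _))//.
    by rewrite -[leRHS]/(1 + 1) lerD// cos_max.
  apply: le_osmall (osmallM ZW (Obig_cst P (p%:R * `|c|))) _ => n w.
  rewrite (le_trans (cos_lipschitz _ _))// (_ : _ - _ = dotv c (Z n w - B *m W n w)); last first.
    by rewrite dotvDr dotvNr; ring.
  rewrite (le_trans (ler_dotv _ _))// ger0_norm ?mulr_ge0//.
  by rewrite mulrC.
rewrite (_ : _ * _ = 0 + expR (- (\int[P]_w (g (V 0%N w) ^+ 2) / 2)) * cos b); last by rewrite add0r.
rewrite (_ : (fun n => _) = (fun n =>
  \int[P]_w (cos (dotv c (Z n w) + b) - cos (dotv c (B *m W n w) + b)) +
  \int[P]_w cos ((Num.sqrt n%:R)^-1 * (\sum_(i < n) g (V i w)) + b))); last first.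
  apply/funext => n; rewrite exB; [|exact: i1|exact: i1].
  rewrite (_ : (fun w => cos (dotv c (B *m W n w) + b)) =
    (fun w => cos ((Num.sqrt n%:R)^-1 * (\sum_(i < n) g (V i w)) + b))) ?subrK//.
  by apply/funext => w; rewrite WE.
by apply: cvgD; [exact: lim0|exact: clt_cos].
Qed.

End asymptotically_linear.

(** * Minimum distance estimation *)

Section positive_definite.
Context {R : realType}.

Lemma quad_dotv n (M : 'M[R]_n) (c : 'cV[R]_n) : (c^T *m M *m c) 0 0 = dotv c (M *m c).
Proof. by rewrite /dotv mulmxA. Qed.

Lemma dotv_sym n (M : 'M[R]_n) (c e : 'cV[R]_n) : M^T = M ->
  dotv c (M *m e) = dotv e (M *m c).
Proof.
by move=> MT; rewrite [RHS]dotvC /dotv trmx_mul MT mulmxA.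
Qed.

Lemma cauchy_schwarz_mx n (M : 'M[R]_n) (c e : 'cV[R]_n) : pos_def M ->
  dotv c (M *m e) ^+ 2 <= dotv c (M *m c) * dotv e (M *m e).
Proof.
move=> [MT M0]; have [->|c0] := eqVneq c 0.
  by rewrite /dotv trmx0 !mul0mx mxE expr0n mul0r.
have a0 : 0 < dotv c (M *m c) by rewrite -quad_dotv; exact: M0.
have ge0 f : 0 <= dotv f (M *m f).
  have [->|f0] := eqVneq f 0; first by rewrite /dotv trmx0 mul0mx mxE.
  by rewrite -quad_dotv ltW// M0.
pose s := dotv c (M *m e) / dotv c (M *m c).
have := ge0 (e - s *: c).
rewrite mulmxBr -scalemxAr dotvDl dotvNl !dotvDr !dotvNr !dotvZl !dotvZr.
rewrite (dotv_sym e c MT); move: a0; rewrite /s.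
move: (dotv c (M *m c)) (dotv c (M *m e)) (dotv e (M *m e)) => a b z a0 h.
have : 0 <= z - b ^+ 2 / a.
  by move: h; rewrite (_ : _ + _ = z - b ^+ 2 / a)//; field; rewrite gt_eqF.
by rewrite subr_ge0 ler_pdivrMr// mulrC.
Qed.

Lemma pos_def_unitmx n (M : 'M[R]_n) : pos_def M -> M \in unitmx.
Proof.
move=> [MT M0]; rewrite -row_free_unit -kermx_eq0; apply/eqP/row_matrixP => i.
rewrite row0; apply: contrapT => /eqP ri0.
have rT : (row i (kermx M))^T != 0.
  by apply: contra_neq ri0 => /(congr1 trmx); rewrite trmxK trmx0.
have := M0 _ rT; rewrite trmxK.
have -> : row i (kermx M) *m M = 0 by rewrite -row_mul mulmx_ker row0.
by rewrite mul0mx mxE ltxx.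
Qed.

(** Cauchy-Schwarz in the form of [M] for [d] and [invmx M *m d] bounds the square of [d'd] by the
    product of [d'Md] and [d'M^-1 d]. Bounding the last factor by a multiple of [|d| ^+ 2] gives the
    constant without eigenvalues. *)
Lemma pos_def_lower_bound n (M : 'M[R]_n) : pos_def M ->
  exists2 c : R, 0 < c & forall d : 'cV[R]_n, c * `|d| ^+ 2 <= dotv d (M *m d).
Proof.
move=> pM; have uM := pos_def_unitmx pM.
pose C := n%:R * (n%:R * `|invmx M|) + 1.
have C0 : 0 < C by rewrite ltr_wpDl// !mulr_ge0.
exists C^-1; first by rewrite invr_gt0.
move=> d; have [->|d0] := eqVneq d 0.
  by rewrite normr0 expr0n mulr0 mulmx0 /dotv mulmx0 mxE.
have d_gt0 : 0 < `|d| by rewrite normr_gt0.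
have CS := @cauchy_schwarz_mx _ M d (invmx M *m d) pM.
rewrite !mulKVmx// in CS.
have dd : `|d| ^+ 2 <= dotv d d.
  have [i di] : exists i, `|d| = `|d i 0|.
    have [[i j]] := mx_norm_neq0 (negbT (gt_eqF d_gt0)).
    by rewrite (ord1 j) /= => E; exists i.
  rewrite di real_normK ?num_real// dotvE (bigD1 i)//= -expr2 lerDl.
  by apply: sumr_ge0 => j _; rewrite -expr2 sqr_ge0.
have ed : dotv (invmx M *m d) d <= C * `|d| ^+ 2.
  rewrite (le_trans (ler_norm _))// (le_trans (ler_dotv _ _))//.
  have h := ler_norm_mulmx (invmx M) d.
  rewrite (@le_trans _ _ (n%:R * (n%:R * `|invmx M| * `|d|) * `|d|))//.
    by rewrite ler_wpM2r// ler_wpM2l.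
  rewrite /C mulrDl mul1r expr2 !mulrA lerDl mulr_ge0//.
have dM0 : 0 <= dotv d (M *m d) by rewrite -quad_dotv ltW//; exact: pM.2.
rewrite mulrC ler_pdivrMr// -(@ler_pM2r _ (`|d| ^+ 2)) ?exprn_gt0//.
apply: (@le_trans _ _ (dotv d (M *m d) * dotv (invmx M *m d) d)); last first.
  by rewrite -[leRHS]mulrA ler_wpM2l.
apply: le_trans CS; rewrite -expr2 lerXn2r// ?nnegrE ?sqr_ge0//.
by rewrite (le_trans _ dd)// sqr_ge0.
Qed.

End positive_definite.

(** For small [s] of sign opposite to [L] the linear term would beat the others. The criterion is a
    polynomial of degree four in the step along a line, so this makes the first-order condition pure
    algebra. *)
Lemma linear_term_eq0 (R : realType) (L k0 k1 k2 s0 : R) : 0 < s0 ->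
  (forall s, `|s| <= s0 -> 0 <= s * L + s ^+ 2 * (k0 + s * k1 + s ^+ 2 * k2)) -> L = 0.
Proof.
move=> s00 h; apply: contrapT => /eqP L0.
have aL : 0 < `|L| by rewrite normr_gt0.
pose K := `|k0| + `|k1| + `|k2| + 1.
have K0 : 0 < K by rewrite ltr_wpDl// !addr_ge0.
(* Small enough that the higher terms, at most [t ^+ 2 * K], do not exceed half of [t * |L|]. *)
pose t := Num.min s0 (Num.min 1 (`|L| / K / 2)).
have t0 : 0 < t by rewrite !lt_min s00 ltr01 !divr_gt0.
have ts0 : t <= s0 by rewrite ge_min lexx.
have t1 : t <= 1 by rewrite !ge_min lexx orbT.
have tL : t * K <= `|L| / 2.
  rewrite -ler_pdivlMr// (_ : _ / K = `|L| / K / 2); last by field; rewrite gt_eqF.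
  by rewrite !ge_min lexx !orbT.
pose s := - Num.sg L * t.
have sa : `|s| = t by rewrite normrM normrN normr_sg L0 mul1r gtr0_norm.
have sL : s * L = - (t * `|L|) by rewrite /s normrEsg; ring.
have := h s; rewrite sa => /(_ ts0).
have s2 : s ^+ 2 = t ^+ 2 by rewrite -sa real_normK ?num_real.
have b : k0 + s * k1 + s ^+ 2 * k2 <= K.
  rewrite (le_trans (ler_norm _))// (le_trans (ler_normD _ _))//.
  rewrite /K -[leLHS]addr0 lerD// lerD//.
    rewrite (le_trans (ler_normD _ _))// lerD// normrM sa ler_piMl//.
  by rewrite normrM normrX sa ler_piMl// exprn_ile1// ltW.
rewrite sL s2.
have : t ^+ 2 * (k0 + s * k1 + s ^+ 2 * k2) <= t * (`|L| / 2).
  rewrite (@le_trans _ _ (t ^+ 2 * K))// ?ler_wpM2l ?sqr_ge0//.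
  by rewrite expr2 -mulrA ler_wpM2l// ltW.
by rewrite s2; nra.
Qed.

Lemma compact_pos_lower_bound (R : realType) (T : topologicalType) (A : set T) (F : T -> R) :
  compact A -> continuous F -> (forall x, A x -> 0 < F x) ->
  exists2 k, 0 < k & forall x, A x -> k <= F x.
Proof.
move=> /compact_near_coveringP cA cF F0.
have := cA R (0^'+) (fun k x => k <= F x) _; case.
  move=> x Ax; have Fx0 := F0 _ Ax.
  exists ([set y | F x / 2 < F y], [set k | k < F x / 2]) => /=.
    split; last by apply: nbhs_right_lt; rewrite divr_gt0.
    have /cvgr_gt/(_ (F x / 2)) : F y @[y --> x] --> F x by exact: cF.
    by apply; rewrite ltr_pdivrMr// ltr_pMr// ltr1n.
  by move=> [y k] /= [Fy kF]; rewrite ltW// (lt_trans kF).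
move=> e /= e0 H; exists (e / 2); first by rewrite divr_gt0.
move=> x Ax; apply: (H (e / 2)) => //=.
- by rewrite sub0r normrN ger0_norm ?divr_ge0 ?ltW// ltr_pdivrMr// ltr_pMr// ltr1n.
- by rewrite divr_gt0.
Qed.

(* Least squares in the reduced form D x = J x + b x x, quadratic in the
   deviation x of the parameter from its true value. *)
Section minimum_distance.
Context {R : realType} {n m p : nat}.
Variable J : 'I_n -> 'M[R]_(m, p).
Variable b : 'cV[R]_p -> 'cV[R]_p -> 'I_n -> 'cV[R]_m.
Hypothesis bDl : forall x y z t, b (x + y) z t = b x z t + b y z t.
Hypothesis bDr : forall x y z t, b x (y + z) t = b x y t + b x z t.
Hypothesis bZl : forall k x y t, b (k *: x) y t = k *: b x y t.
Hypothesis bZr : forall k x y t, b x (k *: y) t = k *: b x y t.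
Hypothesis b_le : forall x y t, `|b x y t| <= `|x| * `|y|.

Definition reduced_dev x t := J t *m x + b x x t.
Local Notation D := reduced_dev.

Definition dist_crit (Mn : 'M[R]_m) (N : 'I_n -> 'cV[R]_m) x : R :=
  \sum_t (2^-1 * dotv (D x t) (Mn *m D x t) - dotv (D x t) (N t)).

Variable M : 'M[R]_m.
Hypothesis pM : pos_def M.
Let H0 := \sum_t (J t)^T *m M *m J t.
Hypothesis uH0 : H0 \in unitmx.
Variable A : set 'cV[R]_p.
Hypothesis cA : compact A.
Hypothesis A0 : interior A 0.
Hypothesis cD : forall t, continuous (D ^~ t).
Hypothesis ident : forall x, A x -> x != 0 -> exists t, D x t != 0.

Let D0 t : D 0 t = 0.
Proof.
by rewrite /D mulmx0 add0r -[in LHS](scale0r (0 : 'cV[R]_p)) bZl scale0r.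
Qed.

(** At a point no worse than [0], where the criterion vanishes, the quadratic part is bounded by the
    linear one: [\sum_t (y t ^+ 2 - k * r * y t) <= 0] with [y t = |D x t|]. Each term is at least
    [- ((k * r) ^+ 2 / 4)], so no single [y t] can exceed a multiple of [r]. *)
Lemma reduced_dev_le_score : exists C e : R, [/\ 0 < C, 0 < e &
  forall Mn N x r, `|Mn - M| <= e -> 0 <= r -> (forall t, `|N t| <= r) ->
    dist_crit Mn N x <= dist_crit Mn N 0 -> forall t, `|D x t| <= C * r].
Proof.
have [c c0 cP] := pos_def_lower_bound pM.
pose k := 4 * m%:R / c.
have k0 : 0 <= k by rewrite divr_ge0 ?(ltW c0)// mulr_ge0.
(* The second witness is the distance from [M] within which the form of [Mn] keeps half of the lower
   bound [c]. *)
exists (k * n.+1%:R + 1), (c / 2 / (m%:R * m%:R + 1)); split.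
- by rewrite ltr_wpDl// mulr_ge0.
- by rewrite !divr_gt0// ltr_wpDl// mulr_ge0.
move=> Mn N x r MnM r0 Nr.
have crit0 : dist_crit Mn N 0 = 0.
  rewrite /dist_crit big1// => t _.
  by rewrite D0 mulmx0 /dotv trmx0 !mul0mx mxE mulr0 subrr.
rewrite crit0 => cle.
pose y t := `|D x t|.
have y0 t : 0 <= y t by exact: normr_ge0.
have low t : c / 2 * y t ^+ 2 <= dotv (D x t) (Mn *m D x t).
  have -> : Mn *m D x t = M *m D x t + (Mn - M) *m D x t.
    by rewrite -mulmxDl addrC subrK.
  rewrite dotvDr.
  have h1 := cP (D x t).
  have h2 : `|dotv (D x t) ((Mn - M) *m D x t)| <= c / 2 * y t ^+ 2.
    rewrite (le_trans (ler_dotv _ _))//.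
    have h := ler_norm_mulmx (Mn - M) (D x t).
    rewrite (@le_trans _ _ (m%:R * y t * (m%:R * `|Mn - M| * y t)))//.
      by rewrite ler_wpM2l// mulr_ge0.
    rewrite (_ : _ * _ = (m%:R * m%:R * `|Mn - M|) * y t ^+ 2); last by rewrite /y; ring.
    rewrite ler_wpM2r ?sqr_ge0//.
    have mm0 : 0 < m%:R * m%:R + 1 :> R by rewrite ltr_wpDl// mulr_ge0.
    move: MnM; rewrite ler_pdivlMr// => hh.
    by rewrite (le_trans _ hh)// mulrC ler_wpM2l// lerDl.
  have := ler_norm (- dotv (D x t) ((Mn - M) *m D x t)); rewrite normrN.
  by move: h1 h2; rewrite -/(y t); lra.
have upp t : dotv (D x t) (N t) <= m%:R * r * y t.
  rewrite (le_trans (ler_norm _))// (le_trans (ler_dotv _ _))//.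
  by rewrite -/(y t) mulrAC ler_wpM2r// ler_wpM2l.
have sum_le : \sum_t (y t ^+ 2 - (k * r) * y t) <= 0.
  have : c / 4 * \sum_t (y t ^+ 2 - (k * r) * y t) <= 0.
    apply: le_trans cle; rewrite mulr_sumr; apply: ler_sum => t _.
    rewrite (_ : c / 4 * _ = 2^-1 * (c / 2 * y t ^+ 2) - m%:R * r * y t); last first.
      by rewrite /k; field; rewrite gt_eqF.
    by rewrite lerB// ler_wpM2l.
  by rewrite pmulr_rle0// divr_gt0.
have kr0 : 0 <= k * r by rewrite mulr_ge0.
have low2 s : - ((k * r) ^+ 2 / 4) <= y s ^+ 2 - (k * r) * y s.
  by have := sqr_ge0 (y s - k * r / 2); move: (k * r) (y s) => u v; lra.
move=> t; rewrite -/(y t).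
have : y t ^+ 2 - (k * r) * y t <= n%:R * ((k * r) ^+ 2 / 4).
  have : y t ^+ 2 - k * r * y t + \sum_(s | s != t) - ((k * r) ^+ 2 / 4) <= 0.
    apply: le_trans sum_le; rewrite [leRHS](bigD1 t)//= lerD2l.
    by apply: ler_sum => s _; exact: low2.
  rewrite sumrN sumr_const subr_le0 => /le_trans; apply.
  rewrite -[_ *+ #|_|]mulr_natl ler_wpM2r ?divr_ge0 ?sqr_ge0//.
  by rewrite ler_nat -[leqRHS]card_ord max_card.
move=> h; rewrite leNgt; apply/negP => big.
have big2 : k * r * n.+1%:R < y t.
  by rewrite (le_lt_trans _ big)// mulrAC mulrDl mul1r lerDl.
move: h; apply/negP; rewrite -ltNge.
have n0 : 0 <= n%:R :> R by [].
move: big2; rewrite -[n.+1%:R]natr1.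
move: (k * r) (y t) (n%:R : R) kr0 (y0 t) n0 => u v w u0 v0 w0 hv.
have uw : 0 <= u * w by rewrite mulr_ge0.
have h1 : u * w <= v - u by lra.
have h2 : u * w * (u * (w + 1)) <= (v - u) * v.
  by apply: ler_pM => //; [rewrite mulr_ge0// addr_ge0|lra].
have [u_0|u_0] := eqVneq u 0.
  move: hv; rewrite u_0 !mul0r expr0n /= !mul0r mulr0 subr0 => hv.
  by rewrite exprn_gt0.
have u_gt0 : 0 < u by rewrite lt_def u_0.
have v_gt0 : 0 < v by rewrite (le_lt_trans _ hv)// mulr_ge0// addr_ge0.
have h3 : u * w < v - u by lra.
have h4 : u * w * v < (v - u) * v by rewrite ltr_pM2r.
have h5 : u * w * (u * (w + 1)) <= u * w * v by rewrite ler_wpM2l// ltW.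
have h6 : 0 <= u * w * (u * w) by rewrite mulr_ge0.
have h7 : 0 <= u * w * u by rewrite mulr_ge0.
by lra.
Qed.

(** Away from [0] on the compact set, identification makes [\sum_t |D x t|] positive, hence bounded
    below: the consistency argument in deterministic form. *)
Lemma small_of_reduced_dev (rho : R) : 0 < rho -> exists2 k, 0 < k &
  forall x, A x -> (forall t, `|D x t| <= k) -> `|x| < rho.
Proof.
move=> rho0; pose F x := \sum_t `|D x t|.
have cF : continuous F.
  have -> : F = \sum_t (fun x => `|D x t|) by apply/funext => x; rewrite fct_sumE.
  elim/big_ind: _ => [|f g cf cg|t _] x; first exact: cst_continuous.
    by apply: continuousD; [exact: cf|exact: cg].
  apply: (@continuous_comp _ _ _ (D ^~ t) (fun v : 'cV[R]_m => `|v|)); first exact: cD.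
  exact: norm_continuous.
have cB : compact (A `&` [set x | rho <= `|x|]).
  apply: compact_closedI => //.
  rewrite (_ : mkset _ = (fun x : 'cV[R]_p => `|x|) @^-1` `[rho, +oo[%classic); last first.
    by apply/seteqP; split=> x /=; rewrite in_itv /= andbT.
  apply: closed_comp => [x _|]; first by apply: norm_continuous.
  exact: interval_closed.
have [|k k0 kP] := compact_pos_lower_bound cB cF.
  move=> x [Ax /= rx].
  have x0 : x != 0 by rewrite -normr_gt0 (lt_le_trans rho0).
  have [t Dt] := ident Ax x0.
  rewrite /F (bigD1 t)//= ltr_wpDr ?normr_gt0//; exact: sumr_ge0.
(* A sum of [n] terms of at most [k / n.+1%:R] is strictly below [k], also when [n = 0]. *)
exists (k / n.+1%:R); first by rewrite divr_gt0.
move=> x Ax Dk; rewrite ltNge; apply/negP => rx.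
have := kP x (conj Ax rx); apply/negP; rewrite -ltNge.
rewrite (@le_lt_trans _ _ (\sum_(t < n) k / n.+1%:R))//; first exact: ler_sum.
rewrite sumr_const card_ord -[_ *+ n]mulr_natl mulrCA gtr_pMr// ltr_pdivrMr// mul1r ltr_nat//.
Qed.

(** [x] is recovered from the vectors [J t *m x] through the inverse of [H0]. *)
Lemma le_of_jacobian : exists2 C : R, 0 < C & forall (x : 'cV[R]_p) (y : R),
  0 <= y -> (forall t, `|J t *m x| <= y) -> `|x| <= C * y.
Proof.
pose C := p%:R * `|invmx H0| * \sum_t (m%:R * `|(J t)^T *m M|) + 1.
exists C.
  by rewrite ltr_wpDl// !mulr_ge0// sumr_ge0// => t _; rewrite mulr_ge0.
move=> x y y0 Jy.
rewrite -[x](mulKmx uH0) (le_trans (ler_norm_mulmx _ _))//.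
rewrite /C mulrDl mul1r ler_wpDr// -!mulrA ler_wpM2l// ler_wpM2l//.
rewrite /H0 mulmx_suml (le_trans (ler_norm_sum _ _ _))// mulr_suml.
apply: ler_sum => t _.
rewrite -[_ *m J t *m x]mulmxA (le_trans (ler_norm_mulmx _ _))//.
by rewrite ler_wpM2l// mulr_ge0.
Qed.

(** The derivative of [D] at [x] in the direction [h]; as [D] is quadratic, [D_step] is an exact
    expansion. *)
Let polar x h t := J t *m h + (b x h t + b h x t).

Let D_step x h s t : D (x + s *: h) t = D x t + (s *: polar x h t + s ^+ 2 *: b h h t).
Proof.
rewrite /D /polar mulmxDr -scalemxAr bDl !bDr !bZl !bZr scalerA -expr2 !scalerDr.
move: (J t *m x) (J t *m h) (b x x t) (b x h t) (b h x t) (b h h t) => u v w y z q'.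
by apply/matrixP => i j; rewrite !mxE; ring.
Qed.

Lemma first_order_condition Mn N x : Mn^T = Mn -> interior A x ->
  (forall x', A x' -> dist_crit Mn N x <= dist_crit Mn N x') ->
  forall h, \sum_t dotv (polar x h t) (Mn *m D x t - N t) = 0.
Proof.
move=> MnT intx minx h.
have [s0 s00 s0P] : exists2 s0, 0 < s0 & forall s, `|s| <= s0 -> A (x + s *: h).
  have /nbhs_ballP[e /= e0 eA] := intx.
  exists (e / 2 / (`|h| + 1)); first by rewrite !divr_gt0// ltr_wpDl.
  move=> s sl; apply: eA; rewrite -ball_normE /= opprD addrA subrr add0r normrN normrZ.
  move: sl; rewrite ler_pdivlMr ?ltr_wpDl// => sl.
  rewrite (@le_lt_trans _ _ (`|s| * (`|h| + 1)))//.
    by rewrite ler_wpM2l// lerDl.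
  by rewrite (le_lt_trans sl)// ltr_pdivrMr// ltr_pMr// ltr1n.
pose a t := polar x h t; pose c t := b h h t; pose g t := Mn *m D x t - N t.
(* These are the coefficients of the powers of [s] in the increment of the criterion, read off from
   [D_step]. *)
apply: (@linear_term_eq0 _ _ (\sum_t (dotv (c t) (g t) + 2^-1 * dotv (a t) (Mn *m a t)))
  (\sum_t dotv (a t) (Mn *m c t)) (\sum_t 2^-1 * dotv (c t) (Mn *m c t)) s0 s00).
move=> s /s0P/minx; rewrite -subr_ge0; congr (_ <= _).
rewrite /dist_crit -sumrB !mulr_sumr -!big_split /= mulr_sumr -big_split /=.
apply: eq_bigr => t _; rewrite D_step -!/(a t) -!/(c t) /g.
move: (D x t) (a t) (c t) (N t) => dd aa cc nn.
rewrite !mulmxDr -!scalemxAr !dotvDl !dotvDr !dotvNr !dotvZl !dotvZr.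
rewrite (dotv_sym dd aa MnT) (dotv_sym dd cc MnT) (dotv_sym cc aa MnT).
by field.
Qed.

Let dotv_trmul (h : 'cV[R]_p) (B : 'M[R]_(m, p)) (v : 'cV[R]_m) :
  dotv h (B^T *m v) = dotv (B *m h) v.
Proof. by rewrite /dotv trmx_mul mulmxA. Qed.

(** A chain of improving bounds: the criterion gives [|D x t| <= C1 * r], identification then
    [|x| < rho], and in that ball the Jacobian gives [|x| <= C3 * r]. Being interior, [x] satisfies
    the first-order condition, which differs from the linear equation in [H0] only by products of
    two small factors. *)
Lemma minimum_distance_expansion : exists C e : R, [/\ 0 < C, 0 < e &
  forall Mn N x r, Mn^T = Mn -> is_minimizer_over A (dist_crit Mn N) x ->
    `|Mn - M| <= e -> 0 <= r -> (forall t, `|N t| <= r) -> r <= e ->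
    `|H0 *m x - \sum_t (J t)^T *m N t| <= C * r * (r + `|Mn - M|)].
Proof.
have [C1 [e1 [C1_gt0 e1_gt0 P1]]] := reduced_dev_le_score.
have [C2 C2_gt0 P2] := le_of_jacobian.
have /nbhs_ballP[rho0 /= rho0_gt0 rho0A] := A0.
(* [rho0] keeps [x] in the interior; the second bound makes the quadratic term [C2 * |x| ^+ 2] at
   most half of [|x|]. *)
pose rho := Num.min rho0 (C2^-1 / 2).
have rho_gt0 : 0 < rho by rewrite lt_min rho0_gt0 divr_gt0 ?invr_gt0.
have [k k0 kP] := small_of_reduced_dev rho_gt0.
pose C3 := 2 * C1 * C2.
have C3_gt0 : 0 < C3 by rewrite !mulr_gt0.
pose Jb := \sum_t `|J t|.
have Jb0 : 0 <= Jb by exact: sumr_ge0.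
(* One constant per remainder: the part of [polar] coming from [b] against the gradient, the
   replacement of [Mn] by [M], and the quadratic part of [D]. *)
pose K1 := m%:R * (2 * C3) * (m%:R * (`|M| + 1) * C1 + 1).
pose K2 := m%:R * (p%:R * Jb) * (m%:R * C1).
pose K3 := m%:R * (p%:R * Jb) * (m%:R * `|M| * C3 ^+ 2).
have C10 := ltW C1_gt0; have C30 := ltW C3_gt0.
have K10 : 0 <= K1.
  apply: mulr_ge0; first by apply: mulr_ge0 => //; exact: mulr_ge0.
  apply: addr_ge0 => //; apply: mulr_ge0 => //; apply: mulr_ge0 => //; exact: addr_ge0.
have mpJ0 : 0 <= m%:R * (p%:R * Jb) by apply: mulr_ge0 => //; exact: mulr_ge0.
have K20 : 0 <= K2 by apply: mulr_ge0 => //; exact: mulr_ge0.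
have K30 : 0 <= K3.
  by apply: mulr_ge0 => //; apply: mulr_ge0; [exact: mulr_ge0|exact: sqr_ge0].
have K0 : 0 <= K1 + K2 + K3 by rewrite addr_ge0// addr_ge0.
exists (n%:R * (K1 + K2 + K3) + 1), (Num.min e1 (Num.min (k / C1) 1)); split.
- by rewrite ltr_wpDl// mulr_ge0.
- by rewrite !lt_min e1_gt0 divr_gt0// ltr01.
move=> Mn N x r MnT [Ax minx] MnM r0 Nr re.
move: MnM re; rewrite !le_min => /andP[MnM1 /andP[_ MnM2]] /andP[_ /andP[rk _]].
have A00 : A 0 by exact: nbhs_singleton A0.
have Dr t : `|D x t| <= C1 * r by apply: (P1 Mn N) => //; exact: minx.
have xrho : `|x| < rho.
  apply: kP => // t; rewrite (le_trans (Dr t))//.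
  by rewrite mulrC -ler_pdivlMr.
have intx : interior A x.
  rewrite /interior; apply: (filterS rho0A); apply: open_nbhs_nbhs; split; first exact: ball_open.
  by rewrite -ball_normE /= sub0r normrN (lt_le_trans xrho)// ge_min lexx.
have xr : `|x| <= C3 * r.
  have Jx t : `|J t *m x| <= C1 * r + `|x| * `|x|.
    rewrite (_ : J t *m x = D x t - b x x t); last by rewrite /D addrK.
    by rewrite (le_trans (ler_normB _ _))// lerD.
  have := P2 x _ _ Jx; rewrite addr_ge0 ?mulr_ge0 ?(ltW C1_gt0)// => /(_ isT) h.
  have : C2 * (`|x| * `|x|) <= `|x| / 2.
    rewrite mulrCA ler_wpM2l// mulrC -ler_pdivlMr// mulrC.
    by rewrite (le_trans (ltW xrho))// ge_min lexx orbT.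
  by move: h; rewrite /C3; lra.
have FOC := first_order_condition MnT intx minx.
apply: mx_norm_le => [|i j].
  by rewrite !mulr_ge0 ?addr_ge0 ?mulr_ge0 ?addr_ge0.
rewrite (ord1 j); set y := H0 *m x - _.
(* Coordinate [i] of the error is its product with a basis vector, which also serves as the
   direction in the first-order condition. *)
pose h : 'cV[R]_p := delta_mx i 0.
have h1 : `|h| <= 1.
  apply: mx_norm_le => // a c; rewrite mxE.
  by case: (_ && _); rewrite ?normr1 ?normr0.
have -> : y i 0 = dotv h y.
  rewrite dotvE (bigD1 i)//= big1 => [|a ai]; rewrite /h [delta_mx _ _ _ _]mxE.
    by rewrite !eqxx mul1r addr0.
  by rewrite (negbTE ai) mul0r.
pose g t := Mn *m D x t - N t.
pose e t := b x h t + b h x t.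
have -> : dotv h y = \sum_t (- dotv (e t) (g t) + (dotv (J t *m h) ((M - Mn) *m D x t) -
    dotv (J t *m h) (M *m b x x t))).
  transitivity (dotv h y - \sum_t dotv (polar x h t) (g t)); first by rewrite FOC subr0.
  rewrite /y dotvDr dotvNr /H0 mulmx_suml !dotv_sumr -!sumrB; apply: eq_bigr => t _.
  rewrite -!mulmxA !dotv_trmul /polar -/(e t) -/(g t) dotvDl.
  rewrite (_ : J t *m x = D x t - b x x t); last by rewrite /D addrK.
  rewrite /g mulmxBr mulmxBl !dotvDr !dotvNr.
  by ring.
rewrite (le_trans (ler_norm_sum _ _ _))//.
have Mn_le : `|Mn| <= `|M| + 1.
  rewrite -[Mn](subrK M) addrC (le_trans (ler_normD _ _))// lerD//.
have g_le t : `|g t| <= (m%:R * (`|M| + 1) * C1 + 1) * r.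
  rewrite /g (le_trans (ler_normB _ _))// mulrDl mul1r lerD//.
  rewrite (le_trans (ler_norm_mulmx _ _))//.
  rewrite (_ : _ * C1 * r = m%:R * (`|M| + 1) * (C1 * r)); last by ring.
  by apply: ler_pM => //; rewrite ?mulr_ge0// ler_wpM2l.
have e_le t : `|e t| <= 2 * C3 * r.
  rewrite /e (le_trans (ler_normD _ _))//.
  have hx1 : `|x| * `|h| <= C3 * r by rewrite -[leRHS]mulr1 ler_pM.
  have e1' := le_trans (b_le x h t) hx1.
  have e2' : `|b h x t| <= C3 * r by rewrite (le_trans (b_le h x t))// mulrC.
  by rewrite (le_trans (lerD e1' e2'))// -mulrA mulr_natl mulr2n.
have Jh_le t : `|J t *m h| <= p%:R * Jb.
  rewrite (le_trans (ler_norm_mulmx _ _))// -[leRHS]mulr1.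
  apply: ler_pM => //.
  by rewrite ler_wpM2l// /Jb (bigD1 t)//= lerDl sumr_ge0.
have term t : `|- dotv (e t) (g t) + (dotv (J t *m h) ((M - Mn) *m D x t) -
    dotv (J t *m h) (M *m b x x t))| <= (K1 + K2 + K3) * r * (r + `|Mn - M|).
  have t1 : `|dotv (e t) (g t)| <= K1 * r * r.
    rewrite (le_trans (ler_dotv _ _))// /K1.
    rewrite (_ : _ * r * r = m%:R * (2 * C3 * r) * ((m%:R * (`|M| + 1) * C1 + 1) * r)); last by ring.
    by apply: ler_pM => //; rewrite ?mulr_ge0// ler_wpM2l.
  have t2 : `|dotv (J t *m h) ((M - Mn) *m D x t)| <= K2 * r * `|Mn - M|.
    rewrite (le_trans (ler_dotv _ _))// /K2 (distrC Mn).
    rewrite (_ : _ * r * _ = m%:R * (p%:R * Jb) * (m%:R * `|M - Mn| * (C1 * r))); last by ring.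
    apply: ler_pM => //; rewrite ?mulr_ge0//; first by rewrite ler_wpM2l.
    by rewrite (le_trans (ler_norm_mulmx _ _))// ler_wpM2l// mulr_ge0.
  have t3 : `|dotv (J t *m h) (M *m b x x t)| <= K3 * r * r.
    rewrite (le_trans (ler_dotv _ _))// /K3.
    rewrite (_ : _ * r * _ = m%:R * (p%:R * Jb) * (m%:R * `|M| * ((C3 * r) * (C3 * r)))); last by ring.
    apply: ler_pM => //; rewrite ?mulr_ge0//; first by rewrite ler_wpM2l.
    rewrite (le_trans (ler_norm_mulmx _ _))// ler_wpM2l ?mulr_ge0//.
    by rewrite (le_trans (b_le x x t))// ler_pM.
  rewrite (le_trans (ler_normD _ _))// normrN.
  have t23 := ler_normB (dotv (J t *m h) ((M - Mn) *m D x t)) (dotv (J t *m h) (M *m b x x t)).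
  have z0 := normr_ge0 (Mn - M); move: (`|Mn - M|) z0 t2 => z z0 t2.
  have q1 : 0 <= K1 * r * z by apply: mulr_ge0 => //; apply: mulr_ge0.
  have q2 : 0 <= K2 * r * r by apply: mulr_ge0 => //; apply: mulr_ge0.
  have q3 : 0 <= K3 * r * z by apply: mulr_ge0 => //; apply: mulr_ge0.
  rewrite (_ : _ * (r + z) = K1 * r * r + K2 * r * z + K3 * r * r + (K1 * r * z + K2 * r * r + K3 * r * z)); last by ring.
  by lra.
rewrite (@le_trans _ _ (\sum_(t < n) (K1 + K2 + K3) * r * (r + `|Mn - M|)))//; first exact: ler_sum.
rewrite sumr_const card_ord -[_ *+ n]mulr_natl.
rewrite [leRHS](_ : _ = n%:R * ((K1 + K2 + K3) * r * (r + `|Mn - M|)) + r * (r + `|Mn - M|)); last by ring.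
by rewrite lerDl mulr_ge0// addr_ge0.
Qed.

End minimum_distance.

(** For [H] near [G] one has [|b| <= 2 * g * |H *m b|], so [H] is injective. With
    [b = invmx H *m w], the difference [G *m b - w] equals [(G - H) *m b], which is small relative
    to [w]. *)
Lemma inverse_perturbation (R : realType) n (G : 'M[R]_n) : G \in unitmx ->
  exists C e : R, [/\ 0 < C, 0 < e & forall (H : 'M[R]_n) (w : 'cV[R]_n), `|H - G| <= e ->
    H \in unitmx /\ `|G *m (invmx H *m w) - w| <= C * `|H - G| * `|w|].
Proof.
move=> uG; pose g := n%:R * `|invmx G|.
have g0 : 0 <= g by exact: mulr_ge0.
pose e := (2 * (g * n%:R + 1))^-1.
have e0 : 0 < e by rewrite invr_gt0 mulr_gt0// ltr_wpDl// mulr_ge0.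
exists (n%:R * (2 * g) + 1), e; split => //.
  by rewrite ltr_wpDl// mulr_ge0// mulr_ge0.
move=> H w He.
have bound (b : 'cV[R]_n) : `|b| <= 2 * g * `|H *m b|.
  have : `|b| <= g * (`|H *m b| + n%:R * e * `|b|).
    rewrite -{1}[b](mulKmx uG) (le_trans (ler_norm_mulmx _ _))// -/g ler_wpM2l//.
    rewrite (_ : G *m b = H *m b - (H - G) *m b); last by rewrite mulmxBl opprB addrC subrK.
    rewrite (le_trans (ler_normB _ _))// lerD2l (le_trans (ler_norm_mulmx _ _))//.
    by rewrite ler_wpM2r// ler_wpM2l.
  have : g * n%:R * e <= 1 / 2.
    rewrite /e invfM mulrCA mulrC mul1r -[leRHS]mul1r ler_wpM2r//.
    by rewrite ler_pdivrMr ?mul1r ?lerDl// ltr_wpDl// mulr_ge0.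
  have b0 := normr_ge0 b; move: (`|b|) (`|H *m b|) b0 => x y x0 h1 h2.
  have : g * n%:R * e * x <= 1 / 2 * x by rewrite ler_wpM2r.
  by lra.
have uH : H \in unitmx.
  rewrite -unitmx_tr -row_free_unit -kermx_eq0; apply/eqP/row_matrixP => i.
  rewrite row0; set r := row i _.
  have rH : H *m r^T = 0.
    apply: trmx_inj; rewrite trmx_mul trmxK trmx0 /r.
    by rewrite -row_mul mulmx_ker row0.
  have := bound r^T; rewrite rH normr0 mulr0 normr_le0 => /eqP r0.
  by apply: trmx_inj; rewrite trmx0.
split=> //; set b := invmx H *m w.
have Hb : H *m b = w by rewrite /b mulKVmx.
have -> : G *m b - w = - ((H - G) *m b) by rewrite -[in LHS]Hb mulmxBl opprB.
rewrite normrN (le_trans (ler_norm_mulmx _ _))//.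
have := bound b; rewrite Hb => h.
rewrite (@le_trans _ _ (n%:R * `|H - G| * (2 * g * `|w|)))//.
  by rewrite ler_wpM2l// mulr_ge0.
rewrite [leRHS](_ : _ = n%:R * `|H - G| * (2 * g * `|w|) + `|H - G| * `|w|); last by ring.
by rewrite lerDl mulr_ge0.
Qed.

(** * Measurability of matrix operations *)

Section measurable_matrices.
Context {d : measure_display} {T : measurableType d} {R : realType}.

(** The inverse, with [0^-1 = 0], is the pointwise limit of the continuous functions
    [x / (x ^+ 2 + 1 / (k + 1))], at [0] as well. *)
Lemma measurable_invr (f : T -> R) :
  measurable_fun [set: T] f -> measurable_fun [set: T] (fun w => (f w)^-1).
Proof.
move=> mf.
have minv : measurable_fun [set: R] (fun x : R => x^-1).
  pose h (k : nat) (x : R) : R := x * (x ^+ 2 + k.+1%:R^-1)^-1.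
  have pos k (x : R) : 0 < x ^+ 2 + k.+1%:R^-1 by rewrite ltr_wpDl ?sqr_ge0.
  apply: (@measurable_fun_cvg _ _ R [set: R] h) => [k|x _].
    apply: continuous_measurable_fun => x.
    apply: (@continuousM R R id (fun y => (y ^+ 2 + k.+1%:R^-1)^-1)); first exact: cvg_id.
    apply: (@continuousV R R (fun y => y ^+ 2 + k.+1%:R^-1)); first by rewrite gt_eqF.
    apply: (@continuousD R R R (fun y => y ^+ 2) (fun=> k.+1%:R^-1)); last exact: cvg_cst.
    exact: exprn_continuous.
  have [->|x0] := eqVneq x 0.
    rewrite invr0 (_ : (fun k => h k 0) = cst 0); first exact: cvg_cst.
    by apply/funext => k; rewrite /h mul0r.
  rewrite -[X in _ --> X](_ : x * (x ^+ 2 + 0)^-1 = _); last by rewrite addr0; field.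
  apply: cvgM; first exact: cvg_cst.
  apply: cvgV; first by rewrite addr0 expf_neq0.
  apply: cvgD; first exact: cvg_cst.
  exact: cvg_harmonic.
exact: (measurableT_comp minv mf).
Qed.

Lemma measurable_mx_mul m n p (A : T -> 'M[R]_(m, n)) (B : T -> 'M[R]_(n, p)) :
  measurable_mx A -> measurable_mx B -> measurable_mx (fun w => A w *m B w).
Proof.
move=> mA mB; apply: measurable_mx_coords => i j.
under eq_fun do rewrite mxE.
by apply: measurable_sum => k; apply: measurable_funM; exact: measurable_mx_coord.
Qed.

Lemma measurable_mx_add m n (A B : T -> 'M[R]_(m, n)) :
  measurable_mx A -> measurable_mx B -> measurable_mx (fun w => A w + B w).
Proof.
move=> mA mB; apply: measurable_mx_coords => i j.
under eq_fun do rewrite mxE.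
by apply: measurable_funD; exact: measurable_mx_coord.
Qed.

Lemma measurable_mx_scale m n (f : T -> R) (A : T -> 'M[R]_(m, n)) :
  measurable_fun [set: T] f -> measurable_mx A -> measurable_mx (fun w => f w *: A w).
Proof.
move=> mf mA; apply: measurable_mx_coords => i j.
under eq_fun do rewrite mxE.
by apply: measurable_funM => //; exact: measurable_mx_coord.
Qed.

Lemma measurable_mx_cst m n (A : 'M[R]_(m, n)) : measurable_mx (fun _ : T => A).
Proof. by apply: measurable_mx_coords => i j; exact: measurable_cst. Qed.

Lemma measurable_mx_opp m n (A : T -> 'M[R]_(m, n)) :
  measurable_mx A -> measurable_mx (fun w => - A w).
Proof.
move=> mA; apply: measurable_mx_coords => i j.
under eq_fun do rewrite mxE.
by apply: measurableT_comp => //; exact: measurable_mx_coord.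
Qed.

Lemma measurable_mx_tr m n (A : T -> 'M[R]_(m, n)) :
  measurable_mx A -> measurable_mx (fun w => (A w)^T).
Proof.
move=> mA; apply: measurable_mx_coords => i j.
by under eq_fun do rewrite mxE; exact: measurable_mx_coord.
Qed.

Lemma measurable_mx_sum m n (I : Type) (s : seq I) (A : I -> T -> 'M[R]_(m, n)) :
  (forall i, measurable_mx (A i)) -> measurable_mx (fun w => \sum_(i <- s) A i w).
Proof.
move=> mA; apply: measurable_mx_coords => i j.
under eq_fun do rewrite summxE.
by apply: measurable_sum => k; exact: measurable_mx_coord.
Qed.

Lemma measurable_mx_col m1 m2 n (A : T -> 'M[R]_(m1, n)) (B : T -> 'M[R]_(m2, n)) :
  measurable_mx A -> measurable_mx B -> measurable_mx (fun w => col_mx (A w) (B w)).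
Proof.
move=> mA mB; apply: measurable_mx_coords => i j.
rewrite -[i]splitK; case: (fintype.split i) => k /=.
  by under eq_fun do rewrite col_mxEu; exact: measurable_mx_coord.
by under eq_fun do rewrite col_mxEd; exact: measurable_mx_coord.
Qed.

Lemma measurable_det n (A : T -> 'M[R]_n) : measurable_mx A ->
  measurable_fun [set: T] (fun w => \det (A w)).
Proof.
move=> mA; rewrite /determinant; apply: measurable_sum => s.
apply: measurable_funM => //.
by apply: measurable_prod => i _; exact: measurable_mx_coord.
Qed.

(** [invmx] returns a singular matrix unchanged, hence the case distinction on the determinant;
    elsewhere the entries are cofactors divided by the determinant. *)
Lemma measurable_invmx n (A : T -> 'M[R]_n) : measurable_mx A ->
  measurable_mx (fun w => invmx (A w)).
Proof.
move=> mA; have mdet := measurable_det mA.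
apply: measurable_mx_coords => i j.
pose D : set T := (fun w => \det (A w)) @^-1` [set 0].
have mD : measurable D by rewrite -[D]setTI; exact: mdet.
rewrite (_ : (fun w => _) = (fun w => \1_D w * A w i j +
    (1 - \1_D w) * ((\det (A w))^-1 * cofactor (A w) j i))); last first.
  apply/funext => w; rewrite /invmx unitmxE unitfE indicE.
  have [w0|w0] := eqVneq (\det (A w)) 0.
    by rewrite mem_set//= mul1r subrr mul0r addr0.
  by rewrite memNset ?mul0r ?add0r ?subr0 ?mul1r ?mxE ?mxE//=; apply/eqP.
have mcof : measurable_fun [set: T] (fun w => cofactor (A w) j i).
  rewrite /cofactor; apply: measurable_funM => //; apply: measurable_det.
  apply: measurable_mx_coords => k l.
  by under eq_fun do rewrite !mxE; exact: measurable_mx_coord.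
have m1 : measurable_fun [set: T] (\1_D : T -> R) by exact: measurable_indic.
apply: measurable_funD.
  by apply: measurable_funM => //; exact: measurable_mx_coord.
apply: measurable_funM; first exact: measurable_funB.
by apply: measurable_funM => //; exact: measurable_invr.
Qed.

End measurable_matrices.

(** * Reduced form of the panel model *)

Section reduced_form.
Context {R : realType} {K m T' : nat}.
Variable S : 'I_(1 + T') -> 'M[R]_(m, K).
Variables (theta0 : 'cV[R]_m) (lambda0 : 'cV[R]_T').

(** The derivative of [pi_t] at [psi0]. Its last block has [theta0] in the column of the loading of
    period [t]; the zero row in [col_mx 0 1%:M] reflects the normalization of the first loading. *)
Definition reduced_jac t : 'M[R]_(m, K + m + T') :=
  row_mx (row_mx (S t) (loadings lambda0 t 0)%:M)
         (theta0 *m row t (col_mx 0 1%:M : 'M[R]_(1 + T', T'))).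

(** The bilinear form behind the product of loading and [theta], the only nonlinearity of [pi_t]; it
    vanishes in the first period, whose loading is fixed. *)
Definition reduced_cross (x h : 'cV[R]_(K + m + T')) t : 'cV[R]_m :=
  (col_mx 0 (par_lambda x) : 'cV[R]_(1 + T')) t 0 *: par_theta h.

Lemma reduced_jac_mul t x : reduced_jac t *m x =
  S t *m par_beta x + loadings lambda0 t 0 *: par_theta x +
  (col_mx 0 (par_lambda x) : 'cV[R]_(1 + T')) t 0 *: theta0.
Proof.
rewrite -{1}[x]vsubmxK -[usubmx x]vsubmxK /reduced_jac !mul_row_col mul_scalar_mx.
congr (_ + _); rewrite -mulmxA -row_mul mul_col_mx mul0mx mul1mx.
by rewrite [row t _]mx11_scalar mul_mx_scalar mxE.
Qed.

Lemma reduced_devE beta0 x t :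
  reduced_dev reduced_jac reduced_cross x t =
  reduced_coef (col_mx (col_mx beta0 theta0) lambda0 + x) S t -
  reduced_coef (col_mx (col_mx beta0 theta0) lambda0) S t.
Proof.
rewrite /reduced_dev reduced_jac_mul /reduced_cross /reduced_coef /par_beta /par_theta /par_lambda.
rewrite !linearD/= !col_mxKu !col_mxKd.
have -> : loadings (lambda0 + dsubmx x) t 0 =
    loadings lambda0 t 0 + (col_mx 0 (dsubmx x) : 'cV[R]_(1 + T')) t 0.
  by rewrite /loadings -[in LHS](addr0 1%:M) -add_col_mx mxE.
rewrite !scalerDl; move: (_ *: theta0) (_ *: theta0) (_ *: dsubmx _) (_ *: dsubmx _).
move: (S t *m beta0) (S t *m _) => p q r s v w.
by apply/matrixP => i j; rewrite !mxE; ring.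
Qed.

Lemma reduced_crossDl x y h t :
  reduced_cross (x + y) h t = reduced_cross x h t + reduced_cross y h t.
Proof.
rewrite /reduced_cross /par_lambda linearD/= -{1}(addr0 (0 : 'M[R]_1)) -add_col_mx.
by rewrite mxE scalerDl.
Qed.

Lemma reduced_crossDr x y h t :
  reduced_cross x (y + h) t = reduced_cross x y t + reduced_cross x h t.
Proof. by rewrite /reduced_cross /par_theta !linearD. Qed.

Lemma reduced_crossZl k x h t : reduced_cross (k *: x) h t = k *: reduced_cross x h t.
Proof.
rewrite /reduced_cross /par_lambda linearZ/= -{1}(scaler0 _ k) -scale_col_mx.
by rewrite mxE scalerA.
Qed.

Lemma reduced_crossZr k x h t : reduced_cross x (k *: h) t = k *: reduced_cross x h t.
Proof. by rewrite /reduced_cross /par_theta [usubmx _]linearZ [dsubmx _]linearZ/= !scalerA mulrC. Qed.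

Lemma reduced_cross_le x h t : `|reduced_cross x h t| <= `|x| * `|h|.
Proof.
apply: mx_norm_le => [|i j]; first exact: mulr_ge0.
rewrite mxE normrM ler_pM//; last by rewrite !mxE ler_mx_norm.
rewrite mxE; case: (fintype.split t) => k; first by rewrite mxE normr0.
by rewrite mxE ler_mx_norm.
Qed.

Lemma reduced_dev_continuous t :
  continuous (fun x => reduced_dev reduced_jac reduced_cross x t).
Proof.
apply: continuous_mx_coords => i j.
pose u x := dotv (row i (reduced_jac t))^T x.
pose v (x : 'cV[R]_(K + m + T')) := (col_mx 0 (par_lambda x) : 'cV[R]_(1 + T')) t 0.
rewrite (_ : (fun x => _) = (fun x => u x + v x * x (lshift T' (rshift K i)) 0)); last first.
  apply/funext => x; rewrite /u /dotv trmxK /reduced_dev /reduced_cross -row_mul ord1 !mxE.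
  by rewrite /v !mxE.
have cv : continuous v.
  have [->|[k ->]] : v = (fun=> 0) \/ exists k, v = (fun x => x (rshift (K + m) k) 0).
  - rewrite /v -[t]splitK; case: (fintype.split t) => k /=; [left|right; exists k];
      by apply/funext => x; rewrite ?col_mxEu ?col_mxEd mxE.
  - by move=> x; exact: cst_continuous.
  - exact: coord_continuous.
move=> x; apply: (@continuousD R R _ u (fun x => v x * x (lshift T' (rshift K i)) 0)).
  exact: continuous_dotv.
apply: (@continuousM R _ v (fun x => x (lshift T' (rshift K i)) 0)); first exact: cv.
exact: coord_continuous.
Qed.

(** For centred variables this turns the mean of [R'R] into the sum of the [J_t' M J_t], identifying
    the statistical [H0] with that of the minimum distance problem. *)
Lemma regressor_mx_row (X : 'M[R]_(1 + T', K)) (z : 'cV[R]_m) t :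
  row t X = z^T *m S t ->
  row t (regressor_mx X z theta0 lambda0) = z^T *m reduced_jac t.
Proof.
move=> Xt.
have -> : regressor_mx X z theta0 lambda0 =
    row_mx (row_mx X (loadings lambda0 *m z^T)) (col_mx 0 ((z^T *m theta0) 0 0)%:M).
  rewrite /regressor_mx block_mxEh; congr row_mx.
  rewrite -{3}[X]vsubmxK /loadings mul_col_mx mul1mx -block_mxEh.
  by rewrite -block_mxEv.
rewrite !row_row_mx Xt /reduced_jac !mul_mx_row; congr (row_mx (row_mx _ _) _).
  rewrite row_mul [row t _]mx11_scalar mul_scalar_mx mxE mul_mx_scalar.
  by [].
rewrite mulmxA [z^T *m theta0]mx11_scalar mul_scalar_mx.
apply/rowP => j; rewrite !mxE; case: (fintype.split t) => k; rewrite !mxE ?mulr0//.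
by rewrite mulr_natr.
Qed.

End reduced_form.

Section demeaning.
Context {R : realType}.

Lemma demean_linear m n p q (f : {linear 'M[R]_(m, n) -> 'M[R]_(p, q)}) x N i :
  demean (fun i => f (x i)) N i = f (demean x N i).
Proof. by rewrite /demean -linear_sum -[_ *: f _]linearZ -linearB. Qed.

Lemma demeanD m n (x y : nat -> 'M[R]_(m, n)) N i :
  demean (fun i => x i + y i) N i = demean x N i + demean y N i.
Proof. by rewrite /demean big_split/= scalerDr opprD addrACA. Qed.

Lemma demean_cst m n (c : 'M[R]_(m, n)) N i : (0 < N)%N -> demean (fun=> c) N i = 0.
Proof.
move=> N0; rewrite /demean sumr_const card_ord -[c *+ N]scaler_nat scalerA mulVf ?scale1r ?subrr//.
by rewrite pnatr_eq0 -lt0n.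
Qed.

Lemma eq_demean m n (x y : nat -> 'M[R]_(m, n)) N i : x =1 y -> demean x N i = demean y N i.
Proof. by move=> /funext ->. Qed.

Lemma mulmx_rows m n p (A : 'M[R]_(m, n)) (Q : 'M[R]_m) (B : 'M[R]_(m, p)) :
  A^T *m Q *m B = \sum_t \sum_s Q t s *: ((row t A)^T *m row s B).
Proof.
apply/matrixP => i j; rewrite -mulmxA mxE summxE; apply: eq_bigr => t _.
rewrite !mxE summxE mulr_sumr; apply: eq_bigr => s _.
by rewrite !mxE big_ord1 !mxE mulrCA.
Qed.

End demeaning.

(** * The estimators as functions of sample moments *)

Section sample.
Context {R : realType} {K m T' : nat}.
Variable S : 'I_(1 + T') -> 'M[R]_(m, K).
Variables (beta0 : 'cV[R]_K) (theta0 : 'cV[R]_m) (lambda0 : 'cV[R]_T').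
Variables (X : nat -> 'M[R]_(1 + T', K)) (z : nat -> 'cV[R]_m) (y : nat -> 'cV[R]_(1 + T')).
Variables (Xs : nat -> 'M[R]_(1 + T', K)) (zs : nat -> 'cV[R]_m) (us : nat -> 'cV[R]_(1 + T')).
Variables (EX : 'M[R]_(1 + T', K)) (Ez : 'cV[R]_m) (cy : 'cV[R]_(1 + T')).
Hypothesis X_E : forall i, X i = EX + Xs i.
Hypothesis z_E : forall i, z i = Ez + zs i.
Hypothesis Xs_row : forall i t, row t (Xs i) = (zs i)^T *m S t.
Hypothesis y_E : forall i,
  y i = X i *m beta0 + cy + loadings lambda0 *m ((zs i)^T *m theta0) + us i.
Local Notation psi0 := (col_mx (col_mx beta0 theta0) lambda0).
Local Notation D := (reduced_dev (reduced_jac S theta0 lambda0) (@reduced_cross R K m T')).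

Definition sample_var N : 'M[R]_m :=
  N%:R^-1 *: \sum_(i < N) demean zs N i *m (demean zs N i)^T.
Definition sample_score N t : 'cV[R]_m :=
  N%:R^-1 *: \sum_(i < N) demean us N i t 0 *: demean zs N i.

Lemma sample_var_sym N : (sample_var N)^T = sample_var N.
Proof.
rewrite /sample_var linearZ/= linear_sum; congr (_ *: _); apply: eq_bigr => i _.
by rewrite /= trmx_mul trmxK.
Qed.

Variable N : nat.
Hypothesis N0 : (0 < N)%N.

Let zdE i : demean z N i = demean zs N i.
Proof. by rewrite (eq_demean _ _ z_E) demeanD demean_cst// add0r. Qed.

Let XdE i : demean X N i = demean Xs N i.
Proof. by rewrite (eq_demean _ _ X_E) demeanD demean_cst// add0r. Qed.

Let Xd_row i t : row t (demean Xs N i) = (demean zs N i)^T *m S t.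
Proof.
rewrite -(demean_linear (row t)) (eq_demean _ _ (Xs_row ^~ t)).
exact: (demean_linear (mulmxr (S t) \o trmx)).
Qed.

Let ydE i : demean y N i = demean Xs N i *m beta0 +
  loadings lambda0 *m ((demean zs N i)^T *m theta0) + demean us N i.
Proof.
rewrite (eq_demean _ _ y_E) !demeanD demean_cst// addr0 -XdE; congr (_ + _ + _).
  exact: (demean_linear (mulmxr beta0)).
exact: (demean_linear (mulmx (loadings lambda0) \o mulmxr theta0 \o trmx)).
Qed.

(** After demeaning, which removes intercepts and population means, the residual of period [t] at
    [psi] is [u_t - D_t' z]. Expanding its square gives a constant, the score and the form of the
    sample variance. *)
Lemma objectiveE psi : objective y X z N psi =
  (2 * N%:R)^-1 * \sum_(i < N) \sum_t demean us N i t 0 ^+ 2 +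
  dist_crit (reduced_jac S theta0 lambda0) (@reduced_cross R K m T')
    (sample_var N) (sample_score N) (psi - psi0).
Proof.
have res i t : (demean y N i - demean X N i *m par_beta psi
      - loadings (par_lambda psi) *m (demean z N i)^T *m par_theta psi) t 0 =
    demean us N i t 0 - dotv (D (psi - psi0) t) (demean zs N i).
  rewrite (reduced_devE _ _ _ beta0) (_ : psi0 + (psi - psi0) = psi); last by rewrite addrC subrK.
  rewrite dotvC zdE XdE ydE /dotv /reduced_coef.
  rewrite /par_beta /par_theta /par_lambda !col_mxKu !col_mxKd.
  set zd := demean zs N i; set u := demean us N i.
  have XdM (b : 'cV[R]_K) : (demean Xs N i *m b) t 0 = (zd^T *m (S t *m b)) 0 0.
    by rewrite mulmxA -Xd_row -row_mul [RHS]mxE.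
  have LM (l : 'cV[R]_(1 + T')) (b : 'cV[R]_m) :
      (l *m (zd^T *m b)) t 0 = l t 0 * (zd^T *m b) 0 0.
    by rewrite mxE big_ord1.
  have addE (a b : 'cV[R]_(1 + T')) : (a + b) t 0 = a t 0 + b t 0 by rewrite mxE.
  have oppE (a : 'cV[R]_(1 + T')) : (- a) t 0 = - a t 0 by rewrite mxE.
  have addE1 (a b : 'M[R]_1) : (a + b) 0 0 = a 0 0 + b 0 0 by rewrite mxE.
  have oppE1 (a : 'M[R]_1) : (- a) 0 0 = - a 0 0 by rewrite mxE.
  have scaleE1 k (a : 'M[R]_1) : (k *: a) 0 0 = k * a 0 0 by rewrite mxE.
  rewrite -[loadings _ *m _^T *m _]mulmxA mulmxBr !mulmxDr -!scalemxAr.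
  rewrite !(addE, oppE, XdM, LM, addE1, oppE1, scaleE1).
  by ring.
have quad t x : dotv (D x t) (sample_var N *m D x t) =
    N%:R^-1 * \sum_(i < N) dotv (D x t) (demean zs N i) ^+ 2.
  rewrite -quad_dotv /sample_var -scalemxAr -scalemxAl mxE mulmx_sumr mulmx_suml summxE.
  by congr (_ * _); apply: eq_bigr => i _; rewrite rank1_quad.
have lin t x : dotv (D x t) (sample_score N t) =
    N%:R^-1 * \sum_(i < N) demean us N i t 0 * dotv (D x t) (demean zs N i).
  rewrite /sample_score dotvZr dotv_sumr.
  by congr (_ * _); apply: eq_bigr => i _; rewrite dotvZr.
rewrite /objective /dist_crit; set x := psi - psi0.
have Nn0 : N%:R != 0 :> R by rewrite pnatr_eq0 -lt0n.
under [X in _ = _ + X]eq_bigr => t _ do rewrite quad lin.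
have -> : \sum_(i < N) sqnorm (demean y N i - demean X N i *m par_beta psi
      - loadings (par_lambda psi) *m (demean z N i)^T *m par_theta psi) =
    \sum_(i < N) \sum_t (demean us N i t 0 - dotv (D x t) (demean zs N i)) ^+ 2.
  by apply: eq_bigr => i _; apply: eq_bigr => t _; rewrite res.
rewrite ![\sum_(i < N) \sum_t _]exchange_big/= !mulr_sumr -big_split/=.
apply: eq_bigr => t _; rewrite !mulr_sumr -sumrN -!big_split/=.
by apply: eq_bigr => i _; field.
Qed.

Lemma objective_minimizer A psi : is_minimizer_over A (objective y X z N) psi ->
  is_minimizer_over ((fun psi => psi - psi0) @` A)
    (dist_crit (reduced_jac S theta0 lambda0) (@reduced_cross R K m T')
      (sample_var N) (sample_score N)) (psi - psi0).
Proof.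
move=> [Apsi le]; split; first by exists psi.
by move=> _ [psi' Apsi' <-]; have := le _ Apsi'; rewrite !objectiveE lerD2l.
Qed.

(** The normal matrix is [N] times [G] and the right-hand side [N] times [G *m beta0 + w], so
    [beta0] drops out exactly once [G] is invertible. *)
Lemma twfeE (G := \sum_t \sum_s within_mx (1 + T') t s *:
      ((S t)^T *m sample_var N *m S s)) :
  G \in unitmx ->
  twfe y X N - beta0 = invmx G *m (\sum_t \sum_s within_mx (1 + T') t s *:
      ((S t)^T *m (loadings lambda0 s 0 *: (sample_var N *m theta0) + sample_score N s))).
Proof.
move=> uG; have Nn0 : N%:R != 0 :> R by rewrite pnatr_eq0 -lt0n.
have GE : \sum_(i < N) (demean X N i)^T *m within_mx (1 + T') *m demean X N i = N%:R *: G.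
  rewrite /G scaler_sumr.
  under eq_bigr => i _ do rewrite mulmx_rows.
  rewrite exchange_big/=; apply: eq_bigr => t _.
  rewrite exchange_big/= scaler_sumr; apply: eq_bigr => s _.
  rewrite -scaler_sumr !scalerA mulrC -scalerA; congr (_ *: _).
  rewrite /sample_var -scalemxAr -scalemxAl scalerA mulfV// scale1r mulmx_sumr mulmx_suml.
  by apply: eq_bigr => i _; rewrite XdE !Xd_row trmx_mul trmxK !mulmxA.
set w := \sum_t _; have wE : \sum_(i < N) (demean X N i)^T *m within_mx (1 + T') *m demean y N i =
    N%:R *: (G *m beta0 + w).
  have -> : \sum_(i < N) (demean X N i)^T *m within_mx (1 + T') *m demean y N i =
      N%:R *: G *m beta0 + \sum_(i < N) (demean X N i)^T *m within_mx (1 + T') *m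
        (loadings lambda0 *m ((demean zs N i)^T *m theta0) + demean us N i).
    rewrite -GE mulmx_suml -big_split/=; apply: eq_bigr => i _.
    by rewrite ydE -addrA XdE [LHS]mulmxDr; congr (_ + _); rewrite mulmxA.
  rewrite scalerDr scalemxAl; congr (_ + _); rewrite /w scaler_sumr.
  under eq_bigr => i _ do rewrite mulmx_rows.
  rewrite exchange_big/=; apply: eq_bigr => t _.
  rewrite exchange_big/= scaler_sumr; apply: eq_bigr => s _.
  rewrite -scaler_sumr !scalerA mulrC -scalerA; congr (_ *: _).
  rewrite /sample_var /sample_score -scalemxAl scalerA mulrC -scalerA -scalerDr -scalemxAr.
  rewrite scalerA mulfV// scale1r mulmx_suml scaler_sumr -big_split/= mulmx_sumr.
  apply: eq_bigr => i _; rewrite XdE Xd_row trmx_mul trmxK -[LHS]mulmxA.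
  rewrite -[_ *m _^T *m theta0]mulmxA; congr (_ *m _).
  rewrite [row s _]mx11_scalar mul_mx_scalar [_^T *m theta0]mx11_scalar mul_mx_scalar.
  rewrite mul_mx_scalar scalerA -scalerDl; congr (_ *: _).
  by rewrite [LHS]mxE [LHS]mxE [X in X + _]mxE mulrC.
rewrite /twfe GE wE.
have -> : invmx (N%:R *: G) = N%:R^-1 *: invmx G.
  by rewrite invmxZ// unitmxZ// unitfE.
rewrite -scalemxAl -scalemxAr scalerA mulVf// scale1r mulmxDr mulKmx//.
by rewrite addrC addKr.
Qed.

End sample.

(** * Moments of the sample *)

Section fourth_moments.
Context {d : measure_display} {T : measurableType d} {R : realType}.
Variables (P : probability T R) (q : nat) (V : nat -> T -> 'cV[R]_q).
Hypothesis V_iid : iid P V.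

(** A class closed under linear combinations whose pairwise products are square integrable, as the
    limit theorems above require of their summands. *)
Definition fourth_moment (g : 'cV[R]_q -> R) : Prop :=
  measurable_fun [set: borel_mx R q 1] (g : borel_mx R q 1 -> R) /\
  rv_int P (fun w => g (V 0%N w) ^+ 4).

Lemma fourth_moment_measurable g i : fourth_moment g ->
  measurable_fun [set: T] (fun w => g (V i w)).
Proof. by case=> mg _; exact: (iid_measurable_comp V_iid i mg). Qed.

Lemma fourth_moment_cst c : fourth_moment (fun=> c).
Proof. by split; [exact: measurable_cst|exact: rv_int_cst]. Qed.

Lemma fourth_momentD f g : fourth_moment f -> fourth_moment g ->
  fourth_moment (fun x => f x + g x).
Proof.
move=> Lf Lg; have [mf f4] := Lf; have [mg g4] := Lg.
split; first exact: measurable_funD.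
apply: le_rv_int (_ : rv_int P (fun w => 8 * (f (V 0%N w) ^+ 4 + g (V 0%N w) ^+ 4))).
- by apply: measurable_funX; apply: measurable_funD; exact: fourth_moment_measurable.
- move=> w; set x := f _; set y := g _; rewrite ger0_norm ?exprn_even_ge0//.
  have h1 : (x + y) ^+ 2 <= 2 * (x ^+ 2 + y ^+ 2) by have := sqr_ge0 (x - y); nra.
  have h2 : (x ^+ 2 + y ^+ 2) ^+ 2 <= 2 * ((x ^+ 2) ^+ 2 + (y ^+ 2) ^+ 2).
    by have := sqr_ge0 (x ^+ 2 - y ^+ 2); nra.
  rewrite -!exprM in h2; rewrite (exprM _ 2 2).
  have h3 : ((x + y) ^+ 2) ^+ 2 <= (2 * (x ^+ 2 + y ^+ 2)) ^+ 2.
    by apply: lerXn2r h1; rewrite nnegrE ?sqr_ge0// mulr_ge0// addr_ge0 ?sqr_ge0.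
  by rewrite exprMn in h3; lra.
- by apply: rv_intZ; apply: rv_intD.
Qed.

Lemma fourth_momentZ k f : fourth_moment f -> fourth_moment (fun x => k * f x).
Proof.
move=> [mf f4]; split; first by apply: measurable_funM => //; exact: measurable_cst.
have -> : (fun w => (k * f (V 0%N w)) ^+ 4) = (fun w => k ^+ 4 * f (V 0%N w) ^+ 4).
  by apply/funext => w; rewrite exprMn.
exact: rv_intZ.
Qed.

Lemma fourth_moment_sum (I : Type) (s : seq I) (f : I -> 'cV[R]_q -> R) :
  (forall i, fourth_moment (f i)) -> fourth_moment (fun x => \sum_(i <- s) f i x).
Proof.
move=> Lf; elim: s => [|i s IHs].
  rewrite (_ : (fun x => _) = (fun=> 0)); first exact: fourth_moment_cst.
  by apply/funext => x; rewrite big_nil.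
rewrite (_ : (fun x => _) = (fun x => f i x + \sum_(j <- s) f j x)); first exact: fourth_momentD.
by apply/funext => x; rewrite big_cons.
Qed.

Lemma fourth_moment_mul f g : fourth_moment f -> fourth_moment g ->
  measurable_fun [set: borel_mx R q 1] (fun x => f x * g x : R) /\
  rv_int P (fun w => (f (V 0%N w) * g (V 0%N w)) ^+ 2).
Proof.
move=> Lf Lg; have [mf f4] := Lf; have [mg g4] := Lg.
split; first exact: measurable_funM.
apply: le_rv_int (_ : rv_int P (fun w => f (V 0%N w) ^+ 4 + g (V 0%N w) ^+ 4)).
- by apply: measurable_funX; apply: measurable_funM; exact: fourth_moment_measurable.
- move=> w; rewrite ger0_norm ?sqr_ge0// exprMn !(exprM _ 2 2).
  move: (f _ ^+ 2) (g _ ^+ 2) (sqr_ge0 (f (V 0%N w))) (sqr_ge0 (g (V 0%N w))) => x y x0 y0.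
  by nra.
- exact: rv_intD.
Qed.

Lemma fourth_moment_sq f : fourth_moment f -> rv_int P (fun w => f (V 0%N w) ^+ 2).
Proof.
move=> Lf; have [_] := fourth_moment_mul Lf (fourth_moment_cst 1).
by rewrite (_ : (fun w => _) = (fun w => f (V 0%N w) ^+ 2))//; apply/funext => w; rewrite mulr1.
Qed.

Lemma fourth_moment_int f : fourth_moment f -> rv_int P (fun w => f (V 0%N w)).
Proof.
by move=> Lf; apply: rv_int_of_sq; [exact: fourth_moment_measurable|exact: fourth_moment_sq].
Qed.

Lemma fourth_moment_mul_int f g : fourth_moment f -> fourth_moment g ->
  rv_int P (fun w => f (V 0%N w) * g (V 0%N w)).
Proof.
by move=> Lf Lg; apply: rv_int_mul; [exact: fourth_moment_measurable|
  exact: fourth_moment_measurable|exact: fourth_moment_sq|exact: fourth_moment_sq].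
Qed.

Definition sample_cov (f g : 'cV[R]_q -> R) n w : R :=
  n%:R^-1 * \sum_(i < n) (f (V i w) - n%:R^-1 * \sum_(j < n) f (V j w)) *
                         (g (V i w) - n%:R^-1 * \sum_(j < n) g (V j w)).

Lemma sample_covE f g n w : (0 < n)%N -> sample_cov f g n w =
  n%:R^-1 * \sum_(i < n) (f (V i w) * g (V i w)) -
  (n%:R^-1 * \sum_(i < n) f (V i w)) * (n%:R^-1 * \sum_(i < n) g (V i w)).
Proof.
move=> n0; have Nn0 : n%:R != 0 :> R by rewrite pnatr_eq0 -lt0n.
rewrite /sample_cov; set a := n%:R^-1 * \sum_(j < n) f (V j w).
set b := n%:R^-1 * \sum_(j < n) g (V j w).
have -> : \sum_(i < n) (f (V i w) - a) * (g (V i w) - b) =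
    \sum_(i < n) (f (V i w) * g (V i w)) - b * \sum_(i < n) f (V i w)
    - a * \sum_(i < n) g (V i w) + n%:R * (a * b).
  have -> : n%:R * (a * b) = \sum_(i < n) a * b by rewrite sumr_const card_ord mulr_natl.
  rewrite !mulr_sumr -!sumrN -!big_split/=; apply: eq_bigr => i _; ring.
have -> : \sum_(i < n) f (V i w) = n%:R * a by rewrite /a mulrA mulfV ?mul1r.
have -> : \sum_(i < n) g (V i w) = n%:R * b by rewrite /b mulrA mulfV ?mul1r.
by field.
Qed.

Section centered.
Variables f g : 'cV[R]_q -> R.
Hypotheses (Lf : fourth_moment f) (Lg : fourth_moment g).
Hypotheses (f0 : \int[P]_w f (V 0%N w) = 0) (g0 : \int[P]_w g (V 0%N w) = 0).

Let mean_osmall : osmall P (fun n w => n%:R^-1 * \sum_(i < n) g (V i w)).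
Proof. by have [mg _] := Lg; exact: (iid_mean_osmall0 V_iid mg (fourth_moment_sq Lg) g0). Qed.

Let root_Obig : Obig P (fun n w => (Num.sqrt n%:R)^-1 * \sum_(i < n) f (V i w)).
Proof. by have [mf _] := Lf; exact: (iid_root_sum_Obig V_iid mf (fourth_moment_sq Lf) f0). Qed.

Let mean_f_osmall : osmall P (fun n w => n%:R^-1 * \sum_(i < n) f (V i w)).
Proof. by have [mf _] := Lf; exact: (iid_mean_osmall0 V_iid mf (fourth_moment_sq Lf) f0). Qed.

Lemma sample_cov_osmall :
  osmall P (fun n w => sample_cov f g n w - \int[P]_w (f (V 0%N w) * g (V 0%N w))).
Proof.
have [mfg fg2] := fourth_moment_mul Lf Lg.
apply: osmall_eventually (osmallD (iid_mean_osmall V_iid mfg fg2)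
  (osmallM (osmallM mean_f_osmall (Obig_cst _ (-1))) (osmall_Obig mean_osmall))) _.
by move=> n w n0; rewrite sample_covE//; ring.
Qed.

(** The two terms differ by the root of [n] times a product of two sample means: one mean is of
    order n^-1/2, the other tends to [0] in probability. *)
Lemma sample_cov_root_osmall :
  osmall P (fun n w => Num.sqrt n%:R * sample_cov f g n w -
    (Num.sqrt n%:R)^-1 * \sum_(i < n) (f (V i w) * g (V i w))).
Proof.
apply: osmall_eventually (osmallM (osmallM mean_osmall (Obig_cst _ (-1))) root_Obig) _.
move=> n w n0; rewrite sample_covE//.
have s0 : Num.sqrt n%:R != 0 :> R by rewrite gt_eqF// sqrtr_gt0 ltr0n.
have -> : n%:R^-1 = (Num.sqrt n%:R)^-1 * (Num.sqrt n%:R)^-1 :> R.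
  by rewrite -invfM -expr2 sqr_sqrtr.
by field.
Qed.

End centered.
End fourth_moments.

Section matrix_orders.
Context {d : measure_display} {T : measurableType d} {R : realType}.
Variable P : probability T R.

(** Lifts a bound that holds only close to the limit, where [|U n w| <= e], to an order in
    probability: the complementary event has vanishing probability. *)
Lemma osmall_gate e (U Y X : nat -> T -> R) : 0 < e -> osmall P U -> osmall P Y ->
  (exists N, forall n, (N <= n)%N -> {ae P, forall w, `|U n w| <= e -> `|X n w| <= `|Y n w|}) ->
  osmall P X.
Proof.
move=> e0 oU oY [N0 h] delta e' d0 e'0; rewrite (splitr delta).
have d20 : 0 < delta / 2 by rewrite divr_gt0.
have [N1 h1] := oU _ _ d20 e0; have [N2 h2] := oY _ _ d20 e'0.
exists (maxn N0 (maxn N1 N2)) => n; rewrite !geq_max => /and3P[n0 n1 n2].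
have [A1 [mA1 PA1 A1P]] := h1 _ n1; have [A2 [mA2 PA2 A2P]] := h2 _ n2.
have [B [mB PB BP]] := h _ n0.
exists (B `|` (A1 `|` A2)); split; first by do !apply: measurableU.
  rewrite EFinD (le_trans (measureU2 _ _ _))//; first exact: measurableU.
  rewrite [X in (X + _ <= _)%E]PB add0e (le_trans (measureU2 _ _ _))//.
  exact: leeD.
move=> w /not_orP[nB /not_orP[nA1 nA2]]; apply: le_trans (A2P w nA2).
apply: contrapT => nle; apply: nB; apply: BP => /(_ (A1P w nA1)) XY.
exact: nle.
Qed.

Lemma osmall_mxD m n (A B : nat -> T -> 'M[R]_(m, n)) :
  osmall P (fun k w => `|A k w|) -> osmall P (fun k w => `|B k w|) ->
  osmall P (fun k w => `|A k w + B k w|).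
Proof.
move=> oA oB; apply: le_osmall (osmallD oA oB) _ => k w.
by rewrite normr_id [leRHS]ger0_norm ?addr_ge0// ler_normD.
Qed.

Lemma Obig_mxD m n (A B : nat -> T -> 'M[R]_(m, n)) :
  Obig P (fun k w => `|A k w|) -> Obig P (fun k w => `|B k w|) ->
  Obig P (fun k w => `|A k w + B k w|).
Proof.
move=> oA oB; apply: le_Obig (ObigD oA oB) _ => k w.
by rewrite normr_id [leRHS]ger0_norm ?addr_ge0// ler_normD.
Qed.

Lemma osmall_mx_sum (I : Type) (s : seq I) m n (A : I -> nat -> T -> 'M[R]_(m, n)) :
  (forall i, osmall P (fun k w => `|A i k w|)) ->
  osmall P (fun k w => `|\sum_(i <- s) A i k w|).
Proof.
move=> oA; apply: le_osmall (osmall_sum s oA) _ => k w.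
by rewrite normr_id [leRHS]ger0_norm ?sumr_ge0// ler_norm_sum.
Qed.

Lemma osmall_mxMl m n p (B : 'M[R]_(p, m)) (A : nat -> T -> 'M[R]_(m, n)) :
  osmall P (fun k w => `|A k w|) -> osmall P (fun k w => `|B *m A k w|).
Proof.
move=> oA; apply: le_osmall (osmallM oA (Obig_cst P (m%:R * `|B|))) _ => k w.
by rewrite normr_id mulrC ger0_norm ?mulr_ge0// ler_norm_mulmx.
Qed.

Lemma osmall_mxMr m n p (B : 'M[R]_(n, p)) (A : nat -> T -> 'M[R]_(m, n)) :
  osmall P (fun k w => `|A k w|) -> osmall P (fun k w => `|A k w *m B|).
Proof.
move=> oA; apply: le_osmall (osmallM oA (Obig_cst P (n%:R * `|B|))) _ => k w.
rewrite normr_id ger0_norm ?mulr_ge0// (le_trans (ler_norm_mulmx _ _))//.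
by rewrite mulrCA mulrA.
Qed.

Lemma osmall_mxZ m n (c : R) (A : nat -> T -> 'M[R]_(m, n)) :
  osmall P (fun k w => `|A k w|) -> osmall P (fun k w => `|c *: A k w|).
Proof.
move=> oA; apply: le_osmall (osmallM oA (Obig_cst P c)) _ => k w.
by rewrite normr_id mx_normZ normrM normr_id mulrC.
Qed.

Lemma ler_norm_col_mx m1 m2 n (A : 'M[R]_(m1, n)) (B : 'M[R]_(m2, n)) :
  `|col_mx A B| <= `|A| + `|B|.
Proof.
apply: mx_norm_le => [|i j]; first exact: addr_ge0.
rewrite mxE; case: (fintype.split i) => k.
  by rewrite (le_trans (ler_mx_norm _ _ _))// lerDl.
by rewrite (le_trans (ler_mx_norm _ _ _))// lerDr.
Qed.

Lemma ler_norm_dsubmx m1 m2 n (A : 'M[R]_(m1 + m2, n)) : `|dsubmx A| <= `|A|.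
Proof. by apply: mx_norm_le => // i j; rewrite mxE ler_mx_norm. Qed.

End matrix_orders.

Section square_moments.
Context {d : measure_display} {T : measurableType d} {R : realType}.
Variables (P : probability T R) (q : nat) (V : nat -> T -> 'cV[R]_q).
Hypothesis V_iid : iid P V.

Definition square_moment (g : 'cV[R]_q -> R) : Prop :=
  measurable_fun [set: borel_mx R q 1] (g : borel_mx R q 1 -> R) /\
  rv_int P (fun w => g (V 0%N w) ^+ 2).

Lemma square_momentD f g : square_moment f -> square_moment g ->
  square_moment (fun x => f x + g x).
Proof.
move=> [mf f2] [mg g2]; split; first exact: measurable_funD.
apply: le_rv_int (_ : rv_int P (fun w => 2 * (f (V 0%N w) ^+ 2 + g (V 0%N w) ^+ 2))).
- apply: measurable_funX; apply: measurable_funD; exact: (iid_measurable_comp V_iid).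
- move=> w; set x := f _; set y := g _; rewrite ger0_norm ?sqr_ge0//.
  by have := sqr_ge0 (x - y); nra.
- by apply: rv_intZ; apply: rv_intD.
Qed.

Lemma square_momentZ k f : square_moment f -> square_moment (fun x => k * f x).
Proof.
move=> [mf f2]; split; first by apply: measurable_funM => //; exact: measurable_cst.
have -> : (fun w => (k * f (V 0%N w)) ^+ 2) = (fun w => k ^+ 2 * f (V 0%N w) ^+ 2).
  by apply/funext => w; rewrite exprMn.
exact: rv_intZ.
Qed.

Lemma square_moment_sum (I : Type) (s : seq I) (f : I -> 'cV[R]_q -> R) :
  (forall i, square_moment (f i)) -> square_moment (fun x => \sum_(i <- s) f i x).
Proof.
move=> Lf; elim: s => [|i s IHs].
  rewrite (_ : (fun x => _) = (fun=> 0)).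
    by split; [exact: measurable_cst|exact: rv_int_cst].
  by apply/funext => x; rewrite big_nil.
rewrite (_ : (fun x => _) = (fun x => f i x + \sum_(j <- s) f j x)); first exact: square_momentD.
by apply/funext => x; rewrite big_cons.
Qed.

End square_moments.

(** * Joint asymptotics of the two estimators *)

Section joint_asymptotics.
Context {d : measure_display} {T : measurableType d} {R : realType}.
Variables (P : probability T R) (q K m T' : nat) (V : nat -> T -> 'cV[R]_q).
Hypothesis V_iid : iid P V.
Variables (fz : 'cV[R]_q -> 'cV[R]_m) (fu : 'cV[R]_q -> 'cV[R]_(1 + T')).
Hypothesis Lz : forall k, fourth_moment P V (fun x => fz x k 0).
Hypothesis Lu : forall t, fourth_moment P V (fun x => fu x t 0).
Hypothesis z0 : forall k, \int[P]_w fz (V 0%N w) k 0 = 0.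
Hypothesis u0 : forall t, \int[P]_w fu (V 0%N w) t 0 = 0.
Hypothesis uz0 : forall t k, \int[P]_w (fu (V 0%N w) t 0 * fz (V 0%N w) k 0) = 0.
Let M : 'M[R]_m := \matrix_(j, k) \int[P]_w (fz (V 0%N w) j 0 * fz (V 0%N w) k 0).
Variable S : 'I_(1 + T') -> 'M[R]_(m, K).
Variables (theta0 : 'cV[R]_m) (lambda0 : 'cV[R]_T').
Local Notation J := (reduced_jac S theta0 lambda0).
Local Notation Q := (within_mx (1 + T')).
Local Notation L0 := (loadings lambda0).
Local Notation Mn n w := (sample_var (fun i => fz (V i w)) n).
Local Notation Nn n w := (sample_score (fun i => fz (V i w)) (fun i => fu (V i w)) n).

(** At [M] this is the mean of [X'QX] for centred [X], and at the sample variance its empirical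
    counterpart. *)
Definition within_form (B : 'M[R]_m) : 'M[R]_K :=
  \sum_t \sum_s Q t s *: ((S t)^T *m B *m S s).
Definition within_score (B : 'M[R]_m) (N : 'I_(1 + T') -> 'cV[R]_m) : 'cV[R]_K :=
  \sum_t \sum_s Q t s *: ((S t)^T *m (L0 s 0 *: (B *m theta0) + N s)).
(** Almost surely the summand [R+' u+], written through the centred [z] and [u] so that it is a
    function of [v] alone. *)
Definition joint_score (x : 'cV[R]_q) : 'cV[R]_((K + m + T') + K) :=
  col_mx (\sum_t (J t)^T *m (fu x t 0 *: fz x))
    (within_score (fz x *m (fz x)^T) (fun s => fu x s 0 *: fz x)).

(** The limit of the right-hand side of the TWFE equations; its vanishing is where (A) or (B) will
    enter. *)
Hypothesis within_score0 : within_score M (fun=> 0) = 0.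

Let Wz n w : 'M[R]_m :=
  (Num.sqrt n%:R)^-1 *: \sum_(i < n) fz (V i w) *m (fz (V i w))^T.
Let Wu n w t : 'cV[R]_m :=
  (Num.sqrt n%:R)^-1 *: \sum_(i < n) fu (V i w) t 0 *: fz (V i w).
Let W n w := (Num.sqrt n%:R)^-1 *: \sum_(i < n) joint_score (V i w).

Lemma within_scoreD B1 B2 N1 N2 :
  within_score (B1 + B2) (fun t => N1 t + N2 t) = within_score B1 N1 + within_score B2 N2.
Proof.
rewrite -big_split/=; apply: eq_bigr => t _; rewrite -big_split/=; apply: eq_bigr => s _.
by rewrite -scalerDr -mulmxDr mulmxDl scalerDr addrACA.
Qed.

Lemma within_scoreZ k B N :
  within_score (k *: B) (fun t => k *: N t) = k *: within_score B N.
Proof.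
rewrite scaler_sumr; apply: eq_bigr => t _; rewrite scaler_sumr; apply: eq_bigr => s _.
have -> : L0 s 0 *: (k *: B *m theta0) + k *: N s = k *: (L0 s 0 *: (B *m theta0) + N s).
  by rewrite -scalemxAl scalerDr !scalerA [k * _]mulrC.
by rewrite -scalemxAr !scalerA mulrC.
Qed.

Lemma within_score_sum n (B : 'I_n -> 'M[R]_m) N :
  within_score (\sum_i B i) (fun t => \sum_i N i t) = \sum_i within_score (B i) (N i).
Proof.
elim: n B N => [|n IHn] B N.
  rewrite [RHS]big_ord0 big_ord0 -[RHS](scale0r (within_score 0 (fun=> 0))) -within_scoreZ scale0r.
  by congr within_score; apply/funext => t; rewrite scale0r big_ord0.
rewrite !big_ord_recl -IHn -within_scoreD; congr within_score.
by apply/funext => t; rewrite big_ord_recl.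
Qed.

(** [within_score] is jointly linear in its two arguments, so the normalized sum passes inside. *)
Let WE n w : W n w = col_mx (\sum_t (J t)^T *m Wu n w t) (within_score (Wz n w) (Wu n w)).
Proof.
rewrite /W /Wz /Wu within_scoreZ within_score_sum.
have -> : \sum_(i < n) joint_score (V i w) =
    col_mx (\sum_t (J t)^T *m \sum_(i < n) (fu (V i w) t 0 *: fz (V i w)))
     (\sum_(i < n) within_score (fz (V i w) *m (fz (V i w))^T)
        (fun s => fu (V i w) s 0 *: fz (V i w))).
  rewrite -[LHS]vsubmxK !linear_sum/=; congr col_mx.
    under [RHS]eq_bigr => t _ do rewrite mulmx_sumr.
    by rewrite exchange_big/=; apply: eq_bigr => i _; rewrite col_mxKu.
  by apply: eq_bigr => i _; rewrite col_mxKd.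
rewrite scale_col_mx; congr col_mx.
by rewrite scaler_sumr; apply: eq_bigr => t _; rewrite -scalemxAr.
Qed.

Let sq_uz t k : square_moment P V (fun x => fu x t 0 * fz x k 0).
Proof. exact: (fourth_moment_mul V_iid (Lu t) (Lz k)). Qed.
Let sq_zz j k : square_moment P V (fun x => fz x j 0 * fz x k 0).
Proof. exact: (fourth_moment_mul V_iid (Lz j) (Lz k)). Qed.

Let joint_scoreEu x j : joint_score x (lshift K j) 0 =
  \sum_t \sum_k (J t k j * (fu x t 0 * fz x k 0)).
Proof.
rewrite col_mxEu summxE; apply: eq_bigr => t _; rewrite mxE; apply: eq_bigr => k _.
by rewrite !mxE.
Qed.

Let joint_scoreEd x j : joint_score x (rshift (K + m + T') j) 0 =
  \sum_t \sum_s \sum_k (Q t s * S t k j *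
    (L0 s 0 * (\sum_l theta0 l 0 * (fz x k 0 * fz x l 0)) + fu x s 0 * fz x k 0)).
Proof.
rewrite col_mxEd summxE; apply: eq_bigr => t _; rewrite summxE; apply: eq_bigr => s _.
rewrite mxE [X in _ * X]mxE mulr_sumr; apply: eq_bigr => k _.
rewrite -mulrA [_^T _ _]mxE; congr (_ * (_ * _)).
rewrite [LHS]mxE [X in X + _]mxE [X in _ + X]mxE; congr (_ * _ + _).
rewrite [LHS]mxE; apply: eq_bigr => l _.
by rewrite mxE big_ord1 !mxE mulrC.
Qed.

Lemma joint_score_square j : square_moment P V (fun x => joint_score x j 0).
Proof.
rewrite -[j]splitK; case: (fintype.split j) => k /=.
  rewrite (funext (fun x => joint_scoreEu x k)).
  apply: (square_moment_sum V_iid) => t; apply: (square_moment_sum V_iid) => l.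
  exact: (square_momentZ _ (sq_uz t l)).
rewrite (funext (fun x => joint_scoreEd x k)).
apply: (square_moment_sum V_iid) => t; apply: (square_moment_sum V_iid) => s.
apply: (square_moment_sum V_iid) => l; apply: square_momentZ.
apply: (square_momentD V_iid (square_momentZ _ _) (sq_uz s l)).
apply: (square_moment_sum V_iid) => l'.
exact: (square_momentZ _ (sq_zz l l')).
Qed.

Let izz j k : rv_int P (fun w => fz (V 0%N w) j 0 * fz (V 0%N w) k 0).
Proof. exact: (fourth_moment_mul_int V_iid (Lz j) (Lz k)). Qed.
Let iuz t k : rv_int P (fun w => fu (V 0%N w) t 0 * fz (V 0%N w) k 0).
Proof. exact: (fourth_moment_mul_int V_iid (Lu t) (Lz k)). Qed.

Lemma joint_score_mean j : \int[P]_w joint_score (V 0%N w) j 0 = 0.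
Proof.
rewrite -[j]splitK; case: (fintype.split j) => k /=.
  rewrite (funext (fun w => joint_scoreEu (V 0%N w) k)).
  rewrite ex_sum => [|t]; last by apply: rv_int_sum => l; apply: rv_intZ.
  rewrite big1// => t _; rewrite ex_sum => [|l]; last by apply: rv_intZ.
  by rewrite big1// => l _; rewrite exZ// uz0 mulr0.
rewrite (funext (fun w => joint_scoreEd (V 0%N w) k)).
have i1 s l : rv_int P (fun w => L0 s 0 * (\sum_j theta0 j 0 * (fz (V 0%N w) l 0 * fz (V 0%N w) j 0))).
  by apply: rv_intZ; apply: rv_int_sum => l'; apply: rv_intZ.
have i2 t s l : rv_int P (fun w => Q t s * S t l k *
    (L0 s 0 * (\sum_j theta0 j 0 * (fz (V 0%N w) l 0 * fz (V 0%N w) j 0)) +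
     fu (V 0%N w) s 0 * fz (V 0%N w) l 0)).
  by apply: rv_intZ; apply: rv_intD.
have i3 t s : rv_int P (fun w => \sum_l (Q t s * S t l k *
    (L0 s 0 * (\sum_j theta0 j 0 * (fz (V 0%N w) l 0 * fz (V 0%N w) j 0)) +
     fu (V 0%N w) s 0 * fz (V 0%N w) l 0))).
  by apply: rv_int_sum => l.
rewrite ex_sum => [|t]; last by apply: rv_int_sum => s.
(* The terms in [fu] have mean zero, so the mean of the TWFE half is [within_score] at the
   population moments. *)
transitivity (within_score M (fun=> 0) k 0); last by rewrite within_score0 mxE.
rewrite summxE; apply: eq_bigr => t _; rewrite ex_sum// summxE; apply: eq_bigr => s _.
rewrite ex_sum// [RHS]mxE [X in _ = _ * X]mxE mulr_sumr; apply: eq_bigr => l _.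
rewrite exZ; last by apply: rv_intD.
rewrite exD// uz0 addr0 exZ; last by apply: rv_int_sum => l'; apply: rv_intZ.
rewrite ex_sum => [|l']; last by apply: rv_intZ.
rewrite -mulrA [_^T _ _]mxE addr0 [X in _ = _ * (_ * X)]mxE [X in _ = _ * (_ * (_ * X))]mxE.
by congr (_ * (_ * (_ * _))); apply: eq_bigr => l' _; rewrite exZ// [RHS]mulrC mxE.
Qed.

Let W_Obig : Obig P (fun n w => `|W n w|).
Proof.
apply: Obig_mx => i j; rewrite ord1.
have [mg g2] := joint_score_square i.
apply: le_Obig (iid_root_sum_Obig V_iid mg g2 (joint_score_mean i)) _ => n w.
by rewrite /W mxE summxE.
Qed.


Let demeanE p (f : 'cV[R]_q -> 'cV[R]_p) n i w k :
  demean (fun i => f (V i w)) n i k 0 =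
  f (V i w) k 0 - n%:R^-1 * \sum_(j < n) f (V j w) k 0.
Proof. by rewrite /demean !mxE summxE. Qed.

Let sample_varE n w j k :
  Mn n w j k = sample_cov V (fun x => fz x j 0) (fun x => fz x k 0) n w.
Proof.
rewrite /sample_var mxE summxE; congr (_ * _); apply: eq_bigr => i _.
by rewrite mxE big_ord1 [X in _ * X]mxE !demeanE.
Qed.

Let sample_scoreE n w t k :
  Nn n w t k 0 = sample_cov V (fun x => fu x t 0) (fun x => fz x k 0) n w.
Proof.
rewrite /sample_score mxE summxE; congr (_ * _); apply: eq_bigr => i _.
by rewrite mxE !demeanE.
Qed.

Let var_osmall : osmall P (fun n w => `|Mn n w - M|).
Proof.
apply: osmall_mx => j k; apply: le_osmall (sample_cov_osmall V_iid (Lz j) (Lz k) (z0 j) (z0 k)) _.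
by move=> n w; rewrite mxE [X in _ + X]mxE sample_varE [M _ _]mxE.
Qed.

Let score_osmall t : osmall P (fun n w => `|Nn n w t|).
Proof.
apply: osmall_mx => k i; rewrite ord1.
apply: le_osmall (sample_cov_osmall V_iid (Lu t) (Lz k) (u0 t) (z0 k)) _.
by move=> n w; rewrite sample_scoreE uz0 subr0.
Qed.

Let root_var_osmall : osmall P (fun n w => `|Num.sqrt n%:R *: Mn n w - Wz n w|).
Proof.
apply: osmall_mx => j k.
apply: le_osmall (sample_cov_root_osmall V_iid (Lz j) (Lz k) (z0 j) (z0 k)) _ => n w.
rewrite mxE [X in X + _]mxE [X in _ + X]mxE sample_varE [Wz _ _ _ _]mxE summxE.
rewrite (eq_bigr (fun i : 'I_n => fz (V i w) j 0 * fz (V i w) k 0))// => i _.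
by rewrite mxE big_ord1 [X in _ * X]mxE.
Qed.

Let root_score_osmall t : osmall P (fun n w => `|Num.sqrt n%:R *: Nn n w t - Wu n w t|).
Proof.
apply: osmall_mx => k i; rewrite ord1.
apply: le_osmall (sample_cov_root_osmall V_iid (Lu t) (Lz k) (u0 t) (z0 k)) _ => n w.
rewrite mxE [X in X + _]mxE [X in _ + X]mxE sample_scoreE [Wu _ _ _ _ _]mxE summxE.
by rewrite (eq_bigr (fun i : 'I_n => fu (V i w) t 0 * fz (V i w) k 0))// => i' _; rewrite mxE.
Qed.

Let root_score_Obig t : Obig P (fun n w => `|Num.sqrt n%:R *: Nn n w t|).
Proof.
have Wu_Obig : Obig P (fun n w => `|Wu n w t|).
  apply: Obig_mx => k i; rewrite ord1; have [mg g2] := sq_uz t k.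
  apply: le_Obig (iid_root_sum_Obig V_iid mg g2 (uz0 t k)) _ => n w.
  rewrite [Wu _ _ _ _ _]mxE summxE.
  by rewrite (eq_bigr (fun i : 'I_n => fu (V i w) t 0 * fz (V i w) k 0))// => i' _; rewrite mxE.
apply: le_Obig (Obig_mxD (osmall_Obig (root_score_osmall t)) Wu_Obig) _ => n w.
by rewrite subrK.
Qed.

Let within_osmall : osmall P (fun n w => `|within_form (Mn n w) - within_form M|).
Proof.
have -> : (fun n w => `|within_form (Mn n w) - within_form M|) =
    (fun n w => `|\sum_t \sum_s Q t s *: ((S t)^T *m (Mn n w - M) *m S s)|).
  apply/funext => n; apply/funext => w; congr (`|_|).
  rewrite /within_form -sumrB; apply: eq_bigr => t _; rewrite -sumrB; apply: eq_bigr => s _.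
  by rewrite mulmxBr mulmxBl scalerBr.
apply: osmall_mx_sum => t; apply: osmall_mx_sum => s; apply: osmall_mxZ.
by apply: osmall_mxMr; exact: osmall_mxMl.
Qed.

Let root_within_osmall : osmall P (fun n w =>
  `|Num.sqrt n%:R *: within_score (Mn n w) (Nn n w) - within_score (Wz n w) (Wu n w)|).
Proof.
have -> : (fun n w => `|Num.sqrt n%:R *: within_score (Mn n w) (Nn n w) -
      within_score (Wz n w) (Wu n w)|) = (fun n w => `|\sum_t \sum_s Q t s *: ((S t)^T *m
      (L0 s 0 *: ((Num.sqrt n%:R *: Mn n w - Wz n w) *m theta0) +
       (Num.sqrt n%:R *: Nn n w s - Wu n w s)))|).
  apply/funext => n; apply/funext => w; congr (`|_|).
  rewrite -within_scoreZ -[- within_score _ _]scaleN1r -within_scoreZ -within_scoreD.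
  congr (within_score _ _); first by rewrite scaleN1r.
  by apply/funext => t; rewrite scaleN1r.
apply: osmall_mx_sum => t; apply: osmall_mx_sum => s; apply: osmall_mxZ.
apply: osmall_mxMl; apply: osmall_mxD => //.
by apply: osmall_mxZ; exact: osmall_mxMr.
Qed.

Let root_within_Obig : Obig P (fun n w =>
  `|Num.sqrt n%:R *: within_score (Mn n w) (Nn n w)|).
Proof.
have W2 : Obig P (fun n w => `|within_score (Wz n w) (Wu n w)|).
  apply: le_Obig W_Obig _ => n w; rewrite !normr_id WE.
  by rewrite -[X in `|X| <= _](col_mxKd (\sum_t (J t)^T *m Wu n w t)) ler_norm_dsubmx.
apply: le_Obig (Obig_mxD (osmall_Obig root_within_osmall) W2) _ => n w.
by rewrite subrK.
Qed.

Hypothesis pM : pos_def M.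
Let H0 := \sum_t (J t)^T *m M *m J t.
Hypothesis uH0 : H0 \in unitmx.
Hypothesis uG0 : within_form M \in unitmx.
Variable A : set 'cV[R]_(K + m + T').
Hypothesis cA : compact A.
Hypothesis A0 : interior A 0.
Hypothesis ident : forall x, A x -> x != 0 ->
  exists t, reduced_dev J (@reduced_cross R K m T') x t != 0.
Variables (xhat : nat -> T -> 'cV[R]_(K + m + T')) (bhat : nat -> T -> 'cV[R]_K).
Hypothesis xhat_meas : forall n, measurable_mx (xhat n).
Hypothesis bhat_meas : forall n, measurable_mx (bhat n).
Hypothesis xhat_min : forall n, (0 < n)%N -> {ae P, forall w,
  is_minimizer_over A (dist_crit J (@reduced_cross R K m T') (Mn n w) (Nn n w)) (xhat n w)}.
Hypothesis bhat_sol : forall n, (0 < n)%N -> {ae P, forall w,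
  within_form (Mn n w) \in unitmx ->
  bhat n w = invmx (within_form (Mn n w)) *m within_score (Mn n w) (Nn n w)}.

(** The remainder [r * (r + |Mn - M|)] times the root of [n] tends to [0] in probability, because
    [r] times the root of [n] is already bounded in probability. The same sum [r + |Mn - M|] serves
    as the gate. *)
Let xhat_osmall : osmall P (fun n w =>
  `|H0 *m (Num.sqrt n%:R *: xhat n w) - \sum_t (J t)^T *m Wu n w t|).
Proof.
have [C [e [C0 e0 HC]]] := minimum_distance_expansion (@reduced_crossDl R K m T')
  (@reduced_crossDr R K m T') (@reduced_crossZl R K m T') (@reduced_crossZr R K m T')
  (@reduced_cross_le R K m T') pM uH0 cA A0 (@reduced_dev_continuous R K m T' S theta0 lambda0) ident.
pose r n w := \sum_t `|Nn n w t|.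
have r_osmall : osmall P r by apply: osmall_sum => t; exact: score_osmall.
have r0 n w : 0 <= r n w by exact: sumr_ge0.
have main : osmall P (fun n w =>
    `|H0 *m (Num.sqrt n%:R *: xhat n w) - \sum_t (J t)^T *m (Num.sqrt n%:R *: Nn n w t)|).
  have gate_osmall := osmallD r_osmall var_osmall.
  have root_r : Obig P (fun n w => \sum_t `|Num.sqrt n%:R *: Nn n w t|).
    by apply: Obig_sum => t; exact: root_score_Obig.
  have bound_osmall := osmallM gate_osmall (ObigM (Obig_cst P C) root_r).
  apply: osmall_gate e0 gate_osmall bound_osmall _.
  exists 1%N => n n0; apply: filterS (xhat_min n0) => w xmin.
  rewrite normr_id ger0_norm ?addr_ge0// => le_e.
  have le1 : `|Mn n w - M| <= e by apply: le_trans le_e; rewrite lerDr.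
  have le2 : r n w <= e by apply: le_trans le_e; rewrite lerDl.
  have := HC _ _ _ (r n w) (sample_var_sym _ n) xmin le1 (r0 n w) _ le2.
  have Nr t : `|Nn n w t| <= r n w.
    by rewrite /r (bigD1 t)//= lerDl sumr_ge0.
  move=> /(_ Nr) bnd.
  have -> : H0 *m (Num.sqrt n%:R *: xhat n w) - \sum_t (J t)^T *m (Num.sqrt n%:R *: Nn n w t) =
      Num.sqrt n%:R *: (H0 *m xhat n w - \sum_t (J t)^T *m Nn n w t).
    rewrite scalerBr -scalemxAr scaler_sumr; congr (_ - _).
    by apply: eq_bigr => t _; rewrite -scalemxAr.
  rewrite mx_normZ (ger0_norm (sqrtr_ge0 _)).
  apply: (@le_trans _ _ (Num.sqrt n%:R * (C * r n w * (r n w + `|Mn n w - M|)))).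
    by rewrite ler_wpM2l.
  rewrite ger0_norm; last first.
    by rewrite !mulr_ge0 ?addr_ge0 ?(ltW C0)// sumr_ge0.
  have -> : \sum_t `|Num.sqrt n%:R *: Nn n w t| = Num.sqrt n%:R * r n w.
    by rewrite mulr_sumr; apply: eq_bigr => t _; rewrite mx_normZ (ger0_norm (sqrtr_ge0 _)).
  by rewrite le_eqVlt; apply/orP; left; apply/eqP; ring.
have rest : osmall P (fun n w => `|\sum_t (J t)^T *m (Num.sqrt n%:R *: Nn n w t - Wu n w t)|).
  by apply: osmall_mx_sum => t; apply: osmall_mxMl; exact: root_score_osmall.
apply: le_osmall (osmall_mxD main rest) _ => n w; rewrite !normr_id.
rewrite (_ : \sum_t (J t)^T *m (Num.sqrt n%:R *: Nn n w t - Wu n w t) =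
  \sum_t (J t)^T *m (Num.sqrt n%:R *: Nn n w t) - \sum_t (J t)^T *m Wu n w t).
  by rewrite addrA subrK.
by rewrite -sumrB; apply: eq_bigr => t _; rewrite mulmxBr.
Qed.

(** The sample matrix is invertible with probability tending to one, and replacing its inverse by
    that of the limit costs a product of an o_P(1) and an O_P(1) term. *)
Let bhat_osmall : osmall P (fun n w =>
  `|within_form M *m (Num.sqrt n%:R *: bhat n w) - within_score (Wz n w) (Wu n w)|).
Proof.
have [C [e [C0 e0 HC]]] := inverse_perturbation uG0.
have main : osmall P (fun n w => `|within_form M *m (Num.sqrt n%:R *: bhat n w) -
    Num.sqrt n%:R *: within_score (Mn n w) (Nn n w)|).
  have bound_osmall := osmallM within_osmall (ObigM (Obig_cst P C) root_within_Obig).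
  apply: osmall_gate e0 within_osmall bound_osmall _.
  exists 1%N => n n0; apply: filterS (bhat_sol n0) => w bsol.
  rewrite !normr_id => le_e.
  have [uGn bnd] := HC _ (Num.sqrt n%:R *: within_score (Mn n w) (Nn n w)) le_e.
  rewrite bsol// scalemxAr (le_trans bnd)// ger0_norm ?mulr_ge0 ?(ltW C0)//.
  by rewrite mulrCA mulrA.
apply: le_osmall (osmall_mxD main root_within_osmall) _ => n w; rewrite !normr_id.
by rewrite addrA subrK.
Qed.

Lemma joint_asymptotic_normality :
  cvg_to_normal P (fun n w => Num.sqrt n%:R *: col_mx (xhat n w) (bhat n w)) 0
    (invmx (block_mx H0 0 0 (within_form M)) *m
     (\matrix_(j, k) \int[P]_w (joint_score (V 0%N w) j 0 * joint_score (V 0%N w) k 0)) *m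
     (invmx (block_mx H0 0 0 (within_form M)))^T).
Proof.
set Hj := block_mx _ _ _ _.
have uHj : Hj \in unitmx by rewrite unitmxE det_ublock unitrM -!unitmxE uH0.
have HZ : osmall P (fun n w => `|Hj *m (Num.sqrt n%:R *: col_mx (xhat n w) (bhat n w)) - W n w|).
  apply: le_osmall (osmallD xhat_osmall bhat_osmall) _ => n w.
  rewrite normr_id [leRHS]ger0_norm ?addr_ge0// WE scale_col_mx mul_block_col !mul0mx.
  by rewrite addr0 add0r opp_col_mx add_col_mx ler_norm_col_mx.
have mZ n : measurable_mx (fun w => Num.sqrt n%:R *: col_mx (xhat n w) (bhat n w)).
  by apply: measurable_mx_scale; [exact: measurable_cst|exact: measurable_mx_col].
apply: (@cvg_to_normal_linear _ _ _ P _ _ V V_iid joint_score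
  (fun j => (joint_score_square j).1) (fun j => (joint_score_square j).2)
  joint_score_mean _ (invmx Hj) mZ).
apply: le_osmall (osmall_mxMl (invmx Hj) HZ) _ => n w.
by rewrite !normr_id mulmxBr mulKmx.
Qed.

End joint_asymptotics.

(** * The within projection and moments of random matrices *)

Section within_transformation.
Context {R : realType} {n : nat}.
Local Notation Q := (within_mx n.+1 : 'M[R]_n.+1).
Local Notation o := (ones_vec n.+1 : 'cV[R]_n.+1).

Let ones_unit : o^T *m o \in unitmx.
Proof.
rewrite unitmxE det_mx11 unitfE mxE.
under eq_bigr do rewrite !mxE mulr1.
by rewrite sumr_const card_ord pnatr_eq0.
Qed.

Lemma within_mx_ones : Q *m o = 0.
Proof. by rewrite /within_mx mulmxBl mul1mx -!mulmxA mulVmx// mulmx1 subrr. Qed.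

Lemma within_mx_sym : Q^T = Q.
Proof.
rewrite /within_mx linearB/= trmx1 !trmx_mul trmxK trmx_inv trmx_mul trmxK.
by rewrite mulmxA.
Qed.

Lemma within_mx_idem : Q *m Q = Q.
Proof. by rewrite {2}/within_mx mulmxBr mulmx1 !mulmxA within_mx_ones !mul0mx subr0. Qed.

Lemma within_mx_row_sum t : \sum_s Q t s = 0.
Proof.
transitivity ((Q *m o) t 0); last by rewrite within_mx_ones mxE.
by rewrite [RHS]mxE; apply: eq_bigr => s _; rewrite [ones_vec _ _ _]mxE mulr1.
Qed.

Lemma within_mx_col_sum s : \sum_t Q t s = 0.
Proof.
transitivity (\sum_t Q s t); last exact: within_mx_row_sum.
by apply: eq_bigr => t _; rewrite -[in LHS]within_mx_sym mxE.
Qed.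

End within_transformation.

Lemma trmx_mul_rows (R : realType) m n p (A : 'M[R]_(m, n)) (B : 'M[R]_(m, p)) :
  A^T *m B = \sum_t (row t A)^T *m row t B.
Proof.
apply/matrixP => i j; rewrite mxE summxE; apply: eq_bigr => t _.
by rewrite !mxE big_ord1 !mxE.
Qed.

Lemma regressor_mxB (R : realType) K m T' (X X' : 'M[R]_(1 + T', K)) (z z' : 'cV[R]_m) theta0 lambda0 :
  regressor_mx X z theta0 lambda0 - regressor_mx X' z' theta0 lambda0 =
  regressor_mx (X - X') (z - z') theta0 lambda0.
Proof.
rewrite /regressor_mx opp_block_mx add_block_mx !opp_row_mx !add_row_mx subr0.
have -> : (z - z')^T = z^T - z'^T by rewrite linearB.
rewrite mulmxBr mulmxBl [usubmx (_ - _)]linearB [dsubmx (_ - _)]linearB; congr block_mx.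
by apply/matrixP => i j; rewrite !mxE mulrnBl.
Qed.

Section measurable_blocks.
Context {d : measure_display} {T : measurableType d} {R : realType}.

Lemma measurable_mx_row m n1 n2 (A : T -> 'M[R]_(m, n1)) (B : T -> 'M[R]_(m, n2)) :
  measurable_mx A -> measurable_mx B -> measurable_mx (fun w => row_mx (A w) (B w)).
Proof.
move=> mA mB; apply: measurable_mx_coords => i j.
rewrite -[j]splitK; case: (fintype.split j) => k /=.
  by under eq_fun do rewrite row_mxEl; exact: measurable_mx_coord.
by under eq_fun do rewrite row_mxEr; exact: measurable_mx_coord.
Qed.

Lemma measurable_mx_usub m1 m2 n (A : T -> 'M[R]_(m1 + m2, n)) :
  measurable_mx A -> measurable_mx (fun w => usubmx (A w)).
Proof.
move=> mA; apply: measurable_mx_coords => i j.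
by under eq_fun do rewrite mxE; exact: measurable_mx_coord.
Qed.

Lemma measurable_mx_dsub m1 m2 n (A : T -> 'M[R]_(m1 + m2, n)) :
  measurable_mx A -> measurable_mx (fun w => dsubmx (A w)).
Proof.
move=> mA; apply: measurable_mx_coords => i j.
by under eq_fun do rewrite mxE; exact: measurable_mx_coord.
Qed.

Lemma measurable_mx_demean m n (x : nat -> T -> 'M[R]_(m, n)) N i :
  (forall i, measurable_mx (x i)) -> measurable_mx (fun w => demean (x^~ w) N i).
Proof.
move=> mx; apply: measurable_mx_add => //; apply: measurable_mx_opp.
apply: measurable_mx_scale; first exact: measurable_cst.
exact: measurable_mx_sum.
Qed.

Lemma measurable_twfe K n (y : nat -> T -> 'cV[R]_n) (X : nat -> T -> 'M[R]_(n, K)) N :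
  (forall i, measurable_mx (y i)) -> (forall i, measurable_mx (X i)) ->
  measurable_mx (fun w => twfe (y^~ w) (X^~ w) N).
Proof.
move=> my mX.
have mXQ i : measurable_mx (fun w => (demean (X^~ w) N i)^T *m within_mx n).
  apply: measurable_mx_mul; last exact: measurable_mx_cst.
  by apply: measurable_mx_tr; exact: measurable_mx_demean.
apply: measurable_mx_mul.
  apply: measurable_invmx; apply: measurable_mx_sum => i.
  by apply: measurable_mx_mul => //; exact: measurable_mx_demean.
apply: measurable_mx_sum => i.
by apply: measurable_mx_mul => //; exact: measurable_mx_demean.
Qed.

Lemma measurable_regressor_mx K m T' (X : T -> 'M[R]_(1 + T', K)) (z : T -> 'cV[R]_m)
    theta0 lambda0 : measurable_mx X -> measurable_mx z ->
  measurable_mx (fun w => regressor_mx (X w) (z w) theta0 lambda0).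
Proof.
move=> mX mz; rewrite /regressor_mx.
have mzt : measurable_mx (fun w => (z w)^T) by exact: measurable_mx_tr.
apply: measurable_mx_col; apply: measurable_mx_row.
- apply: measurable_mx_row => //; exact: measurable_mx_usub.
- exact: measurable_mx_cst.
- apply: measurable_mx_row; first exact: measurable_mx_dsub.
  by apply: measurable_mx_mul => //; exact: measurable_mx_cst.
under eq_fun do rewrite -scalemx1.
apply: measurable_mx_scale; last exact: measurable_mx_cst.
apply: measurable_mx_coord; apply: measurable_mx_mul => //; exact: measurable_mx_cst.
Qed.

End measurable_blocks.

Section matrix_means.
Context {d : measure_display} {T : measurableType d} {R : realType}.
Variable P : probability T R.

Lemma mx_expectationE m n (F : T -> 'M[R]_(m, n)) i j :
  mx_expectation P F i j = \int[P]_w F w i j.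
Proof. by rewrite mxE unlock. Qed.

Lemma covarianceE (X Y : T -> R) :
  fine (covariance P X Y) = \int[P]_w ((X w - \int[P]_w X w) * (Y w - \int[P]_w Y w)).
Proof. by rewrite unlock /covariance unlock. Qed.

(** Integrability is carried along with the value, since [mx_expectation] assigns a number to
    nonintegrable entries too. *)
Definition has_mean m n (F : T -> 'M[R]_(m, n)) (M : 'M[R]_(m, n)) : Prop :=
  forall i j, rv_int P (fun w => F w i j) /\ \int[P]_w F w i j = M i j.

Lemma has_mean_expectation m n (F : T -> 'M[R]_(m, n)) M :
  has_mean F M -> mx_expectation P F = M.
Proof. by move=> FM; apply/matrixP => i j; rewrite mx_expectationE; case: (FM i j). Qed.

Lemma has_mean_cst m n (M : 'M[R]_(m, n)) : has_mean (fun=> M) M.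
Proof. by move=> i j; split; [exact: rv_int_cst|exact: ex_cst]. Qed.

Lemma has_meanD m n (F G : T -> 'M[R]_(m, n)) M N :
  has_mean F M -> has_mean G N -> has_mean (fun w => F w + G w) (M + N).
Proof.
move=> FM GN i j; have [iF eF] := FM i j; have [iG eG] := GN i j.
rewrite (_ : (fun w => _) = (fun w => F w i j + G w i j)); last first.
  by apply/funext => w; rewrite mxE.
by rewrite mxE -eF -eG exD//; split => //; exact: rv_intD.
Qed.

Lemma has_meanZ m n k (F : T -> 'M[R]_(m, n)) M :
  has_mean F M -> has_mean (fun w => k *: F w) (k *: M).
Proof.
move=> FM i j; have [iF eF] := FM i j.
rewrite (_ : (fun w => _) = (fun w => k * F w i j)); last first.
  by apply/funext => w; rewrite mxE.
by rewrite mxE -eF exZ//; split => //; exact: rv_intZ.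
Qed.

Lemma has_mean_sum (I : Type) (s : seq I) m n (F : I -> T -> 'M[R]_(m, n)) M :
  (forall i, has_mean (F i) (M i)) ->
  has_mean (fun w => \sum_(i <- s) F i w) (\sum_(i <- s) M i).
Proof.
move=> FM; elim: s => [|i s IHs].
  rewrite big_nil (_ : (fun w => _) = (fun=> 0)); first exact: has_mean_cst.
  by apply/funext => w; rewrite big_nil.
rewrite big_cons (_ : (fun w => _) = (fun w => F i w + \sum_(j <- s) F j w)); first exact: has_meanD.
by apply/funext => w; rewrite big_cons.
Qed.

Lemma has_mean_mulmxl m n p (A : 'M[R]_(p, m)) (F : T -> 'M[R]_(m, n)) M :
  has_mean F M -> has_mean (fun w => A *m F w) (A *m M).
Proof.
move=> FM i j.
rewrite (_ : (fun w => _) = (fun w => \sum_k A i k * F w k j)); last first.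
  by apply/funext => w; rewrite mxE.
have iAF k : rv_int P (fun w => A i k * F w k j) by apply: rv_intZ; case: (FM k j).
split; first by apply: rv_int_sum.
rewrite ex_sum// mxE; apply: eq_bigr => k _.
by have [iF <-] := FM k j; rewrite exZ.
Qed.

Lemma has_mean_tr m n (F : T -> 'M[R]_(m, n)) M :
  has_mean F M -> has_mean (fun w => (F w)^T) M^T.
Proof.
move=> FM i j; rewrite (_ : (fun w => _) = (fun w => F w j i)); last first.
  by apply/funext => w; rewrite mxE.
by rewrite mxE.
Qed.

Lemma has_mean_mulmxr m n p (A : 'M[R]_(n, p)) (F : T -> 'M[R]_(m, n)) M :
  has_mean F M -> has_mean (fun w => F w *m A) (M *m A).
Proof.
move=> /has_mean_tr/(has_mean_mulmxl A^T)/has_mean_tr; rewrite trmx_mul !trmxK.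
by rewrite (_ : (fun w => _) = (fun w => F w *m A))//; apply/funext => w; rewrite trmx_mul !trmxK.
Qed.

Lemma has_mean_col m1 m2 n (F : T -> 'M[R]_(m1, n)) (G : T -> 'M[R]_(m2, n)) M N :
  has_mean F M -> has_mean G N -> has_mean (fun w => col_mx (F w) (G w)) (col_mx M N).
Proof.
move=> FM GN i j; rewrite -[i]splitK; case: (fintype.split i) => k /=.
  by under eq_fun do rewrite col_mxEu; rewrite col_mxEu.
by under eq_fun do rewrite col_mxEd; rewrite col_mxEd.
Qed.

Lemma has_mean_row m n1 n2 (F : T -> 'M[R]_(m, n1)) (G : T -> 'M[R]_(m, n2)) M N :
  has_mean F M -> has_mean G N -> has_mean (fun w => row_mx (F w) (G w)) (row_mx M N).
Proof.
move=> FM GN i j; rewrite -[j]splitK; case: (fintype.split j) => k /=.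
  by under eq_fun do rewrite row_mxEl; rewrite row_mxEl.
by under eq_fun do rewrite row_mxEr; rewrite row_mxEr.
Qed.

Lemma has_mean_usub m1 m2 n (F : T -> 'M[R]_(m1 + m2, n)) M :
  has_mean F M -> has_mean (fun w => usubmx (F w)) (usubmx M).
Proof. by move=> FM i j; under eq_fun do rewrite mxE; rewrite mxE. Qed.

Lemma has_mean_dsub m1 m2 n (F : T -> 'M[R]_(m1 + m2, n)) M :
  has_mean F M -> has_mean (fun w => dsubmx (F w)) (dsubmx M).
Proof. by move=> FM i j; under eq_fun do rewrite mxE; rewrite mxE. Qed.

Lemma has_mean_scalar n (F : T -> 'M[R]_1) M :
  has_mean F M -> has_mean (fun w => (F w 0 0)%:M : 'M[R]_n) ((M 0 0)%:M).
Proof.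
move=> FM i j; under eq_fun do rewrite mxE; rewrite mxE.
case: (i == j); first exact: FM.
by split; [exact: rv_int_cst|exact: ex_cst].
Qed.

Lemma has_mean_regressor_mx K m T' (X : T -> 'M[R]_(1 + T', K)) (z : T -> 'cV[R]_m)
    theta0 lambda0 EX Ez : has_mean X EX -> has_mean z Ez ->
  has_mean (fun w => regressor_mx (X w) (z w) theta0 lambda0) (regressor_mx EX Ez theta0 lambda0).
Proof.
move=> XM zM; have ztM := has_mean_tr zM.
apply: has_mean_col; apply: has_mean_row.
- by apply: has_mean_row => //; exact: has_mean_usub.
- exact: has_mean_cst.
- by apply: has_mean_row; [exact: has_mean_dsub|exact: has_mean_mulmxl].
- exact: (has_mean_scalar (has_mean_mulmxr theta0 ztM)).
Qed.

Lemma has_mean_ae m n (F G : T -> 'M[R]_(m, n)) M : measurable_mx F ->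
  {ae P, forall w, F w = G w} -> has_mean G M -> has_mean F M.
Proof.
move=> mF FG GM i j; have [iG <-] := GM i j; have mG := rv_int_measurable iG.
have mFij : measurable_fun [set: T] (fun w => F w i j) by exact: measurable_mx_coord.
have FGij : {ae P, forall w, F w i j = G w i j} by apply: filterS FG => w ->.
split; last exact: ex_ae_eq.
have /integrableP[_ iGoo] := iG; apply/integrableP; split; first exact/measurable_EFinP.
rewrite (ae_eq_integral (fun w => `|(G w i j)%:E|%E))//.
- by apply: measurableT_comp => //; exact/measurable_EFinP.
- by apply: measurableT_comp => //; exact/measurable_EFinP.
- by apply: filterS FGij => w /= -> _.
Qed.

End matrix_means.

Lemma interior_translate (R : realType) n (A : set 'cV[R]_n) x0 :
  interior A x0 -> interior ((fun x => x - x0) @` A) 0.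
Proof.
move=> /nbhs_ballP[e e0 eA]; apply/nbhs_ballP; exists e => // x xe.
exists (x + x0); last by rewrite addrK.
apply: eA; move: xe; rewrite -!ball_normE/= => xe.
by rewrite opprD addrCA subrr addr0 -[`|_|]/(`| - x|) -[- x]add0r.
Qed.

Lemma compact_translate (R : realType) n (A : set 'cV[R]_n) x0 :
  compact A -> compact ((fun x => x - x0) @` A).
Proof.
move=> cA; apply: continuous_compact => //.
apply: continuous_subspaceT => x.
apply: (@continuousB R _ _ id (fun=> x0)); [exact: cvg_id|exact: cst_continuous].
Qed.

(** * The panel model *)

Section panel_model.
Context {R : realType} {d : measure_display} {Omega : measurableType d}.
Variables (P : probability Omega R) (T' K m : nat).
Variables (X : nat -> Omega -> 'M[R]_(1 + T', K)) (y eps : nat -> Omega -> 'cV[R]_(1 + T')).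
Variables (etat : nat -> Omega -> R) (beta0 : 'cV[R]_K) (delta0 Phi0 : 'cV[R]_(1 + T')).
Hypothesis X_meas : forall i, measurable_mx (X i).
Hypothesis eps_meas : forall i, measurable_mx (eps i).
Hypothesis etat_meas : forall i, measurable_fun [set: Omega] (etat i).
Hypothesis model : forall i w,
  y i w = X i w *m beta0 + delta0 + etat i w *: Phi0 + eps i w.
Hypothesis phi01_neq0 : Phi0 ord0 0 != 0.
Hypothesis etat_mean : ('E_P[etat 0%N] = 0)%E.
Hypothesis etat_var : ('V_P[etat 0%N] != 0)%E.
Hypothesis eps_mean : forall t, \int[P]_w eps 0%N w t 0 = 0.
Variables (eta : nat -> Omega -> R) (lambda0 : 'cV[R]_T').
Hypothesis eta_def : forall i w, eta i w = Phi0 ord0 0 * etat i w.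
Hypothesis lambda0_def : lambda0 = normalized_loadings Phi0.
Variables (z : nat -> Omega -> 'cV[R]_m) (S : 'I_(1 + T') -> 'M[R]_(m, K)).
Hypothesis z_meas : forall i, measurable_mx (z i).
Hypothesis S_def : forall i t, {ae P, forall w,
  (row t (pop_center P X i w))^T = (S t)^T *m pop_center P z i w}.
Variables (theta0 : 'cV[R]_m) (mu0 : R) (a : nat -> Omega -> R).
Hypothesis theta0_def : theta0 = invmx (cov_mx P (z 0%N) (z 0%N)) *m
  cov_mx P (z 0%N) (fun w => (eta 0%N w)%:M).
Hypothesis mu0_def : mu0 = - ((mx_expectation P (z 0%N))^T *m theta0) 0 0.
Hypothesis a_def : forall i w, eta i w = mu0 + ((z i w)^T *m theta0) 0 0 + a i w.
Variable v : nat -> Omega -> 'cV[R]_(m + 1 + (1 + T')).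
Hypothesis v_def : forall i w, v i w = col_mx (col_mx (z i w) (a i w)%:M) (eps i w).
Hypothesis A1 : iid P v.
Hypothesis A2star : forall k, P.-integrable [set: Omega] (fun w => (v 0%N w k 0 ^+ 4)%:E).
Hypothesis A3 : mx_expectation P (fun w => z 0%N w *m (eps 0%N w)^T) = 0.
Hypothesis A4 : pos_def (cov_mx P (z 0%N) (z 0%N)).

Let Ez := mx_expectation P (z 0%N).
Let EX := mx_expectation P (X 0%N).
Let fz (x : 'cV[R]_(m + 1 + (1 + T'))) : 'cV[R]_m := usubmx (usubmx x) - Ez.
Let fa (x : 'cV[R]_(m + 1 + (1 + T'))) : R := dsubmx (usubmx x) 0 0.
Let fe (x : 'cV[R]_(m + 1 + (1 + T'))) : 'cV[R]_(1 + T') := dsubmx x.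
Let fu x := fa x *: loadings lambda0 + fe x.
(** [eta] as a function of [v]: since [mu0] is minus the mean of [z' theta0], only the centred [z]
    appears. The moments of [eta] thus come from those of [v]. *)
Let fh x := dotv theta0 (fz x) + fa x.
Local Notation L0 := (loadings lambda0).

Let fzE i w : fz (v i w) = pop_center P z i w.
Proof. by rewrite /fz v_def !col_mxKu. Qed.
Let faE i w : fa (v i w) = a i w.
Proof. by rewrite /fa v_def col_mxKu col_mxKd mxE eqxx mulr1n. Qed.
Let feE i w : fe (v i w) = eps i w.
Proof. by rewrite /fe v_def col_mxKd. Qed.
Let fuE i w : fu (v i w) = u_err a eps lambda0 i w.
Proof. by rewrite /fu faE feE. Qed.
Let fhE i w : fh (v i w) = eta i w.
Proof.
rewrite /fh faE fzE a_def mu0_def /pop_center dotvDr dotvNr.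
by rewrite -[(_^T *m theta0) 0 0]/(dotv _ _) -[((z i w)^T *m theta0) 0 0]/(dotv _ _);
  rewrite ![dotv _ theta0]dotvC; ring.
Qed.

Let L4x k : fourth_moment P v (fun x => x k 0).
Proof.
split; last exact: A2star.
by apply: continuous_measurable_mx; exact: coord_continuous.
Qed.

Let Lz k : fourth_moment P v (fun x => fz x k 0).
Proof.
rewrite (_ : (fun x => _) = (fun x : 'cV[R]_(m + 1 + (1 + T')) => x (lshift (1 + T') (lshift 1 k)) 0 + - Ez k 0)).
  by apply: (fourth_momentD A1) => //; exact: fourth_moment_cst.
by apply/funext => x; rewrite !mxE.
Qed.
Let La : fourth_moment P v fa.
Proof.
rewrite (_ : fa = (fun x : 'cV[R]_(m + 1 + (1 + T')) => x (lshift (1 + T') (rshift m 0)) 0)) //.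
by apply/funext => x; rewrite /fa !mxE.
Qed.
Let Le t : fourth_moment P v (fun x => fe x t 0).
Proof.
rewrite (_ : (fun x => _) = (fun x : 'cV[R]_(m + 1 + (1 + T')) => x (rshift (m + 1) t) 0)) //.
by apply/funext => x; rewrite /fe mxE.
Qed.
Let Lu t : fourth_moment P v (fun x => fu x t 0).
Proof.
rewrite (_ : (fun x => _) = (fun x => L0 t 0 * fa x + fe x t 0)).
  by apply: (fourth_momentD A1) => //; exact: fourth_momentZ.
by apply/funext => x; rewrite /fu mxE [X in X + _]mxE mulrC.
Qed.
Let Lh : fourth_moment P v fh.
Proof.
rewrite (_ : fh = (fun x => \sum_k theta0 k 0 * fz x k 0 + fa x)).
  apply: (fourth_momentD A1) => //; apply: (fourth_moment_sum A1) => k.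
  exact: (fourth_momentZ _ (Lz k)).
by apply/funext => x; rewrite /fh dotvE.
Qed.

Let i1 f : fourth_moment P v f -> rv_int P (fun w => f (v 0%N w)).
Proof. exact: fourth_moment_int. Qed.
Let i2 f g : fourth_moment P v f -> fourth_moment P v g ->
  rv_int P (fun w => f (v 0%N w) * g (v 0%N w)).
Proof. exact: fourth_moment_mul_int. Qed.

Let fz_coord w k : fz (v 0%N w) k 0 = z 0%N w k 0 - \int[P]_w z 0%N w k 0.
Proof. by rewrite fzE /pop_center mxE [X in _ + X]mxE mx_expectationE. Qed.

Let z_int k : rv_int P (fun w => z 0%N w k 0).
Proof.
rewrite (_ : (fun w => _) = (fun w => fz (v 0%N w) k 0 + \int[P]_w z 0%N w k 0)).
  by apply: rv_intD; [exact: (i1 (Lz k))|exact: rv_int_cst].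
by apply/funext => w; rewrite fz_coord subrK.
Qed.

Let z0 k : \int[P]_w fz (v 0%N w) k 0 = 0.
Proof.
rewrite (funext (fun w => fz_coord w k)) exB//; last exact: rv_int_cst.
by rewrite ex_cst subrr.
Qed.

Let etatE w : etat 0%N w = (Phi0 ord0 0)^-1 * fh (v 0%N w).
Proof. by rewrite fhE eta_def mulKf. Qed.

Let etat_int : rv_int P (etat 0%N).
Proof. by rewrite (funext etatE); apply: rv_intZ; exact: i1. Qed.

Let etat0 : \int[P]_w etat 0%N w = 0.
Proof. by have := etat_mean; rewrite unlock /Rintegral => ->. Qed.

Let h0 : \int[P]_w fh (v 0%N w) = 0.
Proof.
rewrite (_ : (fun w => _) = (fun w => Phi0 ord0 0 * etat 0%N w)).
  by rewrite exZ// etat0 mulr0.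
by apply/funext => w; rewrite fhE eta_def.
Qed.

Let lin0 : \int[P]_w dotv theta0 (fz (v 0%N w)) = 0.
Proof.
rewrite (funext (fun w => dotvE theta0 (fz (v 0%N w)))) ex_sum => [|k].
  by rewrite big1// => k _; rewrite exZ ?z0 ?mulr0//; exact: (i1 (Lz k)).
by apply: rv_intZ; exact: (i1 (Lz k)).
Qed.

Let a0 : \int[P]_w fa (v 0%N w) = 0.
Proof.
rewrite (_ : (fun w => _) = (fun w => fh (v 0%N w) - dotv theta0 (fz (v 0%N w)))).
  rewrite exB ?h0 ?lin0 ?subrr//; first exact: (i1 Lh).
  rewrite (funext (fun w => dotvE theta0 (fz (v 0%N w)))); apply: rv_int_sum => k.
  by apply: rv_intZ; exact: (i1 (Lz k)).
by apply/funext => w; rewrite /fh addrC addKr.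
Qed.

Let e0 t : \int[P]_w fe (v 0%N w) t 0 = 0.
Proof. by rewrite (_ : (fun w => _) = (fun w => eps 0%N w t 0))//; apply/funext => w; rewrite feE. Qed.

Let u0 t : \int[P]_w fu (v 0%N w) t 0 = 0.
Proof.
rewrite (_ : (fun w => _) = (fun w => L0 t 0 * fa (v 0%N w) + fe (v 0%N w) t 0)).
  rewrite exD ?exZ ?a0 ?e0 ?mulr0 ?addr0//; [exact: (i1 La)| |exact: (i1 (Le t))].
  by apply: rv_intZ; exact: (i1 La).
by apply/funext => w; rewrite /fu mxE [X in X + _]mxE mulrC.
Qed.

Let M : 'M[R]_m := \matrix_(j, k) \int[P]_w (fz (v 0%N w) j 0 * fz (v 0%N w) k 0).

Let cov_zz : cov_mx P (z 0%N) (z 0%N) = M.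
Proof.
apply/matrixP => j k; rewrite mxE covarianceE [RHS]mxE.
by apply: eq_Rintegral => w _; rewrite !fz_coord.
Qed.

Let pM : pos_def M. Proof. by rewrite -cov_zz. Qed.

(** The normal equations of the projection of [eta]; orthogonality of [a] and [z] follows from
    them. *)
Let Mtheta k : (M *m theta0) k 0 = \int[P]_w (fz (v 0%N w) k 0 * fh (v 0%N w)).
Proof.
have -> : theta0 = invmx M *m cov_mx P (z 0%N) (fun w => (eta 0%N w)%:M).
  by rewrite -cov_zz; exact: theta0_def.
rewrite mulKVmx; last exact: pos_def_unitmx.
rewrite mxE covarianceE.
have etaE w : ((eta 0%N w)%:M : 'M[R]_1) 0 0 = fh (v 0%N w) by rewrite fhE mxE eqxx mulr1n.
rewrite (funext etaE) h0; apply: eq_Rintegral => w _.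
by rewrite etaE fz_coord subr0.
Qed.

Let za0 k : \int[P]_w (fz (v 0%N w) k 0 * fa (v 0%N w)) = 0.
Proof.
have := Mtheta k; rewrite mxE.
have -> : (fun w => fz (v 0%N w) k 0 * fh (v 0%N w)) = (fun w =>
    \sum_l theta0 l 0 * (fz (v 0%N w) k 0 * fz (v 0%N w) l 0) + fz (v 0%N w) k 0 * fa (v 0%N w)).
  apply/funext => w; rewrite /fh mulrDr dotvE mulr_sumr; congr (_ + _).
  by apply: eq_bigr => l _; ring.
have is_ l : rv_int P (fun w => theta0 l 0 * (fz (v 0%N w) k 0 * fz (v 0%N w) l 0)).
  by apply: rv_intZ; exact: (i2 (Lz k) (Lz l)).
rewrite exD; [|exact: rv_int_sum|exact: (i2 (Lz k) La)].
rewrite ex_sum// => /eqP; rewrite addrC -subr_eq eq_sym => /eqP ->.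
apply/eqP; rewrite subr_eq0; apply/eqP; apply: eq_bigr => l _.
by rewrite exZ ?mxE 1?mulrC//; exact: (i2 (Lz k) (Lz l)).
Qed.

(** (A3) concerns the uncentred [z]; centring is free because [eps] has mean zero. *)
Let ze0 t k : \int[P]_w (fz (v 0%N w) k 0 * fe (v 0%N w) t 0) = 0.
Proof.
have iz : rv_int P (fun w => z 0%N w k 0 * eps 0%N w t 0).
  rewrite (_ : (fun w => _) = (fun w => fz (v 0%N w) k 0 * fe (v 0%N w) t 0 +
      (\int[P]_w z 0%N w k 0) * fe (v 0%N w) t 0)).
    by apply: rv_intD; [exact: (i2 (Lz k) (Le t))|apply: rv_intZ; exact: (i1 (Le t))].
  by apply/funext => w; rewrite fz_coord feE; ring.
rewrite (_ : (fun w => _) = (fun w => z 0%N w k 0 * eps 0%N w t 0 -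
    (\int[P]_w z 0%N w k 0) * fe (v 0%N w) t 0)).
  rewrite exB//; last by apply: rv_intZ; exact: (i1 (Le t)).
  rewrite exZ ?e0 ?mulr0 ?subr0; last exact: (i1 (Le t)).
  have /matrixP/(_ k t) := A3; rewrite mx_expectationE [RHS]mxE => <-.
  by apply: eq_Rintegral => w _; rewrite [RHS]mxE big_ord1 [X in _ = _ * X]mxE.
by apply/funext => w; rewrite fz_coord feE; ring.
Qed.

Let uz0 t k : \int[P]_w (fu (v 0%N w) t 0 * fz (v 0%N w) k 0) = 0.
Proof.
rewrite (_ : (fun w => _) = (fun w => L0 t 0 * (fz (v 0%N w) k 0 * fa (v 0%N w)) +
    fz (v 0%N w) k 0 * fe (v 0%N w) t 0)).
  rewrite exD; [|apply: rv_intZ; exact: (i2 (Lz k) La)|exact: (i2 (Lz k) (Le t))].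
  by rewrite exZ ?za0 ?ze0 ?mulr0 ?addr0//; exact: (i2 (Lz k) La).
by apply/funext => w; rewrite /fu mxE [X in X + _]mxE; ring.
Qed.

Let Phi0E : Phi0 = Phi0 ord0 0 *: L0.
Proof.
rewrite lambda0_def /loadings /normalized_loadings -[LHS]vsubmxK scale_col_mx.
rewrite scalerA divff// scale1r; congr col_mx.
apply/matrixP => i j; rewrite !ord1 !mxE eqxx mulr1.
by congr (Phi0 _ _); exact: val_inj.
Qed.

(** One null set for all individuals and periods, of which there are countably many. *)
Let rowX : {ae P, forall w, forall i t,
  row t (pop_center P X i w) = (fz (v i w))^T *m S t}.
Proof.
apply: ae_foralln => i; apply: filter_forall => t.
apply: filterS (S_def i t) => w SE.
by rewrite fzE; apply: trmx_inj; rewrite SE trmx_mul trmxK.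
Qed.

Let y_E i w : y i w = X i w *m beta0 + delta0 + L0 *m ((fz (v i w))^T *m theta0) + fu (v i w).
Proof.
rewrite model /fu [in LHS]Phi0E scalerA [_ * Phi0 _ _]mulrC -eta_def -fhE /fh feE.
rewrite [_^T *m theta0]mx11_scalar mul_mx_scalar -[(_^T *m theta0) 0 0]/(dotv _ _) dotvC.
by rewrite scalerDl faE -!addrA.
Qed.

Let fzM : has_mean P (fun w => fz (v 0%N w)) 0.
Proof. by move=> k i; rewrite ord1 mxE z0; split=> //; exact: (i1 (Lz k)). Qed.

Let zM : has_mean P (z 0%N) Ez.
Proof. by move=> k i; rewrite ord1 /Ez mx_expectationE. Qed.

Let Xs w := pop_center P X 0 w.
Let Xrow w : 'M[R]_(1 + T', K) := \matrix_(t, k) ((fz (v 0%N w))^T *m S t) 0 k.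

Let Xs_meas : measurable_mx Xs.
Proof. by apply: measurable_mx_add => //; exact: measurable_mx_cst. Qed.

Let XsE : {ae P, forall w, Xs w = Xrow w}.
Proof.
apply: filterS rowX => w rw; apply/matrixP => t k; by rewrite [RHS]mxE -rw [RHS]mxE.
Qed.

(** Moment assumptions bear on [v] only; the regressors inherit integrability from [z] through the
    almost sure identity. *)
Let XsM : has_mean P Xs 0.
Proof.
apply: has_mean_ae XsE _ => // t k.
rewrite (_ : (fun w => _) = (fun w => ((fz (v 0%N w))^T *m S t) 0 k)); last first.
  by apply/funext => w; rewrite mxE.
have := has_mean_mulmxr (S t) (has_mean_tr fzM) 0 k.
by rewrite trmx0 mul0mx !mxE.
Qed.

Let XM : has_mean P (X 0%N) EX.
Proof.
have := has_meanD XsM (has_mean_cst P EX); rewrite add0r.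
by rewrite (_ : (fun w => _) = X 0%N)//; apply/funext => w; rewrite /Xs /pop_center subrK.
Qed.

Let Rs w := pop_center P (Rmx X z theta0 lambda0) 0 w.

Let RsE w : Rs w = regressor_mx (Xs w) (fz (v 0%N w)) theta0 lambda0.
Proof.
rewrite /Rs /pop_center (has_mean_expectation (has_mean_regressor_mx theta0 lambda0 XM zM)).
by rewrite /Rmx regressor_mxB fzE.
Qed.

Let Rs_meas : measurable_mx Rs.
Proof.
rewrite (funext RsE); apply: measurable_regressor_mx => //.
rewrite (funext (fzE 0%N)); apply: measurable_mx_add => //; exact: measurable_mx_cst.
Qed.

Let RsXs_row : {ae P, forall w, (forall t, row t (Rs w) =
    (fz (v 0%N w))^T *m reduced_jac S theta0 lambda0 t) /\
  forall t, row t (Xs w) = (fz (v 0%N w))^T *m S t}.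
Proof.
apply: filterS rowX => w rw; split=> t; last exact: rw.
by rewrite RsE; apply: regressor_mx_row; exact: rw.
Qed.

Let fzzM : has_mean P (fun w => fz (v 0%N w) *m (fz (v 0%N w))^T) M.
Proof.
move=> j k; rewrite (_ : (fun w => _) = (fun w => fz (v 0%N w) j 0 * fz (v 0%N w) k 0)).
  by rewrite mxE; split=> //; exact: (i2 (Lz j) (Lz k)).
by apply/funext => w; rewrite mxE big_ord1 [X in _ * X]mxE.
Qed.

Let H0 : 'M[R]_(K + m + T') :=
  \sum_t (reduced_jac S theta0 lambda0 t)^T *m M *m reduced_jac S theta0 lambda0 t.

Let RsM : has_mean P (fun w => (Rs w)^T *m Rs w) H0.
Proof.
apply: (has_mean_ae (G := fun w => \sum_t (reduced_jac S theta0 lambda0 t)^T *m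
    (fz (v 0%N w) *m (fz (v 0%N w))^T) *m reduced_jac S theta0 lambda0 t)).
- by apply: measurable_mx_mul => //; exact: measurable_mx_tr.
- apply: filterS RsXs_row => w [rw _]; rewrite trmx_mul_rows; apply: eq_bigr => t _.
  by rewrite rw trmx_mul trmxK !mulmxA.
by apply: has_mean_sum => t; apply: has_mean_mulmxr; exact: has_mean_mulmxl.
Qed.

Local Notation Q := (within_mx (1 + T') : 'M[R]_(1 + T')).

Let XQXM : has_mean P (fun w => (Xs w)^T *m Q *m Xs w) (within_form S M).
Proof.
apply: (has_mean_ae (G := fun w => within_form S (fz (v 0%N w) *m (fz (v 0%N w))^T))).
- apply: measurable_mx_mul => //; apply: measurable_mx_mul; last exact: measurable_mx_cst.
  exact: measurable_mx_tr.
- apply: filterS RsXs_row => w [_ rw]; rewrite mulmx_rows.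
  apply: eq_bigr => t _; apply: eq_bigr => s _.
  by rewrite !rw trmx_mul trmxK !mulmxA.
apply: has_mean_sum => t; apply: has_mean_sum => s; apply: has_meanZ.
by apply: has_mean_mulmxr; exact: has_mean_mulmxl.
Qed.

Let Rp := Rplus P X z theta0 lambda0 0.

Let Rp_meas : measurable_mx Rp.
Proof.
rewrite /Rp /Rplus; apply: measurable_mx_col; apply: measurable_mx_row => //.
- exact: measurable_mx_cst.
- exact: measurable_mx_cst.
by apply: measurable_mx_mul => //; exact: measurable_mx_cst.
Qed.

Let HplusE : Hplus P X z theta0 lambda0 = block_mx H0 0 0 (within_form S M).
Proof.
apply: has_mean_expectation.
rewrite (_ : (fun w => _) = (fun w => block_mx ((Rs w)^T *m Rs w) 0 0 ((Xs w)^T *m Q *m Xs w))).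
  apply: has_mean_col; apply: has_mean_row => //; exact: has_mean_cst.
apply/funext => w; rewrite /Rplus tr_block_mx mulmx_block !trmx0 !mul0mx !mulmx0 !addr0 !add0r.
by rewrite trmx_mul within_mx_sym -!mulmxA [Q *m (Q *m _)]mulmxA within_mx_idem !mulmxA.
Qed.

Let Ey : mx_expectation P (y 0%N) = EX *m beta0 + delta0.
Proof.
apply: has_mean_expectation.
rewrite (_ : y 0%N = (fun w => X 0%N w *m beta0 + delta0 + (fh (v 0%N w) *: L0 + fe (v 0%N w)))).
  rewrite -[EX *m beta0 + delta0]addr0; apply: has_meanD.
    by apply: has_meanD; [exact: has_mean_mulmxr|exact: has_mean_cst].
  rewrite -[0]addr0; apply: has_meanD => t j; rewrite ord1.
    rewrite (_ : (fun w => _) = (fun w => L0 t 0 * fh (v 0%N w))).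
      by rewrite exZ ?h0 ?mulr0 ?mxE//; [split=> //; apply: rv_intZ|]; exact: (i1 Lh).
    by apply/funext => w; rewrite mxE mulrC.
  by rewrite e0 mxE; split=> //; exact: (i1 (Le t)).
apply/funext => w; rewrite model feE fhE eta_def [in LHS]Phi0E scalerA -!addrA.
by rewrite [_ * Phi0 _ _]mulrC.
Qed.

Let us w := uplus P X y a eps beta0 lambda0 0 w.

(** The composite error [Lambda0 eta + eps] splits into the projection on [z] and the error [u]. The
    first part is correlated with the regressors in general, and (A) or (B) is what removes it from
    the mean of the TWFE score. *)
Let dresE w : pop_center P y 0 w - Xs w *m beta0 =
  L0 *m ((fz (v 0%N w))^T *m theta0) + fu (v 0%N w).
Proof.
rewrite /Xs /pop_center Ey y_E mulmxBl.
move: (X 0%N w *m beta0) (EX *m beta0) (L0 *m _) (fu _) => p q r s.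
by apply/matrixP => i j; rewrite !mxE; ring.
Qed.

Let score := joint_score fz fu S theta0 lambda0.

Let scoreE : {ae P, forall w, (Rp w)^T *m us w = score (v 0%N w)}.
Proof.
apply: filterS RsXs_row => w [Rrow Xrow_].
rewrite /Rp /Rplus /us /uplus tr_block_mx mul_block_col !trmx0 !mul0mx addr0 add0r.
rewrite -/(Rs w) -/(Xs w) dresE -fuE; congr col_mx.
  rewrite trmx_mul_rows; apply: eq_bigr => t _.
  rewrite Rrow trmx_mul trmxK -mulmxA; congr (_ *m _).
  by rewrite [row t _]mx11_scalar mul_mx_scalar mxE.
rewrite trmx_mul within_mx_sym mulmx_rows; apply: eq_bigr => t _; apply: eq_bigr => s _.
rewrite Xrow_ trmx_mul trmxK -[_ *m _ *m row s _]mulmxA; congr (_ *: (_ *m _)).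
rewrite [row s _]mx11_scalar mul_mx_scalar -[_ *m _^T *m theta0]mulmxA.
rewrite [_^T *m theta0]mx11_scalar !mul_mx_scalar scalerA -scalerDl; congr (_ *: _).
by rewrite [LHS]mxE [LHS]mxE [X in X + _]mxE mulrC.
Qed.

Let y_meas i : measurable_mx (y i).
Proof.
rewrite (funext (model i)); apply: measurable_mx_add => //; apply: measurable_mx_add.
  apply: measurable_mx_add; last exact: measurable_mx_cst.
  by apply: measurable_mx_mul => //; exact: measurable_mx_cst.
by apply: measurable_mx_scale => //; exact: measurable_mx_cst.
Qed.

Let us_meas : measurable_mx us.
Proof.
apply: measurable_mx_col.
  apply: measurable_mx_add => //; apply: measurable_mx_scale; last exact: measurable_mx_cst.
  rewrite -(funext (faE 0%N)).
  exact: (fourth_moment_measurable A1 0%N La).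
apply: measurable_mx_add; last first.
  by apply: measurable_mx_opp; apply: measurable_mx_mul => //; exact: measurable_mx_cst.
by apply: measurable_mx_add => //; exact: measurable_mx_cst.
Qed.

Let AplusE : Aplus P X y z a eps beta0 theta0 lambda0 =
  \matrix_(j, k) \int[P]_w (score (v 0%N w) j 0 * score (v 0%N w) k 0).
Proof.
apply: has_mean_expectation.
apply: (has_mean_ae (G := fun w => score (v 0%N w) *m (score (v 0%N w))^T)).
- apply: measurable_mx_mul => //; apply: measurable_mx_mul; last exact: measurable_mx_tr.
  by apply: measurable_mx_mul => //; exact: measurable_mx_tr.
- by apply: filterS scoreE => w <-; rewrite trmx_mul trmxK !mulmxA.
move=> j k; rewrite [(\matrix_(_, _) _) j k]mxE.
rewrite (_ : (fun w => _) = (fun w => score (v 0%N w) j 0 * score (v 0%N w) k 0)).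
  split=> //; have sq l := joint_score_square A1 Lz Lu S theta0 lambda0 l.
  apply: rv_int_mul; [exact: (iid_measurable_comp A1 _ (sq j).1)|
    exact: (iid_measurable_comp A1 _ (sq k).1)|exact: (sq j).2|exact: (sq k).2].
by apply/funext => w; rewrite mxE big_ord1 [X in _ * X]mxE.
Qed.

Hypothesis AB : L0 = ones_vec (1 + T') \/
  exists Phix0 : 'rV[R]_K, forall t, regressor_loading P (etat 0%N) (X 0%N) t = Phix0.

(** A nonzero extended variance could be infinite, with [fine] equal to zero; the fourth moments of
    [v] exclude this. *)
Let etat_var0 : fine 'V_P[etat 0%N]%E != 0.
Proof.
have iV : rv_int P (fun w => (etat 0%N w - fine 'E_P[etat 0%N]%E) * (etat 0%N w - fine 'E_P[etat 0%N]%E)).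
  rewrite etat_mean/= (_ : (fun w => _) = (fun w => (Phi0 ord0 0)^-2 * (fh (v 0%N w) * fh (v 0%N w)))).
    by apply: rv_intZ; exact: (i2 Lh Lh).
  by apply/funext => w; rewrite etatE subr0 -exprVn; ring.
rewrite fine_eq0 ?etat_var// /variance unlock.
have := integrable_fin_num measurableT iV; rewrite unlock.
by [].
Qed.

(** Both sides are the covariance of [x_t] with [eta]: [M *m theta0] is that of [z] with [eta], and
    [S_t'] carries the centred [z] to the centred [x_t]. *)
Let loading_E t : (S t)^T *m (M *m theta0) =
  (Phi0 ord0 0 * fine 'V_P[etat 0%N]%E) *: (regressor_loading P (etat 0%N) (X 0%N) t)^T.
Proof.
apply/matrixP => k j; rewrite ord1 mxE [RHS]mxE [X in _ = _ * X]mxE [X in _ = _ * X]mxE.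
rewrite -mulrA mulVKf// covarianceE etat0.
have XtM := XM t k; have [iX eX] := XtM; rewrite eX.
have fE : (fun w => etat 0%N w * ((fz (v 0%N w))^T *m S t) 0 k) = (fun w =>
    \sum_l ((Phi0 ord0 0)^-1 * S t l k) * (fz (v 0%N w) l 0 * fh (v 0%N w))).
  apply/funext => w; rewrite etatE mxE mulr_sumr; apply: eq_bigr => l _.
  by rewrite mxE; ring.
have il l : rv_int P (fun w => ((Phi0 ord0 0)^-1 * S t l k) * (fz (v 0%N w) l 0 * fh (v 0%N w))).
  by apply: rv_intZ; exact: (i2 (Lz l) Lh).
have iE : rv_int P (fun w => etat 0%N w * ((fz (v 0%N w))^T *m S t) 0 k).
  by rewrite fE; exact: rv_int_sum.
transitivity (Phi0 ord0 0 * \int[P]_w (etat 0%N w * ((fz (v 0%N w))^T *m S t) 0 k)).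
  rewrite fE ex_sum// mulr_sumr; apply: eq_bigr => l _.
  rewrite mxE Mtheta exZ; last exact: (i2 (Lz l) Lh).
  by rewrite !mulrA mulfV// mul1r.
congr (_ * _); apply: ex_ae_eq.
- exact: rv_int_measurable iE.
- apply: measurable_funM; first by apply: measurable_funB => //; exact: measurable_cst.
  by apply: measurable_funB; [exact: rv_int_measurable iX|exact: measurable_cst].
by apply: filterS XsE => w XE; have /matrixP/(_ t k) := XE; rewrite [X in X = _ -> _]mxE
  [X in _ + X = _ -> _]mxE [X in _ = X -> _]mxE subr0 => ->.
Qed.

(* Under (A) the rows of Q sum to 0; under (B) it is the columns, since
   S_t' M theta0 = E(x*_t eta) is then the same for all t. *)
Let within_score_eq0 : within_score S theta0 lambda0 M (fun=> 0) = 0.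
Proof.
have [LE|[Phix0 Phix]] := AB.
  have o1 s : ones_vec (1 + T') s 0 = 1 :> R by rewrite mxE.
  apply: big1 => t _; rewrite LE.
  rewrite (eq_bigr (fun s => Q t s *: ((S t)^T *m (M *m theta0)))) => [|s _].
    by rewrite -scaler_suml within_mx_row_sum scale0r.
  by rewrite addr0 o1 scale1r.
rewrite /within_score exchange_big big1// => s _.
pose c := L0 s 0 *: ((Phi0 ord0 0 * fine 'V_P[etat 0%N]%E) *: Phix0^T).
rewrite (eq_bigr (fun t => Q t s *: c)) => [|t _].
  by rewrite -scaler_suml within_mx_col_sum scale0r.
by rewrite addr0 -scalemxAr loading_E Phix.
Qed.

Variables (psi0 : 'cV[R]_(K + m + T')) (Psi Psibar : set 'cV[R]_(K + m + T')).
Variable psihat : nat -> Omega -> 'cV[R]_(K + m + T').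
Hypothesis psi0_def : psi0 = col_mx (col_mx beta0 theta0) lambda0.
Hypothesis Psibar_compact : compact Psibar.
Hypothesis Psibar_sub : Psibar `<=` Psi.
Hypothesis psi0_int : interior Psibar psi0.
Hypothesis psihat_meas : forall n, measurable_mx (psihat n).
Hypothesis psihat_min : forall n w, (0 < n)%N ->
  is_minimizer_over Psibar (objective (y^~ w) (X^~ w) (z^~ w) n) (psihat n w).
Hypothesis A5 : forall psi, Psi psi -> psi <> psi0 ->
  exists t, reduced_coef psi S t <> reduced_coef psi0 S t.
Hypothesis twfe_defined : mx_expectation P (fun w =>
  (pop_center P X 0 w)^T *m within_mx (1 + T') *m pop_center P X 0 w) \in unitmx.
Hypothesis H0_nonsing : mx_expectation P (fun w =>
  (pop_center P (Rmx X z theta0 lambda0) 0 w)^T *m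
   pop_center P (Rmx X z theta0 lambda0) 0 w) \in unitmx.

Lemma panel_joint_normality : cvg_to_normal P
  (fun n w => Num.sqrt n%:R *:
     col_mx (psihat n w - psi0) (twfe (y^~ w) (X^~ w) n - beta0)) 0
  (invmx (Hplus P X z theta0 lambda0) *m Aplus P X y z a eps beta0 theta0 lambda0 *m
   invmx (Hplus P X z theta0 lambda0)).
Proof.
have uH0 : H0 \in unitmx by rewrite -(has_mean_expectation RsM).
have uG0 : within_form S M \in unitmx by rewrite -(has_mean_expectation XQXM).
(* The limit theorem yields a sandwich whose right factor is a transposed inverse; symmetry removes
   the transpose. *)
have Hsym : (Hplus P X z theta0 lambda0)^T = Hplus P X z theta0 lambda0.
  apply/matrixP => i j; rewrite mxE !mx_expectationE; apply: eq_Rintegral => w _.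
  by rewrite -[in LHS](trmxK (Rplus P X z theta0 lambda0 0 w)) -trmx_mul trmxK mxE.
have invE : invmx (Hplus P X z theta0 lambda0) = (invmx (Hplus P X z theta0 lambda0))^T.
  by rewrite trmx_inv Hsym.
rewrite {2}invE AplusE HplusE.
have XE w i : X i w = EX + pop_center P X i w by rewrite /pop_center addrC subrK.
have zE w i : z i w = Ez + fz (v i w) by rewrite fzE /pop_center addrC subrK.
apply: (joint_asymptotic_normality A1 Lz Lu z0 u0 uz0 within_score_eq0 pM uH0 uG0
  (compact_translate (x0 := psi0) Psibar_compact) (interior_translate psi0_int) _
  (xhat := fun n w => psihat n w - psi0) (bhat := fun n w => twfe (y^~ w) (X^~ w) n - beta0)).
- move=> _ [psi Apsi <-] psi_neq0.
  have psi_neq : psi <> psi0 by move=> psiE; rewrite psiE subrr eqxx in psi_neq0.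
  have [t st] := A5 (Psibar_sub Apsi) psi_neq; exists t.
  rewrite (reduced_devE _ _ _ beta0) -psi0_def [psi0 + _]addrC subrK subr_eq0.
  exact/eqP.
- by move=> n; apply: measurable_mx_add => //; exact: measurable_mx_cst.
- move=> n; apply: measurable_mx_add; last exact: measurable_mx_cst.
  exact: measurable_twfe.
- move=> n n0; apply: filterS rowX => w rw.
  rewrite psi0_def.
  exact: (objective_minimizer (XE w) (zE w) rw (y_E^~ w) n0 (psihat_min w n0)).
- move=> n n0; apply: filterS rowX => w rw.
  exact: (twfeE (XE w) rw (y_E^~ w) n0).
Qed.

End panel_model.

Theorem theorem3 (R : realType) (d : measure_display) (Omega : measurableType d)
  (P : probability Omega R)
  (T' K m : nat) (two_periods : (2 <= 1 + T')%N)
  (* interactive effects model *)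
  (X : nat -> Omega -> 'M[R]_(1 + T', K))
  (y eps : nat -> Omega -> 'cV[R]_(1 + T'))
  (etat : nat -> Omega -> R)
  (beta0 : 'cV[R]_K) (delta0 Phi0 : 'cV[R]_(1 + T'))
  (X_meas : forall i, measurable_mx (X i))
  (eps_meas : forall i, measurable_mx (eps i))
  (etat_meas : forall i, measurable_fun [set: Omega] (etat i))
  (model : forall i w,
    y i w = X i w *m beta0 + delta0 + etat i w *: Phi0 + eps i w)
  (phi01_neq0 : Phi0 ord0 0 != 0)
  (etat_mean : forall i, ('E_P[etat i] = 0)%E)
  (etat_var : forall i, ('V_P[etat i] != 0)%E)
  (eps_cond : forall i t,
    is_cond_expectation P (fun w => eps i w t 0)
      (fun w => col_mx (col_mx (row t (X i w))^T (delta0 t 0)%:M)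
                       (Phi0 t 0 * etat i w)%:M)
      (fun=> 0))
  (* normalized effects and loadings *)
  (eta : nat -> Omega -> R) (lambda0 : 'cV[R]_T')
  (eta_def : forall i w, eta i w = Phi0 ord0 0 * etat i w)
  (lambda0_def : lambda0 = normalized_loadings Phi0)
  (* z_i consists of distinct entries of X_i, and all entries of X_i are,
     up to centering, linear combinations of those of z_i *)
  (z : nat -> Omega -> 'cV[R]_m) (sel : 'I_m -> 'I_(1 + T') * 'I_K)
  (S : 'I_(1 + T') -> 'M[R]_(m, K))
  (sel_inj : injective sel)
  (z_def : forall i w j, z i w j 0 = X i w (sel j).1 (sel j).2)
  (S_def : forall i t,
    {ae P, forall w,
      (row t (pop_center P X i w))^T = (S t)^T *m pop_center P z i w})
  (* linear projection of eta_i on 1 and z_i *)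
  (theta0 : 'cV[R]_m) (mu0 : R) (a : nat -> Omega -> R)
  (theta0_def : forall i, theta0 =
    invmx (cov_mx P (z i) (z i)) *m cov_mx P (z i) (fun w => (eta i w)%:M))
  (mu0_def : forall i, mu0 = - ((mx_expectation P (z i))^T *m theta0) 0 0)
  (a_def : forall i w, eta i w = mu0 + ((z i w)^T *m theta0) 0 0 + a i w)
  (* parameter space and estimator *)
  (psi0 : 'cV[R]_(K + m + T'))
  (psi0_def : psi0 = col_mx (col_mx beta0 theta0) lambda0)
  (Psi Psibar : set 'cV[R]_(K + m + T'))
  (psi0_Psi : Psi psi0)
  (Psibar_compact : compact Psibar)
  (Psibar_sub : Psibar `<=` Psi)
  (psi0_int : interior Psibar psi0)
  (psihat : nat -> Omega -> 'cV[R]_(K + m + T'))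
  (psihat_meas : forall n, measurable_mx (psihat n))
  (psihat_min : forall n w, (0 < n)%N ->
    is_minimizer_over Psibar (objective (y^~ w) (X^~ w) (z^~ w) n) (psihat n w))
  (* (A1)-(A5) *)
  (v : nat -> Omega -> 'cV[R]_(m + 1 + (1 + T')))
  (v_def : forall i w, v i w = col_mx (col_mx (z i w) (a i w)%:M) (eps i w))
  (A1 : iid P v)
  (A2star : forall i k,
    P.-integrable [set: Omega] (fun w => (v i w k 0 ^+ 4)%:E))
  (A3 : mx_expectation P (fun w => z 0%N w *m (eps 0%N w)^T) = 0)
  (A4 : pos_def (cov_mx P (z 0%N) (z 0%N)))
  (A5 : forall psi, Psi psi -> psi <> psi0 ->
    exists t, reduced_coef psi S t <> reduced_coef psi0 S t)
  (* existence of the inverse of H_0^+ *)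
  (twfe_defined : mx_expectation P (fun w =>
    (pop_center P X 0 w)^T *m within_mx (1 + T') *m pop_center P X 0 w) \in unitmx)
  (H0_nonsing : mx_expectation P (fun w =>
    (pop_center P (Rmx X z theta0 lambda0) 0 w)^T *m
     pop_center P (Rmx X z theta0 lambda0) 0 w) \in unitmx)
  (* (A) or (B) *)
  (AB : loadings lambda0 = ones_vec (1 + T') \/
    exists Phix0 : 'rV[R]_K,
      forall t, regressor_loading P (etat 0%N) (X 0%N) t = Phix0) :
  cvg_to_normal P
    (fun n w => Num.sqrt n%:R *:
       col_mx (psihat n w - psi0) (twfe (y^~ w) (X^~ w) n - beta0))
    0
    (invmx (Hplus P X z theta0 lambda0)
     *m Aplus P X y z a eps beta0 theta0 lambda0
     *m invmx (Hplus P X z theta0 lambda0)).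
Proof.
have z_meas i : measurable_mx (z i).
  apply: measurable_mx_coords => j k; rewrite ord1.
  by rewrite (funext (fun w => z_def i w j)); exact: measurable_mx_coord.
(* The conditional mean, integrated over the whole space. *)
have eps_mean t : \int[P]_w eps 0%N w t 0 = 0.
  have [_ _ _ /(_ setT measurableT)] := eps_cond 0%N t.
  by rewrite preimage_setT integral0 /Rintegral => <-.
exact: (panel_joint_normality X_meas eps_meas etat_meas model phi01_neq0 (etat_mean 0%N)
  (etat_var 0%N) eps_mean eta_def lambda0_def z_meas S_def (theta0_def 0%N) (mu0_def 0%N)
  a_def v_def A1 (A2star 0%N) A3 A4 AB psi0_def Psibar_compact Psibar_sub psi0_int
  psihat_meas psihat_min A5 twfe_defined H0_nonsing).
Qed.
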